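(* Let $(X,(p_j)_{j\ge 1})$ be a Fréchet space possessing a Schauder basis $(e_n)_{n\ge 0}$. Suppose that $p_1(e_n)>0$ for every $n\ge 0$ and that for every $\varepsilon>0$, every $C,M,N\ge 1$ and every $K\ge J\ge 2$ (with $M,N,J,K$ integers), there exist indices $(n_{j,m})_{1\le j\le J,\, 1\le m\le M}\subset \,]N,\infty[$ with $n_{j,m}\ne n_{j',m'}$ for every $(j,m)\ne (j',m')$, and a family $(\alpha_{j,m})_{1\le j\le J,\,1\le m\le M}$ of non-zero scalars such that for every $1\le j \le J$ and every $1\le m\le M$: (1) $p_{J-1}(\alpha_{1,m}e_{n_{1,m}})\le \varepsilon$; (2) $p_1(\alpha_{J,m}e_{n_{J,m}})\ge \frac{1}{\varepsilon}$; (3) for every $1\le l\le M$, if $\mathrm{next}^l(j,m)$ exists then for every $1\le k< K$, $$C\, p_k\big(\alpha_{\mathrm{next}^{l}(j,m)}e_{n_{\mathrm{next}^{l}(j,m)}}\big)\le p_{k+1}(\alpha_{j,m}e_{n_{j,m}}).$$ Then $X$ does not satisfy the Invariant Subset Property.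
   Context: A Fréchet space $(X,(p_j)_{j\ge1})$ (over $\mathbb{K}=\mathbb{R}$ or $\mathbb{C}$) is a topological vector space whose topology is induced by a non-decreasing and separating sequence of seminorms $(p_j)_{j\ge 1}$ such that the metric $d(x,y)=\sum_{j\ge 1}2^{-j}\min\{1,p_j(x-y)\}$ is complete; $(p_j)$ is always assumed non-decreasing and separating. For the finite index set $\{(j,m):1\le j\le J,\,1\le m\le M\}$ endowed with the lexicographical order, $\mathrm{next}(j,m)$ denotes the next element after $(j,m)$ (it does not exist for $(J,M)$), and $\mathrm{next}^l$ is its $l$-fold iterate. A continuous linear operator $T:X\to X$ possesses a non-trivial invariant subset if there exists a non-empty closed subset $M$ of $X$, different from $\{0\}$ and $X$, such that $TM\subset M$. The space $X$ satisfies the Invariant Subset Property if every continuous linear operator on $X$ possesses a non-trivial invariant subset. *)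

(* Defs.v *)
From HB Require Import structures.
From mathcomp Require Import all_boot all_order all_algebra.
From mathcomp Require Import complex.
From mathcomp Require Import all_classical all_reals all_analysis.

Set Implicit Arguments.
Unset Strict Implicit.
Unset Printing Implicit Defensive.

Import Order.TTheory GRing.Theory Num.Theory.
Import numFieldNormedType.Exports.
Local Open Scope classical_set_scope.
Local Open Scope ring_scope.

Inductive scalar_kind := RealScalars | ComplexScalars.

Definition scalars (R : realType) (s : scalar_kind) : numFieldType :=
  match s with
  | RealScalars => R
  | ComplexScalars => (R[i])%C
  end.

(* The norm of the numFieldType R[i] takes its values in R[i]; modulus is the
   same number, as an element of R. *)
Definition modulus (R : realType) (s : scalar_kind) : scalars R s -> R :=
  match s with
  | RealScalars => fun a : R => `|a|
  | ComplexScalars => fun a : (R[i])%C => ComplexField.Normc.normc a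
  end.

(* A sequence (p_j)_{j >= 1} is given by a function p on nat; the value p 0 is
   never used. *)
Section Frechet.
Context (R : realType) (s : scalar_kind) (X : topologicalLmodType (scalars R s)).

Definition is_seminorm (q : X -> R) : Prop :=
  [/\ forall x, 0 <= q x,
      forall (a : scalars R s) x, q (a *: x) = modulus a * q x &
      forall x y, q (x + y) <= q x + q y].

Definition induces_topology (p : nat -> X -> R) : Prop :=
  forall (x : X) (A : set X), nbhs x A <->
    exists (J : nat) (r : R), 0 < r /\
      [set y | forall j, (1 <= j <= J)%N -> p j (y - x) < r] `<=` A.

Definition frechet_dist (p : nat -> X -> R) (x y : X) : R :=
  limn (fun n => \sum_(1 <= j < n) 2 ^- j * Num.min 1 (p j (x - y))).

Definition complete_dist (d : X -> X -> R) : Prop :=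
  forall u : nat -> X,
    (forall eps : R, 0 < eps -> exists N : nat, forall m n : nat,
       (N <= m)%N -> (N <= n)%N -> d (u m) (u n) < eps) ->
    exists x : X, (fun n => d (u n) x) @ \oo --> (0 : R).

Definition frechet_space (p : nat -> X -> R) : Prop :=
  [/\ forall j, (1 <= j)%N -> is_seminorm (p j),
      forall j x, (1 <= j)%N -> p j x <= p j.+1 x,
      forall x, (forall j, (1 <= j)%N -> p j x = 0) -> x = 0,
      induces_topology p &
      complete_dist (frechet_dist p)].

Definition schauder_basis (e : nat -> X) : Prop :=
  forall x : X, exists! a : nat -> scalars R s,
    (fun n => \sum_(0 <= k < n) a k *: e k) @ \oo --> x.

Definition nontrivial_invariant_subset (T : X -> X) (A : set X) : Prop :=
  [/\ A !=set0, closed A, A <> [set 0], A <> setT & T @` A `<=` A].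

Definition invariant_subset_property : Prop :=
  forall T : {linear X -> X}, continuous T ->
    exists A : set X, nontrivial_invariant_subset T A.

End Frechet.

Definition index_set (J M : nat) : set (nat * nat) :=
  [set i | (1 <= i.1 <= J)%N /\ (1 <= i.2 <= M)%N].

(* i' is the successor of i in index_set J M for the lexicographic order; no
   such i' exists when i = (J, M). *)
Definition is_next (J M : nat) (i i' : nat *l nat) : Prop :=
  [/\ index_set J M i', (i < i')%O &
      forall i'' : nat *l nat, index_set J M i'' -> (i < i'')%O -> (i' <= i'')%O].

Fixpoint is_next_iter (J M l : nat) (i i' : nat * nat) : Prop :=
  match l with
  | 0 => i = i'
  | l'.+1 => exists2 i'', is_next J M i i'' & is_next_iter J M l' i'' i'
  end.

(* Main.v *)
Require Import Defs.
From HB Require Import structures.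
From mathcomp Require Import all_boot all_order all_algebra.
From mathcomp Require Import complex.
From mathcomp Require Import all_classical all_reals all_analysis.
From mathcomp Require Import zify ring lra.

Set Implicit Arguments.
Unset Strict Implicit.
Unset Printing Implicit Defensive.

Import Order.TTheory GRing.Theory Num.Theory.
Import numFieldNormedType.Exports.
Local Open Scope classical_set_scope.
Local Open Scope ring_scope.

(** The operator T is built in the manner of Read and is made such that every
    non-zero vector has a dense orbit; a non-empty closed invariant set other than
    {0} contains a non-zero vector, hence is the whole space.

    The data is a sequence z_0, z_1, ... of non-zero multiples of the basis vectors,
    each used once. T is given by the orbit f_i = T^i z_0, and the orbit by the
    relations f_i = z_i, except at certain positions c_s + l with l < n_s, where
      f_(c_s + l) = z_(c_s + l) + P_s(T) f_l.
    So T^(c_s) coincides with P_s(T) on E_s, the span of the z_i with i < n_s, up to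
    the vectors v_l = z_(c_s + l). The polynomials P_s and the seminorms q_(j_s) in
    which v_l is small run through a schedule: every polynomial is approximated, and
    every seminorm index occurs, infinitely often and in all combinations; the
    polynomial 1 also occurs exactly.

    A stage consists of three groups of positions, u, g and v. Both u and v come from
    the chains given by the hypothesis: v is the first row of a chain, small for
    q_(j_s) and, by the descent through the rows, large for the next seminorm. The
    vector g supplies a missing basis vector and is scaled to be huge. The chain u is
    placed before g and v but is chosen after them; it starts tiny and ends huge. So
    T leads from large vectors to smaller ones at the end of u and at g, while at the
    end of v, where the perturbation is switched off, it leads to the tiny starts of
    two chains u. As a result (shift_small) bounded positive powers of T lose only
    one seminorm and gain an arbitrarily large factor on each stage. This makes T
    continuous, and it makes T^(c_s) small on the tail of every vector (tail_small).
    On v itself T^(c_s) is governed by -P_s(T)^2 f_l, which is harmless because v_l is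
    large for the seminorm that follows q_(j_s).

    Given x <> 0, consider a late stage s with P_s = 1 and the head of x in E_(s+1),
    written as A(T) z_0. The coordinates of x on v are so small that some coefficient
    of A of degree below n_s is not too small (head_pivot). Hence there is P without
    constant term such that P A is 'X^(c_s) up to a small error and up to degrees
    where the orbit is tiny (approximate_division). For a later stage s' with P_s'
    close to P, T^(c_s') x is close to P(T) A(T) z_0, thus to f_(c_s), thus to z_0
    (orbit_approaches_start). So z_0 lies in the closure of every non-zero orbit, and
    the orbit of z_0 itself approaches all P_s(T) z_0, that is, a dense set.

    The tails are estimated by means of the coordinates of x, so the coordinate
    functionals of the Schauder basis have to be continuous, uniformly in the sense
    of psum_equicontinuous. This is the classical argument: Baire's theorem and the
    open mapping theorem for the seminorms sup_N q_k(S_N x), where S_N are the partial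
    sums of the expansion. *)

(** * Absolute values and the l1 norm of polynomials *)

Definition absolute_value (R : realType) (K : fieldType) (nu : K -> R) : Prop :=
  [/\ forall a, 0 <= nu a,
      forall a, nu a = 0 <-> a = 0,
      forall a b, nu (a * b) = nu a * nu b &
      forall a b, nu (a + b) <= nu a + nu b].

Section AbsoluteValue.
Variables (R : realType) (K : fieldType) (nu : K -> R).
Hypothesis nuP : absolute_value nu.

Lemma nu_ge0 a : 0 <= nu a. Proof. by case: nuP. Qed.

Lemma nuM a b : nu (a * b) = nu a * nu b. Proof. by case: nuP. Qed.

Lemma nuD a b : nu (a + b) <= nu a + nu b. Proof. by case: nuP. Qed.

Lemma nu0 : nu 0 = 0. Proof. by case: nuP => _ h _ _; exact/h. Qed.

Lemma nu_eq0 a : (nu a == 0) = (a == 0).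
Proof. by case: nuP => _ h _ _; apply/eqP/eqP => /h. Qed.

Lemma nu_gt0 a : (0 < nu a) = (a != 0).
Proof. by rewrite lt_neqAle nu_ge0 andbT eq_sym nu_eq0. Qed.

Lemma nu1 : nu 1 = 1.
Proof.
have h : nu 1 != 0 by rewrite nu_eq0 oner_eq0.
by apply: (mulfI h); rewrite -nuM !mulr1.
Qed.

Lemma nuN1 : nu (-1) = 1.
Proof.
have : nu (-1) ^+ 2 == 1 by rewrite expr2 -nuM mulrNN mulr1 nu1.
rewrite sqrf_eq1 => /orP[/eqP//|/eqP h].
by have := nu_ge0 (-1); rewrite h oppr_ge0 ler10.
Qed.

Lemma nuN a : nu (- a) = nu a.
Proof. by rewrite -mulN1r nuM nuN1 mul1r. Qed.

Lemma nuV a : nu a^-1 = (nu a)^-1.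
Proof.
have [->|a0] := eqVneq a 0; first by rewrite invr0 nu0 invr0.
have h : nu a != 0 by rewrite nu_eq0.
by apply: (mulfI h); rewrite -nuM !divff // nu1.
Qed.

Definition l1norm (P : {poly K}) : R := \sum_(i < size P) nu P`_i.
Local Notation l1 := l1norm.

Lemma l1_ge0 P : 0 <= l1 P.
Proof. by apply: sumr_ge0 => i _; exact: nu_ge0. Qed.

Lemma l1E (P : {poly K}) N : (size P <= N)%N -> l1 P = \sum_(i < N) nu P`_i.
Proof.
move=> PN; rewrite /l1norm (big_ord_widen N (fun i => nu P`_i)) // big_mkcond.
apply: eq_bigr => i _; case: ltnP => // h.
by rewrite nth_default // nu0.
Qed.

Lemma l10 : l1 0 = 0.
Proof. by rewrite /l1norm size_poly0 big_ord0. Qed.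

Lemma l1D (P Q : {poly K}) : l1 (P + Q) <= l1 P + l1 Q.
Proof.
pose N := maxn (size P) (size Q).
have hP : (size P <= N)%N by rewrite leq_maxl.
have hQ : (size Q <= N)%N by rewrite leq_maxr.
rewrite (l1E hP) (l1E hQ) (@l1E _ N) ?(leq_trans (size_polyD _ _)) //.
by rewrite -big_split; apply: ler_sum => i _; rewrite coefD nuD.
Qed.

Lemma l1Z a P : l1 (a *: P) = nu a * l1 P.
Proof.
rewrite (@l1E _ (size P)) ?size_scale_leq // mulr_sumr.
by apply: eq_bigr => i _; rewrite coefZ nuM.
Qed.

Lemma l1N P : l1 (- P) = l1 P.
Proof. by rewrite -scaleN1r l1Z nuN1 mul1r. Qed.

Lemma l1B (P Q : {poly K}) : l1 (P - Q) <= l1 P + l1 Q.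
Proof. by rewrite -(l1N Q) l1D. Qed.

Lemma l1_sum (I : Type) (r : seq I) (F : I -> {poly K}) :
  l1 (\sum_(i <- r) F i) <= \sum_(i <- r) l1 (F i).
Proof.
elim/big_ind2 : _ => [|x a y b xa yb|//]; first by rewrite l10.
exact: le_trans (l1D _ _) (lerD xa yb).
Qed.

Lemma l1MXn (P : {poly K}) n : l1 (P * 'X^n) = l1 P.
Proof.
have h : (size (P * 'X^n)%R <= n + size P)%N.
  by rewrite (leq_trans (size_polyMleq _ _)) // size_polyXn addnS addnC.
rewrite (l1E h) big_split_ord /= big1 ?add0r => [|i _]; last first.
  by rewrite coefMXn ltn_ord nu0.
by apply: eq_bigr => i _; rewrite coefMXn ltnNge leq_addr /= addKn.
Qed.

Lemma l1C a : l1 a%:P = nu a.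
Proof.
by rewrite (@l1E _ 1) ?size_polyC ?leq_b1 // big_ord_recl big_ord0 addr0 coefC.
Qed.

Lemma l1M (P Q : {poly K}) : l1 (P * Q) <= l1 P * l1 Q.
Proof.
rewrite -{1}[P]coefK poly_def mulr_suml (le_trans (l1_sum _ _)) //.
rewrite [leRHS]mulr_suml; apply: ler_sum => i _.
by rewrite -scalerAl l1Z (mulrC 'X^i) l1MXn.
Qed.

Lemma l1X (P : {poly K}) n : l1 (P ^+ n) <= l1 P ^+ n.
Proof.
elim: n => [|n ih]; first by rewrite !expr0 l1C nu1.
rewrite !exprS (le_trans (l1M _ _)) //.
by rewrite ler_wpM2l ?l1_ge0.
Qed.

Lemma l1_drop n P : l1 (drop_poly n P) <= l1 P.
Proof.
rewrite -(l1MXn _ n).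
have -> : drop_poly n P * 'X^n = P - take_poly n P.
  by rewrite -{2}(poly_take_drop n P) addrC addKr.
pose N := maxn n (size P).
have hP : (size P <= N)%N by rewrite leq_maxr.
rewrite (l1E hP) (@l1E _ N); last first.
  rewrite (leq_trans (size_polyD _ _)) // geq_max hP size_polyN.
  by rewrite (leq_trans (size_take_poly _ _)) // leq_maxl.
apply: ler_sum => i _; rewrite coefB coef_take_poly.
by case: ifP => _; rewrite ?subr0 // subrr nu0 nu_ge0.
Qed.

End AbsoluteValue.

(** * Dividing a monomial by a polynomial with control of the coefficients *)

Section Division.
Variables (R : realType) (K : fieldType) (nu : K -> R).
Hypothesis nuP : absolute_value nu.
Local Notation l1 := (l1norm nu).

(** With the coefficient of degree i factored out, the part of A of degree at least
    i is A`_i * 'X^i * (1 - W) with W`_0 = 0, and a truncated geometric series in W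
    inverts 1 - W up to W ^+ n, all of whose terms have degree at least n. *)
Lemma division_pivot (n c i : nat) (H delta : R) (A : {poly K}) :
  (i < c)%N -> 0 < delta -> (size A <= n)%N -> l1 A <= H -> delta <= nu A`_i ->
  exists P W : {poly K},
    [/\ P * (drop_poly i A * 'X^i) = 'X^c - 'X^c * W ^+ n, P`_0 = 0,
        (size P <= c + n * n)%N & W`_0 = 0] /\
    (size ('X^c * W ^+ n)%R <= c + n * n + n)%N /\
    l1 P <= delta^-1 * (n%:R * (1 + delta^-1 * H) ^+ n) /\
    l1 (W ^+ n) <= (1 + delta^-1 * H) ^+ n.
Proof.
move=> ic d0 sA lA dA; set a := A`_i.
have a0 : a != 0 by rewrite -(nu_gt0 nuP) (lt_le_trans d0).
pose D := drop_poly i A; pose W : {poly K} := 1 - a^-1 *: D.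
pose S : {poly K} := \sum_(k < n) W ^+ k.
pose P : {poly K} := a^-1 *: S * 'X^(c - i).
have H0 : 0 <= H by apply: le_trans lA; exact: l1_ge0.
have nua : nu a^-1 <= delta^-1.
  by rewrite (nuV nuP) lef_pV2 // posrE ?(nu_gt0 nuP) // (lt_le_trans d0).
set w := 1 + delta^-1 * H.
have w1 : 1 <= w by rewrite lerDl mulr_ge0 // invr_ge0 ltW.
have lW : l1 W <= w.
  rewrite (le_trans (l1B nuP _ _)) // (l1C nuP) (nu1 nuP) lerD2l (l1Z nuP).
  by rewrite ler_pM ?(nu_ge0 nuP) ?(l1_ge0 nuP) // (le_trans (l1_drop nuP _ _)).
have lWk k : (k <= n)%N -> l1 (W ^+ k) <= w ^+ n.
  move=> kn; rewrite (le_trans (l1X nuP _ _)) //.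
  apply: (le_trans (y := w ^+ k)); last exact: ler_weXn2l.
  by rewrite lerXn2r ?nnegrE ?(l1_ge0 nuP) // (le_trans ler01).
have n0 : (0 < n)%N.
  rewrite lt0n; apply: contra_neq a0 => n0; rewrite /a nth_default //.
  by apply: leq_trans sA _; rewrite n0.
have sW : (size W <= n)%N.
  rewrite (leq_trans (size_polyD _ _)) // geq_max size_poly1 n0 size_polyN.
  rewrite (leq_trans (size_scale_leq _ _)) // size_drop_poly.
  exact: leq_trans (leq_subr _ _) sA.
have sWk k : (k < n)%N -> (size (W ^+ k) <= n * n)%N.
  move=> kn; rewrite (leq_trans (size_poly_exp_leq _ _)) //; nia.
have sS : (size S <= n * n)%N.
  apply: (leq_trans (size_sum _ _ _)); apply/bigmax_leqP => k _.
  exact: sWk.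
exists P, W; split; [split|split; [|split]].
- have DE : D = a *: (1 - W) by rewrite /W subKr scalerA divff // scale1r.
  have := subrX1 W n; rewrite -/S => SE.
  have SE' : S * (1 - W) = 1 - W ^+ n.
    by rewrite -[LHS]opprK -mulrN opprB mulrC -SE opprB.
  rewrite -/D DE /P -!scalerAl -!scalerAr scalerA.
  rewrite mulVf // scale1r mulrACA SE' -exprD subnK ?(ltnW ic) //.
  by rewrite mulrBl mul1r mulrC.
- by rewrite coefMXn subn_gt0 ic.
- rewrite (leq_trans (size_polyMleq _ _)) // size_polyXn addnS /=.
  rewrite addnC leq_add ?leq_subr //.
  exact: leq_trans (size_scale_leq _ _) sS.
- by rewrite /W coefB coefZ coef_drop_poly add0n coefC eqxx mulVf // subrr.
- rewrite (leq_trans (size_polyMleq _ _)) // size_polyXn addSn /= -addnA leq_add2l.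
  apply: (leq_trans (size_poly_exp_leq _ _)).
  have : ((size W).-1 * n <= n.-1 * n)%N by rewrite leq_mul2r -!subn1 leq_sub2r ?orbT.
  by move: n0; clear; nia.
- rewrite /P (l1MXn nuP) (l1Z nuP) ler_pM ?(nu_ge0 nuP) ?(l1_ge0 nuP) //.
  have -> : n%:R * w ^+ n = \sum_(k < n) w ^+ n.
    by rewrite sumr_const card_ord mulr_natl.
  rewrite (le_trans (l1_sum nuP _ _)) //.
  by apply: ler_sum => k _; rewrite lWk // ltnW.
- exact: lWk.
Qed.

(** A bound B that serves all A at once. In the application A(T) z is the head of a
    vector and P(T) carries it to T^c z up to two errors: E1 is small, and E2 lives
    in the degrees from n on, where the orbit of z is tiny. The condition P`_0 = 0
    makes P(T) small on the tail of the vector, where positive powers of T gain a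
    factor but the identity does not. *)
Definition divides_within (n c D : nat) (H delta tau B : R) : Prop :=
  0 <= B /\ forall A : {poly K}, (size A <= n)%N -> l1 A <= H ->
    (exists2 i, (i < D)%N & delta <= nu A`_i) ->
    exists P E1 E2 : {poly K},
      [/\ P * A = 'X^c + E1 + E2, P`_0 = 0, (size P <= c + n * n)%N & l1 P <= B] /\
      [/\ l1 E1 <= tau, l1 E2 <= B, forall i, (i < n)%N -> E2`_i = 0,
          (size E1 <= c + n * n + n)%N & (size E2 <= c + n * n + n)%N].

(** Induction on D. If some coefficient below D exceeds a very small threshold d',
    the induction hypothesis with d' in place of delta applies. Otherwise the
    coefficient of degree D serves as pivot, and the lower ones, multiplied by the
    quotient, stay below tau by the choice of d'. *)
Lemma approximate_division (n c D : nat) (H delta tau : R) :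
  (D <= c)%N -> 0 <= H -> 0 < delta -> 0 < tau ->
  exists B, divides_within n c D H delta tau B.
Proof.
move=> Dc H0 d0 t0; elim: D delta d0 Dc => [|D ih] delta d0 Dc.
  by exists 0; split=> // A _ _ [].
pose w := 1 + delta^-1 * H; pose B1 := delta^-1 * (n%:R * w ^+ n).
have w0 : 0 <= w by rewrite addr_ge0 // mulr_ge0 // invr_ge0 ltW.
have B10 : 0 <= B1 by rewrite !mulr_ge0 ?ler0n ?exprn_ge0 // invr_ge0 ltW.
pose d' := Num.min delta (tau / (B1 + 1) / (D%:R + 1)).
have B1p : 0 < B1 + 1 by rewrite ltr_wpDl.
have Dp : 0 < D%:R + 1 :> R by rewrite ltr_wpDl.
have d'0 : 0 < d' by rewrite lt_min d0 !divr_gt0.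
have [B [B0 hB]] := ih d' d'0 (ltnW Dc).
exists (Num.max B (B1 + w ^+ n)); split; first by rewrite le_max B0.
move=> A sA lA [i iD di].
have [[i' i'D di']|noi] := pselect (exists2 i, (i < D)%N & d' <= nu A`_i).
  have [|P [E1 [E2 [[h1 h2 h3 h4] [h5 h6 h7 h8 h9]]]]] := hB _ sA lA; first by exists i'.
  exists P, E1, E2; split; split=> //; by rewrite le_max ?h4 ?h6.
have small k : (k < D)%N -> nu A`_k <= d'.
  by move=> kD; rewrite leNgt; apply/negP => /ltW h; apply: noi; exists k.
have iE : i = D.
  apply/eqP; rewrite eqn_leq -ltnS iD leqNgt; apply/negP => h.
  by apply: noi; exists i => //; rewrite ge_min di.
subst i.
have [P [W [[h1 h2 h3 h4] [hs [h5 h6]]]]] := division_pivot Dc d0 sA lA di.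
exists P, (P * take_poly D A), (- ('X^c * W ^+ n)); split; split=> //.
- by rewrite -{1}(poly_take_drop D A) mulrDr h1 addrC addrAC.
- rewrite le_max; apply/orP; right; apply: (le_trans h5).
  by rewrite lerDl exprn_ge0.
- apply: (le_trans (l1M nuP _ _)).
  have lt : l1 (take_poly D A) <= D%:R * d'.
    have -> : D%:R * d' = \sum_(k < D) d' by rewrite sumr_const card_ord mulr_natl.
    rewrite (l1E nuP (size_take_poly _ _)); apply: ler_sum => k _.
    by rewrite coef_take_poly ltn_ord small.
  have d'le : d' * (D%:R + 1) * (B1 + 1) <= tau.
    by rewrite -!ler_pdivlMr // ge_min lexx orbT.
  apply: le_trans d'le; rewrite mulrC ler_pM ?(l1_ge0 nuP) //.
    by rewrite (le_trans lt) // mulrC ler_wpM2l ?(ltW d'0) // lerDl.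
  by rewrite (le_trans h5) // lerDl.
- rewrite (l1N nuP) mulrC (l1MXn nuP) le_max; apply/orP; right.
  by apply: (le_trans h6); rewrite lerDr.
- move=> k kn; rewrite coefN mulrC coefMXn; case: ifP => [_|_]; first by rewrite oppr0.
  have -> : W = drop_poly 1 W * 'X^1.
    rewrite -{1}(poly_take_drop 1 W); suff -> : take_poly 1 W = 0 by rewrite add0r.
    by apply/polyP => -[|j]; rewrite coef_take_poly coef0 //= h4.
  rewrite exprMn -exprM mul1n coefMXn; case: ltnP => [_|]; first by rewrite oppr0.
  by move=> /leq_trans/(_ (leq_subr _ _)); rewrite leqNgt kn.
- apply: (leq_trans (size_polyMleq _ _)).
  have st : (size (take_poly D A) <= n)%N.
    apply/leq_sizeP => k nk; rewrite coef_take_poly; case: ifP => // _.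
    by rewrite nth_default // (leq_trans sA).
  by rewrite (leq_trans (leq_pred _)) // leq_add.
- by rewrite size_polyN.
Qed.

Definition division_bound (n c D : nat) (H delta tau : R) : R :=
  xget 0 [set B | divides_within n c D H delta tau B].

Lemma division_boundP (n c D : nat) (H delta tau : R) :
  (D <= c)%N -> 0 <= H -> 0 < delta -> 0 < tau ->
  divides_within n c D H delta tau (division_bound n c D H delta tau).
Proof.
by move=> *; apply: (xgetPex 0); exact: approximate_division.
Qed.

End Division.

(** * Positions, the cyclic orbit and its triangular change of basis *)

(** Stage s occupies the positions from stage_start s to stage_start s.+1: first
    s.+2 rows of length width s, then a single position, and from pert s on one
    position for each of the stage_start s earlier ones. The layout is fixed before
    any vector is chosen, so that the gauge of a stage can refer to its end. *)
Fixpoint stage_start (s : nat) : nat :=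
  if s is r.+1 then
    (stage_start r + r.+2 * (stage_start r).+1 ^ 2 + 1 + stage_start r)%N
  else 1%N.
Arguments stage_start : simpl never.

(** Longer than the powers of T that shift_small admits, so that such a shift leads
    from a row at most into the next one. *)
Definition width (s : nat) : nat := ((stage_start s).+1 ^ 2)%N.

(** The power T^(pert s) imitates the polynomial P s on the earlier positions. *)
Definition pert (s : nat) : nat := (stage_start s + s.+2 * width s + 1)%N.

Lemma stage_startS s : stage_start s.+1 = (pert s + stage_start s)%N.
Proof. by []. Qed.

Lemma widthE s : width s = (stage_start s * stage_start s + 2 * stage_start s + 1)%N.
Proof. rewrite /width; nia. Qed.

Lemma pertE s : pert s = (stage_start s + s.+2 * width s + 1)%N.
Proof. by []. Qed.

Lemma width_le_pert s : (stage_start s + 2 * width s < pert s)%N.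
Proof. rewrite pertE; nia. Qed.

Lemma start_lt_width s : (stage_start s < width s)%N.
Proof. rewrite widthE; nia. Qed.

Lemma stage_start_ltS s : (stage_start s < stage_start s.+1)%N.
Proof. have := width_le_pert s; rewrite stage_startS; lia. Qed.

Lemma stage_start_mono r s : (r <= s)%N -> (stage_start r <= stage_start s)%N.
Proof.
by apply: (homo_leq (leqnn) (@leq_trans)) => i; exact: ltnW (stage_start_ltS i).
Qed.

Lemma stage_start_gt s : (s < stage_start s)%N.
Proof.
elim: s => [//|s ih]; exact: leq_ltn_trans ih (stage_start_ltS s).
Qed.

Lemma stage_start_gt0 s : (0 < stage_start s)%N.
Proof. exact: leq_ltn_trans (stage_start_gt s). Qed.

Lemma stage_exists i : exists s, (i < stage_start s.+1)%N.
Proof. by exists i; rewrite ltnW // stage_start_gt. Qed.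

Definition stage_of (i : nat) : nat := ex_minn (stage_exists i).

Lemma stage_ofE s i :
  (stage_start s <= i)%N -> (i < stage_start s.+1)%N -> stage_of i = s.
Proof.
rewrite /stage_of; case: ex_minnP => r ir rmin si iS.
apply/eqP; rewrite eqn_leq rmin //= leqNgt; apply/negP => rs.
by have := leq_trans (leq_trans ir (stage_start_mono rs)) si; rewrite ltnn.
Qed.

Lemma stage_ofP i : (0 < i)%N ->
  (stage_start (stage_of i) <= i < stage_start (stage_of i).+1)%N.
Proof.
move=> i0; rewrite /stage_of; case: ex_minnP => r ir rmin; rewrite ir andbT.
case: r ir rmin => [//|r] ir rmin.
by rewrite leqNgt; apply/negP => /rmin; rewrite ltnn.
Qed.

Section Orbit.
Variables (K : fieldType) (X : lmodType K) (P : nat -> {poly K}).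
Hypothesis sizeP : forall s, (size (P s) <= s.+1)%N.

(** The polynomials with z i = (zpoly i)(T) (z 0): they invert the triangular
    relation that defines orbit. *)
Definition zpoly (i : nat) : {poly K} :=
  if (pert (stage_of i) <= i)%N
  then 'X^i - P (stage_of i) * 'X^(i - pert (stage_of i)) else 'X^i.
Local Notation zeta := zpoly.

(** The orbit entry of index i refers to entries of smaller index only (by
    pert_index_lt), and m is a bound that makes the recursion structural. *)
Fixpoint orbit_rec (z : nat -> X) (m i : nat) : X :=
  if m is m'.+1 then
    z i + (if (pert (stage_of i) <= i)%N
           then \sum_(k < size (P (stage_of i)))
             (P (stage_of i))`_k *: orbit_rec z m' (i - pert (stage_of i) + k)
           else 0)
  else 0.

Definition orbit (z : nat -> X) (i : nat) : X := orbit_rec z i.+1 i.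

Lemma pert_index_lt i (k : nat) : (pert (stage_of i) <= i)%N ->
  (k < size (P (stage_of i)))%N -> (i - pert (stage_of i) + k < i)%N.
Proof.
move=> h hk; have := sizeP (stage_of i); have := width_le_pert (stage_of i).
have := stage_start_gt (stage_of i); lia.
Qed.

Lemma orbit_rec_fuel z m i : (i < m)%N -> orbit_rec z m i = orbit z i.
Proof.
rewrite /orbit; elim/ltn_ind: i m => i ih [//|m] im /=.
congr (_ + _); case: ifP => // h; apply: eq_bigr => k _; congr (_ *: _).
have lt := pert_index_lt h (ltn_ord k).
by rewrite (ih _ lt m) ?(leq_trans lt) // (ih _ lt i).
Qed.

Lemma orbit_ext z z' i : (forall k, (k <= i)%N -> z k = z' k) ->
  orbit z i = orbit z' i.
Proof.
elim/ltn_ind: i => i ih zz'; rewrite /orbit /= zz' //; congr (_ + _); case: ifP => // h; apply: eq_bigr => k _.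
congr (_ *: _); have lt := pert_index_lt h (ltn_ord k).
rewrite !orbit_rec_fuel // ih // => j hj; apply: zz'.
exact: leq_trans hj (ltnW lt).
Qed.

Variable z : nat -> X.
Local Notation f := (orbit z).

(** This is p(T) (z 0) for the operator T whose orbit of z 0 is f. *)
Definition orbit_sum (p : {poly K}) : X := \sum_(i < size p) p`_i *: f i.
Local Notation Phi := orbit_sum.

Lemma PhiE (p : {poly K}) N : (size p <= N)%N ->
  Phi p = \sum_(i < N) p`_i *: f i.
Proof.
move=> pN; rewrite /orbit_sum (big_ord_widen N (fun i => p`_i *: f i)) // big_mkcond.
by apply: eq_bigr => i _; case: ltnP => // h; rewrite nth_default // scale0r.
Qed.

Lemma Phi_is_linear : linear Phi.
Proof.
move=> a p r; pose N := maxn (size p) (size r).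
have hp : (size p <= N)%N by rewrite leq_maxl.
have hr : (size r <= N)%N by rewrite leq_maxr.
rewrite (PhiE hp) (PhiE hr) (@PhiE _ N); last first.
  rewrite (leq_trans (size_polyD _ _)) // geq_max hr andbT.
  exact: leq_trans (size_scale_leq _ _) hp.
rewrite scaler_sumr -big_split; apply: eq_bigr => i _.
by rewrite coefD coefZ scalerDl scalerA.
Qed.

HB.instance Definition _ :=
  GRing.isLinear.Build K {poly K} X *:%R Phi Phi_is_linear.

Lemma Phi_Xn i : Phi 'X^i = f i.
Proof.
rewrite /orbit_sum size_polyXn big_ord_recr /= big1 ?add0r => [|j _].
  by rewrite coefXn eqxx scale1r.
by rewrite coefXn ltn_eqF // scale0r.
Qed.

Lemma orbit_layoff i : (i < pert (stage_of i))%N -> f i = z i.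
Proof. by move=> h; rewrite /orbit /= leqNgt h addr0. Qed.

Lemma Phi_MXn (p : {poly K}) l N : (size p <= N)%N ->
  Phi (p * 'X^l) = \sum_(k < N) p`_k *: f (l + k)%N.
Proof.
move=> pN; rewrite -{1}(coefK p) poly_def mulr_suml linear_sum /=.
rewrite (big_ord_widen N (fun k => Phi (p`_k *: 'X^k * 'X^l))) // big_mkcond.
apply: eq_bigr => k _; case: ltnP => h.
  by rewrite -scalerAl linearZ /= -exprD Phi_Xn addnC.
by rewrite nth_default // scale0r.
Qed.

Lemma orbit_pert i : (pert (stage_of i) <= i)%N ->
  f i = z i + Phi (P (stage_of i) * 'X^(i - pert (stage_of i))).
Proof.
move=> h; rewrite {1}/orbit /= h (@Phi_MXn _ _ (size (P (stage_of i)))) //.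
congr (_ + _); apply: eq_bigr => k _; congr (_ *: _).
by rewrite orbit_rec_fuel // pert_index_lt.
Qed.

Lemma Phi_zeta i : Phi (zeta i) = z i.
Proof.
rewrite /zpoly; case: leqP => h; last by rewrite Phi_Xn orbit_layoff.
by rewrite linearB /= Phi_Xn orbit_pert // addrK.
Qed.

Lemma stage_of_layoff s i :
  (stage_start s <= i)%N -> (i < pert s)%N -> stage_of i = s.
Proof.
by move=> h1 h2; apply: stage_ofE => //; rewrite stage_startS ltn_addr.
Qed.

Lemma stage_of_pert s l : (l < stage_start s)%N -> stage_of (pert s + l) = s.
Proof.
move=> h; apply: stage_ofE; last by rewrite stage_startS ltn_add2l.
have := width_le_pert s; lia.
Qed.

Lemma zeta_layoff s i :
  (stage_start s <= i)%N -> (i < pert s)%N -> zeta i = 'X^i.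
Proof. by move=> h1 h2; rewrite /zpoly (stage_of_layoff h1 h2) leqNgt h2. Qed.

Lemma zeta_pert s l : (l < stage_start s)%N ->
  zeta (pert s + l) = 'X^(pert s + l) - P s * 'X^l.
Proof. by move=> h; rewrite /zpoly stage_of_pert // leq_addr addKn. Qed.

Lemma orbit_layoff_stage s i :
  (stage_start s <= i)%N -> (i < pert s)%N -> f i = z i.
Proof. by move=> h1 h2; rewrite orbit_layoff // (stage_of_layoff h1 h2). Qed.

Lemma orbit_pert_stage s l : (l < stage_start s)%N ->
  f (pert s + l)%N = z (pert s + l)%N + Phi (P s * 'X^l).
Proof.
by move=> h; rewrite orbit_pert stage_of_pert // ?leq_addr // addKn.
Qed.

Lemma size_zeta i : (size (zeta i) <= i.+1)%N.
Proof.
rewrite /zpoly; case: (leqP (pert _) i) => h; last by rewrite size_polyXn.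
rewrite (leq_trans (size_polyD _ _)) // size_polyXn geq_max leqnn size_polyN.
apply: (leq_trans (size_polyMleq _ _)); rewrite size_polyXn.
have := sizeP (stage_of i); have := width_le_pert (stage_of i).
have := stage_start_gt (stage_of i) => h1 h2 h3.
rewrite addnS /=; apply: (leq_trans (leq_add h3 (leqnn _))); lia.
Qed.

End Orbit.

(** * Choosing the basis vectors of one stage *)

Definition seminorms (R : realType) (K : fieldType) (nu : K -> R)
    (X : lmodType K) (q : nat -> X -> R) : Prop :=
  [/\ forall k x, 0 <= q k x,
      forall k a x, q k (a *: x) = nu a * q k x,
      forall k x y, q k (x + y) <= q k x + q k y &
      forall k x, q k x <= q k.+1 x].

Section Seminorms.
Variables (R : realType) (K : fieldType) (nu : K -> R).
Variables (X : lmodType K) (q : nat -> X -> R).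
Hypothesis nuP : absolute_value nu.
Hypothesis qP : seminorms nu q.

Lemma q_ge0 k x : 0 <= q k x. Proof. by case: qP. Qed.

Lemma qZ k a x : q k (a *: x) = nu a * q k x. Proof. by case: qP. Qed.

Lemma qD k x y : q k (x + y) <= q k x + q k y. Proof. by case: qP. Qed.

Lemma qN k x : q k (- x) = q k x.
Proof. by rewrite -scaleN1r qZ (nuN1 nuP) mul1r. Qed.

Lemma qB k x y : q k (x - y) <= q k x + q k y.
Proof. by rewrite -(qN k y) qD. Qed.

Lemma q_zero k : q k 0 = 0.
Proof. by rewrite -(scale0r 0) qZ (nu0 nuP) mul0r. Qed.

Lemma q_distC k x y : q k (x - y) = q k (y - x).
Proof. by rewrite -qN opprB. Qed.

Lemma q_dist_trans k x y w : q k (x - w) <= q k (x - y) + q k (y - w).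
Proof. by rewrite -[x - w](subrKA y) qD. Qed.

Lemma q_mono k l x : (k <= l)%N -> q k x <= q l x.
Proof.
move=> kl; apply: (homo_leq (f := q^~ x) (r := fun a b => a <= b)) kl => //.
  by move=> a b c; exact: le_trans.
by move=> i; case: qP.
Qed.

Lemma q_sum k (I : Type) (r : seq I) (pr : pred I) (F : I -> X) :
  q k (\sum_(i <- r | pr i) F i) <= \sum_(i <- r | pr i) q k (F i).
Proof.
elim/big_ind2 : _ => [|x a y b xa yb|//]; first by rewrite q_zero.
exact: le_trans (qD _ _ _) (lerD xa yb).
Qed.

End Seminorms.

Section Stage.
Variables (R : realType) (K : fieldType) (nu : K -> R).
Variables (X : lmodType K) (q : nat -> X -> R) (e : nat -> X).
Hypothesis nuP : absolute_value nu.
Hypothesis nu_nat : forall n, nu n%:R = n%:R.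
Hypothesis qP : seminorms nu q.
Hypothesis e_gt0 : forall n, 0 < q 0 (e n).

(** The data provided by the assumption on the basis, with the pair (j, m) replaced
    by the position (j - 1) * M + m - 1 of its lexicographic rank and with seminorms
    numbered from 0. A step of at most M positions costs one seminorm. *)
Definition scaled_chain (eps C : R) (M N j kk : nat)
    (n : nat -> nat) (alpha : nat -> K) : Prop :=
  [/\ forall i, (i < j.+2 * M)%N -> (N < n i)%N /\ alpha i != 0,
      forall i i', (i < i')%N -> (i' < j.+2 * M)%N -> n i <> n i',
      forall i, (i < M)%N -> q j (alpha i *: e (n i)) <= eps,
      forall i, (j.+1 * M <= i)%N -> (i < j.+2 * M)%N ->
        eps^-1 <= q 0 (alpha i *: e (n i)) &
      forall i i' k, (i < i')%N -> (i' <= i + M)%N -> (i' < j.+2 * M)%N ->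
        (k <= kk)%N ->
        C * q k (alpha i' *: e (n i')) <= q k.+1 (alpha i *: e (n i))].

Definition has_chains : Prop :=
  forall (eps C : R) (M N j kk : nat), 0 < eps -> 1 <= C -> (0 < M)%N ->
    exists n alpha, scaled_chain eps C M N j kk n alpha.

Hypothesis chains : has_chains.

(** From the first row to the last one there are j.+1 steps of length M, each of which
    costs one seminorm, and the last row is large for q 0. So the first row is at
    once small for q j and large for q j.+1. *)
Lemma chain_first_row eps C M N j kk n alpha : 1 <= C -> (0 < M)%N ->
  (j <= kk)%N -> scaled_chain eps C M N j kk n alpha ->
  forall i, (i < M)%N -> eps^-1 <= q j.+1 (alpha i *: e (n i)).
Proof.
move=> C1 M0 jk [_ _ _ big ch] i iM.
have row r : (r <= j.+1)%N ->
    eps^-1 <= q r (alpha (i + (j.+1 - r) * M)%N *: e (n (i + (j.+1 - r) * M)%N)).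
  elim: r => [_|r ih rj].
    by apply: big; rewrite subn0 ?leq_addl // mulSn [in ltnRHS]mulSn; nia.
  apply: le_trans (ih (ltnW rj)) _.
  have -> : (j.+1 - r = (j.+1 - r.+1).+1)%N by lia.
  set i1 := (i + (j.+1 - r.+1) * M)%N.
  have -> : (i + (j.+1 - r.+1).+1 * M = i1 + M)%N by rewrite /i1 mulSn; lia.
  apply: (le_trans (y := C * q r (alpha (i1 + M)%N *: e (n (i1 + M)%N)))).
    by rewrite ler_peMl // (q_ge0 qP).
  apply: ch; [lia|by []| |lia].
  by rewrite /i1; have : ((j.+1 - r.+1).+2 * M <= j.+2 * M)%N;
    [rewrite leq_mul2r; lia|rewrite !mulSn; lia].
by have := row _ (leqnn _); rewrite subnn mul0n addn0.
Qed.

(** The parts u, g, v of a stage in the order of their positions; they are chosen in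
    the order v, g, u. Since T maps the end of u to g, and g to the start of v up to
    known vectors, each of these has to dominate all that follows it within the
    stage. At the end of v, T yields the start of the next u minus P s applied to
    the start of this u: both are tiny because u is chosen after v although it
    stands before it. The number w stands for everything known before the stage. *)
Record stage_spec (s j : nat) (w : R) (z : nat -> X) : Prop := StageSpec {
  v_small : forall l, (l < stage_start s)%N -> w * q j (z (pert s + l)%N) <= 1;
  v_large : forall l, (l < stage_start s)%N -> w <= q j.+1 (z (pert s + l)%N);
  v_chain : forall l l' k, (l < l')%N -> (l' < stage_start s)%N -> (k <= s)%N ->
    w * q k (z (pert s + l')%N) <= q k.+1 (z (pert s + l)%N);
  g_large : w <= q 0 (z (pert s).-1);
  g_large_v : forall l, (l < stage_start s)%N ->
    w * q s (z (pert s + l)%N) <= q 0 (z (pert s).-1);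
  u_small : forall l, (l < width s)%N -> w * q s (z (stage_start s + l)%N) <= 1;
  u_small_gv : forall l i, (l < width s)%N -> (pert s <= i.+1)%N ->
    (i < stage_start s.+1)%N -> w * q s (z (stage_start s + l)%N) <= q 0 (z i);
  u_large : forall l, (s.+1 * width s <= l)%N -> (l < s.+2 * width s)%N ->
    w <= q 0 (z (stage_start s + l)%N);
  u_large_gv : forall l i, (s.+1 * width s <= l)%N -> (l < s.+2 * width s)%N ->
    (pert s <= i.+1)%N -> (i < stage_start s.+1)%N ->
    w * q s (z i) <= q 0 (z (stage_start s + l)%N);
  u_chain : forall l l' k, (l < l')%N -> (l' <= l + width s)%N ->
    (l' < s.+2 * width s)%N -> (k <= s)%N ->
    w * q k (z (stage_start s + l')%N) <= q k.+1 (z (stage_start s + l)%N) }.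

Definition vec (d : nat -> nat * K) (i : nat) : X := (d i).2 *: e (d i).1.

Definition valid (n : nat) (d : nat -> nat * K) : Prop :=
  (forall i, (i < n)%N -> (d i).2 != 0) /\
  (forall i i', (i < i')%N -> (i' < n)%N -> (d i).1 <> (d i').1).

Lemma vec_gt0 n d i : valid n d -> (i < n)%N -> 0 < q 0 (vec d i).
Proof.
by move=> [d0 _] i_n; rewrite /vec (qZ qP) mulr_gt0 // (nu_gt0 nuP) d0.
Qed.

Lemma large_scalar (G : R) n : exists2 b : K, b != 0 & G <= q 0 (b *: e n).
Proof.
have [m Gm] : exists m : nat, G / q 0 (e n) <= m.+1%:R.
  exists (Num.Def.truncn (G / q 0 (e n))).
  exact: ltW (truncnS_gt _).
exists m.+1%:R; first by rewrite -(nu_gt0 nuP) nu_nat.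
by rewrite (qZ qP) nu_nat -ler_pdivrMr.
Qed.

Lemma pert_block s i : (stage_start s <= i)%N -> (i < stage_start s.+1)%N ->
  [\/ exists2 l, (l < s.+2 * width s)%N & i = (stage_start s + l)%N,
      i = (pert s).-1 |
      exists2 l, (l < stage_start s)%N & i = (pert s + l)%N].
Proof.
rewrite stage_startS; have := pertE s.
move: (pert s) (stage_start s) (s.+2 * width s)%N => c n L -> ni ic.
have [h1|h1] := ltnP i (n + L); first by constructor 1; exists (i - n)%N; lia.
have [h2|h2] := ltnP i (n + L).+1; first by constructor 2; lia.
by constructor 3; exists (i - (n + L + 1))%N; lia.
Qed.

Definition glue (T : Type) (s : nat) (d u : nat -> T) (g : T) (v : nat -> T)
    (i : nat) : T :=
  if (i < stage_start s)%N then d i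
  else if (i < (pert s).-1)%N then u (i - stage_start s)%N
  else if (i < pert s)%N then g else v (i - pert s)%N.

Section Glue.
Variables (T : Type) (s : nat) (d u : nat -> T) (g : T) (v : nat -> T).
Let t := glue s d u g v.

Lemma glue_old i : (i < stage_start s)%N -> t i = d i.
Proof. by rewrite /t /glue => ->. Qed.

Lemma glue_u l : (l < s.+2 * width s)%N -> t (stage_start s + l)%N = u l.
Proof.
move=> h; rewrite /t /glue ltnNge leq_addr /= addKn pertE.
by rewrite addn1 /= ltn_add2l h.
Qed.

Lemma glue_g : t (pert s).-1 = g.
Proof.
by rewrite /t /glue ltnn ltnNge pertE addn1 /= leq_addr /= ltnSn.
Qed.

Lemma glue_v l : t (pert s + l)%N = v l.
Proof.
rewrite /t /glue addKn (ltnNge _ (pert s)) leq_addr /= !ifF //.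
  by apply/negbTE; rewrite -leqNgt (leq_trans (leq_pred _)) // leq_addr.
apply/negbTE; rewrite -leqNgt (leq_trans _ (leq_addr _ _)) //.
by rewrite pertE -addnA leq_addr.
Qed.

End Glue.

(** Distinct indices come from the separation: those of the earlier stages are at
    most N0, those of v lie in ]N0, N1], those of u lie above N2, and g, at most N2,
    avoids the former two. *)
Lemma glue_valid s (d u : nat -> nat * K) (g : nat * K) (v : nat -> nat * K) (N0 N1 N2 : nat) :
  valid (stage_start s) d ->
  (forall i, (i < stage_start s)%N -> (d i).1 <= N0 /\ (d i).1 <> g.1)%N ->
  (N0 <= N1)%N -> (N1 <= N2)%N -> (g.1 <= N2)%N -> g.2 != 0 ->
  (forall l, (l < s.+2 * width s)%N -> (N2 < (u l).1)%N /\ (u l).2 != 0) ->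
  (forall l l', (l < l')%N -> (l' < s.+2 * width s)%N -> (u l).1 <> (u l').1) ->
  (forall l, (l < stage_start s)%N ->
     [/\ (N0 < (v l).1)%N, ((v l).1 <= N1)%N, (v l).1 <> g.1 & (v l).2 != 0]) ->
  (forall l l', (l < l')%N -> (l' < stage_start s)%N -> (v l).1 <> (v l').1) ->
  valid (stage_start s.+1) (glue s d u g v).
Proof.
move=> [d0 dinj] dN N01 N12 gN g0 uN uinj vN vinj.
have dec i : (i < stage_start s.+1)%N -> [\/ (i < stage_start s)%N,
    exists2 l, (l < s.+2 * width s)%N & i = (stage_start s + l)%N, i = (pert s).-1 |
    exists2 l, (l < stage_start s)%N & i = (pert s + l)%N].
  move=> h; have [|ni] := ltnP i (stage_start s); first by constructor 1.
  by have [?|?|?] := pert_block ni h; [constructor 2|constructor 3|constructor 4].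
have cn : (stage_start s + s.+2 * width s < pert s)%N by rewrite pertE addn1.
split=> [i /dec[h|[l h ->]|->|[l h ->]]|].
- by rewrite glue_old ?d0.
- by rewrite glue_u //; case: (uN l h).
- by rewrite glue_g.
- by rewrite glue_v; case: (vN l h).
move=> i i' ii' i'c; have ic : (i < stage_start s.+1)%N by exact: ltn_trans i'c.
case: (dec i' i'c) => [h'|[l' h' E']|E'|[l' h' E']];
  case: (dec i ic) => [h|[l h E]|E|[l h E]]; subst;
  rewrite ?(glue_old _ _ _ _ h) ?(glue_old _ _ _ _ h') ?(glue_u _ _ _ _ h)
    ?(glue_u _ _ _ _ h') ?glue_g ?glue_v.
all: clear dec d0 g0.
- exact: dinj.
- by clear - ii' h'; lia.
- by move: ii' h' cn; clear; move: (s.+2 * width s)%N => L; lia.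
- by move: ii' h' cn; clear; move: (s.+2 * width s)%N => L; lia.
- by have [h1 _] := uN _ h'; have [h2 _] := dN _ h; clear - h1 h2 N01 N12; lia.
- by apply: uinj => //; clear - ii'; lia.
- by move: ii' h' cn; clear; move: (s.+2 * width s)%N => L; lia.
- by move: ii' h' cn; clear; move: (s.+2 * width s)%N => L; lia.
- by have [_] := dN _ h.
- by have [h1 _] := uN _ h; clear - h1 gN; lia.
- by clear - ii'; lia.
- by move: ii' cn; clear; move: (s.+2 * width s)%N => L; lia.
- by have [h1 _ _ _] := vN _ h'; have [h2 _] := dN _ h; clear - h1 h2; lia.
- by have [h1 _] := uN _ h; have [_ h2 _ _] := vN _ h'; clear - h1 h2 N12; lia.
- by have [_ _ /nesym] := vN _ h'.
- by apply: vinj => //; clear - ii'; lia.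
Qed.

(** The index of g is s itself unless it has been used before, so that in the end
    every basis vector is used. *)
Lemma stage_extension s j w d : 1 <= w -> valid (stage_start s) d ->
  exists d', [/\ forall i, (i < stage_start s)%N -> d' i = d i,
    valid (stage_start s.+1) d',
    exists2 i, (i < stage_start s.+1)%N & (d' i).1 = s &
    stage_spec s j w (vec d')].
Proof.
move=> w1 vald; set n := stage_start s; set M := width s; set c := pert s.
have w0 : 0 < w by exact: lt_le_trans w1.
have n0 : (0 < n)%N := stage_start_gt0 s.
have M0 : (0 < M)%N by rewrite (leq_trans _ (start_lt_width s)).
pose N0 := (s + \sum_(i < n) (d i).1)%N.
have dN0 i : (i < n)%N -> ((d i).1 <= N0)%N.
  by move=> h; rewrite /N0 (bigD1 (Ordinal h)) //= addnCA leq_addr.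
have winv : 0 < w^-1 by rewrite invr_gt0.
have [nv [av hv]] := chains N0 j (maxn s j) winv w1 n0.
have vrow := chain_first_row w1 n0 (leq_maxr s j) hv.
have [v1 v2 v3 _ v5] := hv; rewrite invrK in vrow.
(* Indices: those used so far are <= N0, those of v lie in ]N0, N1]. *)
pose N1 := (N0 + \sum_(i < n) nv i).+1%N.
have nvl l : (l < n)%N -> (l < j.+2 * n)%N.
  by move=> h; rewrite mulSn ltn_addr.
have vN1 l : (l < n)%N -> (nv l < N1)%N.
  by move=> h; rewrite /N1 (bigD1 (Ordinal h)) //= ltnS addnCA leq_addr.
pose gi := if [exists i : 'I_n, (d i).1 == s] then N1 else s.
have gi_d i : (i < n)%N -> (d i).1 <> gi.
  move=> h; rewrite /gi; case: ifPn => [_ E|/existsPn /(_ (Ordinal h)) /eqP //].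
  have := dN0 i h; rewrite E /N1 leqNgt ltnS leq_addr //.
have gi_v l : (l < n)%N -> nv l <> gi.
  move=> h E; have := vN1 l h; have := (v1 l (nvl l h)).1.
  rewrite E /gi; case: ifP => _; rewrite ?ltnn // /N0 ltnNge leq_addr //.
have [b b0 hb] := large_scalar
  (w * (1 + \sum_(l < n) q s (av l *: e (nv l)))) gi.
pose N2 := (N1 + gi)%N.
pose S := \sum_(l < n) (q s (av l *: e (nv l)) + (q 0 (av l *: e (nv l)))^-1).
pose G := q s (b *: e gi) + (q 0 (b *: e gi))^-1.
(* u starts below 1 / U and ends above U, which settles all comparisons of u
   with g and v. *)
pose U := w * (1 + S + G).
have S0 : 0 <= S.
  by apply: sumr_ge0 => l _; rewrite addr_ge0 ?invr_ge0 ?(q_ge0 qP).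
have G0 : 0 <= G by rewrite addr_ge0 ?invr_ge0 ?(q_ge0 qP).
have SG1 : 1 <= 1 + S + G by clear - S0 G0; lra.
have U0 : 0 < U by rewrite mulr_gt0 // (lt_le_trans ltr01).
have Uinv : 0 < U^-1 by rewrite invr_gt0.
have [nu_ [au [u1 u2 u3 u4 u5]]] := chains N2 s s Uinv w1 M0.
rewrite invrK in u4.
pose d' := glue s d (fun l => (nu_ l, au l)) (gi, b) (fun l => (nv l, av l)).
have val' : valid (stage_start s.+1) d'.
  apply: (@glue_valid _ _ _ _ _ N0 N1 N2) => //.
  - by move=> i h; split; [exact: dN0|exact: gi_d].
  - by rewrite /N1 -addnS leq_addr.
  - by rewrite leq_addr.
  - by rewrite leq_addl.
  - move=> l h; have [h1 h2] := v1 l (nvl l h).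
    by split => //; [rewrite ltnW ?vN1|exact: gi_v].
  - by move=> l l' ll' h; apply: v2 => //; exact: nvl.
have vg : vec d' c.-1 = b *: e gi by rewrite /vec /d' glue_g.
have vv l : vec d' (c + l)%N = av l *: e (nv l) by rewrite /vec /d' glue_v.
have vu l : (l < s.+2 * M)%N -> vec d' (n + l)%N = au l *: e (nu_ l).
  by move=> h; rewrite /vec /d' glue_u.
have wU : w <= U by rewrite ler_peMr // ltW.
have gv i : (c <= i.+1)%N -> (i < stage_start s.+1)%N ->
    w * q s (vec d' i) <= U /\ w / q 0 (vec d' i) <= U.
  move=> ci iS.
  suff h : q s (vec d' i) + (q 0 (vec d' i))^-1 <= 1 + S + G.
    have i1 := q_ge0 qP s (vec d' i).
    have i2 : 0 <= (q 0 (vec d' i))^-1 by rewrite invr_ge0 (q_ge0 qP).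
    by split; rewrite /U ler_pM2l //; clear - h i1 i2; lra.
  have ni : (n <= i)%N.
    by move: ci; rewrite /c pertE addn1 ltnS; exact: leq_trans (leq_addr _ _).
  have [[l h E]|->|[l h ->]] := pert_block ni iS.
  - by move: ci; rewrite E /c pertE addn1 ltnS leq_add2l leqNgt h.
  - by rewrite vg -/G; clear - S0; lra.
  rewrite vv; apply: (le_trans (y := S)); last by clear - G0; lra.
  rewrite /S (bigD1 (Ordinal h)) //= lerDl.
  by apply: sumr_ge0 => k _; rewrite addr_ge0 ?invr_ge0 ?(q_ge0 qP).
have Msub l : (l < M)%N -> (l < s.+2 * M)%N by move=> h; rewrite mulSn ltn_addr.
have usm l : (l < M)%N -> U * q s (vec d' (n + l)%N) <= 1.
  move=> h; rewrite vu ?Msub // mulrC -ler_pdivlMr // div1r.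
  exact: u3.
have usm' l : (l < M)%N -> w * q s (vec d' (n + l)%N) <= w / U.
  move=> h; rewrite ler_pM2l // -[U^-1]mul1r ler_pdivlMr // mulrC.
  exact: usm.
exists d'; split => //; first by move=> i h; rewrite /d' glue_old.
  have [/existsP[i /eqP E]|ne] := boolP [exists i : 'I_n, (d i).1 == s].
    exists (i : nat); first exact: ltn_trans (ltn_ord i) (stage_start_ltS s).
    by rewrite /d' glue_old.
  exists c.-1; last by rewrite /d' glue_g /= /gi (negbTE ne).
  rewrite stage_startS -/c -/n (leq_trans _ (leq_addr _ _)) //.
  by rewrite /c pertE addn1.
split=> //.
- by move=> l h; rewrite vv mulrC -ler_pdivlMr // div1r; exact: v3.
- by move=> l h; rewrite vv; exact: vrow.
- move=> l l' k ll' h ks; rewrite !vv; apply: v5 => //.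
  + by rewrite ltnW // (leq_trans h) // leq_addl.
  + exact: nvl.
  + by rewrite leq_max ks.
- rewrite -/c vg; apply: le_trans hb; rewrite ler_peMr ?(ltW w0) // lerDl.
  by apply: sumr_ge0 => l _; exact: (q_ge0 qP).
- move=> l h; rewrite -/c vg vv; apply: le_trans hb; rewrite ler_pM2l //.
  rewrite (bigD1 (Ordinal h)) //= addrCA lerDl addr_ge0 //.
  by apply: sumr_ge0 => k _; exact: (q_ge0 qP).
- by move=> l h; apply: le_trans (usm l h); rewrite ler_wpM2r // (q_ge0 qP).
- move=> l i h ci iS; apply: (le_trans (usm' l h)).
  have i0 := vec_gt0 val' iS.
  rewrite ler_pdivrMr // mulrC -ler_pdivrMr //.
  exact: (gv i ci iS).2.
- by move=> l h1 h2; rewrite -/n vu //; exact: le_trans wU (u4 l h1 h2).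
- move=> l i h1 h2 ci iS; apply: (le_trans (gv i ci iS).1).
  by rewrite -/n vu //; exact: u4.
- move=> l l' k ll' l'M h ks; rewrite -/n !vu ?(ltn_trans ll') //.
  exact: u5.
Qed.

End Stage.

(** * The gauge of a stage and the full sequence of vectors *)

Section Gauge.
Variables (R : realType) (K : fieldType) (nu : K -> R).
Variables (X : lmodType K) (q : nat -> X -> R).
Variable (P : nat -> {poly K}).
Hypothesis nuP : absolute_value nu.
Hypothesis qP : seminorms nu q.
Implicit Type z : nat -> X.
Local Notation l1 := (l1norm nu).

(** Bounds the orbit below stage_start s, and also its continuation through the first
    row of u, which is tiny (orbit_near). *)
Definition orbit_size (s : nat) z : R :=
  1 + \sum_(i < stage_start s) q s (orbit P z i).

(** Bounds the norm of the head polynomial of any x whose coordinates satisfy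
    nu x_i * q 0 (z i) <= s.+1; for a given x this holds from some s on. *)
Definition head_bound (s : nat) z : R :=
  s.+1%:R * \sum_(i < stage_start s) l1 (zpoly P i) / q 0 (z i).

(** A size that some low coefficient of the head polynomial of a non-zero x exceeds
    (head_pivot). *)
Definition pivot_bound (s : nat) z : R :=
  (2 * s.+1%:R * (stage_start s)%:R * orbit_size s z)^-1.

Definition error_bound (s : nat) z : R := (s.+1%:R * orbit_size s z)^-1.

Definition quotient_bound (s : nat) z : R :=
  if s is r.+1 then
    division_bound nu (stage_start s) (pert r) (stage_start r) (head_bound s z)
      (pivot_bound r z) (error_bound s z)
  else 0.

(** Summed over the stages so as to be monotone in s: a polynomial admitted at one
    stage has to be admitted at all later ones. *)
Definition poly_bound (s : nat) z : R :=
  \sum_(r < s.+1) (1 + l1 (P r) + quotient_bound r z).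

(** The factor gained by positive powers of T on stage s: it beats the coefficients
    of the admitted polynomials and makes sums over all positions converge. *)
Definition decay (s : nat) z : R := 2 ^+ stage_start s.+1 * poly_bound s z.

Definition decay_pred (s : nat) z : R := if s is r.+1 then decay r z else 0.

(** Collects all that the vectors of stage s have to beat. It depends on the vectors
    before that stage only (gauge_ext), so the stages can be chosen one by one. *)
Definition gauge (s : nat) z : R :=
  1 + 2 * decay s z * (1 + l1 (P s)) * orbit_size s z
  + \sum_(i < stage_start s)
      (2 * decay_pred s z + 2 ^+ (s + i) * l1 (zpoly P i)) / q 0 (z i)
  + 2 * s.+1%:R ^+ 2 * (stage_start s)%:R * orbit_size s z
  + s.+1%:R * quotient_bound s z.

Lemma orbit_size_ge1 s z : 1 <= orbit_size s z.
Proof. by rewrite lerDl sumr_ge0 // => i _; exact: (q_ge0 qP). Qed.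

Lemma head_bound_ge0 s z : 0 <= head_bound s z.
Proof.
rewrite mulr_ge0 // sumr_ge0 // => i _.
by rewrite mulr_ge0 ?invr_ge0 ?(q_ge0 qP) ?(l1_ge0 nuP).
Qed.

Lemma orbit_size_gt0 s z : 0 < orbit_size s z.
Proof. exact: lt_le_trans (orbit_size_ge1 s z). Qed.

Lemma pivot_bound_gt0 s z : 0 < pivot_bound s z.
Proof.
by rewrite invr_gt0 !mulr_gt0 ?ltr0n ?stage_start_gt0 // orbit_size_gt0.
Qed.

Lemma error_bound_gt0 s z : 0 < error_bound s z.
Proof. by rewrite invr_gt0 mulr_gt0 // orbit_size_gt0. Qed.

Lemma quotient_boundP s z :
  divides_within nu (stage_start s.+1) (pert s) (stage_start s)
    (head_bound s.+1 z) (pivot_bound s z) (error_bound s.+1 z)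
    (quotient_bound s.+1 z).
Proof.
apply: division_boundP => //.
- by have := width_le_pert s => h; rewrite ltnW // (leq_ltn_trans _ h) // leq_addr.
- exact: head_bound_ge0.
- exact: pivot_bound_gt0.
- exact: error_bound_gt0.
Qed.

Lemma quotient_bound_ge0 s z : 0 <= quotient_bound s z.
Proof. by case: s => [//|s]; have [] := quotient_boundP s z. Qed.

Let poly_bound_term_ge0 r z : 0 <= 1 + l1 (P r) + quotient_bound r z.
Proof. by rewrite !addr_ge0 // ?quotient_bound_ge0 // (l1_ge0 nuP). Qed.

Lemma poly_bound_term s z : 1 + l1 (P s) + quotient_bound s z <= poly_bound s z.
Proof.
by rewrite /poly_bound big_ord_recr /= lerDr sumr_ge0.
Qed.

Lemma poly_bound_l1 s z : 1 + l1 (P s) <= poly_bound s z.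
Proof. by apply: le_trans (poly_bound_term s z); rewrite lerDl quotient_bound_ge0. Qed.

Lemma poly_bound_ge1 s z : 1 <= poly_bound s z.
Proof. by apply: le_trans (poly_bound_l1 s z); rewrite lerDl (l1_ge0 nuP). Qed.

Lemma poly_bound_gt0 s z : 0 < poly_bound s z.
Proof. exact: lt_le_trans (poly_bound_ge1 s z). Qed.

Lemma poly_bound_mono r s z : (r <= s)%N -> poly_bound r z <= poly_bound s z.
Proof.
move=> rs; apply: (homo_leq (f := poly_bound^~ z) (r := fun a b => a <= b)) rs => //.
  by move=> a b c; exact: le_trans.
by move=> i; rewrite /poly_bound [leRHS]big_ord_recr /= lerDl poly_bound_term_ge0.
Qed.

Lemma decay_gt0 s z : 0 < decay s z.
Proof. by rewrite mulr_gt0 ?exprn_gt0 // poly_bound_gt0. Qed.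

Lemma decay_pred_ge0 s z : 0 <= decay_pred s z.
Proof. by case: s => [//|s]; rewrite /= ltW // decay_gt0. Qed.

Let part1 s z := 2 * decay s z * (1 + l1 (P s)) * orbit_size s z.
Let part2 s z := \sum_(i < stage_start s)
      (2 * decay_pred s z + 2 ^+ (s + i) * l1 (zpoly P i)) / q 0 (z i).
Let part3 s z := 2 * s.+1%:R ^+ 2 * (stage_start s)%:R * orbit_size s z.
Let part4 s z := s.+1%:R * quotient_bound s z.

Let part1_ge0 s z : 0 <= part1 s z.
Proof.
apply: mulr_ge0 (ltW (orbit_size_gt0 _ _)); apply: mulr_ge0.
  by rewrite mulr_ge0 // ltW // decay_gt0.
by rewrite addr_ge0 // (l1_ge0 nuP).
Qed.

Let term2_ge0 s z i :
  0 <= (2 * decay_pred s z + 2 ^+ (s + i) * l1 (zpoly P i)) / q 0 (z i).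
Proof.
apply: mulr_ge0; last by rewrite invr_ge0 (q_ge0 qP).
apply: addr_ge0; apply: mulr_ge0 => //.
- exact: decay_pred_ge0.
- exact: (l1_ge0 nuP).
Qed.

Let part2_ge0 s z : 0 <= part2 s z.
Proof. by apply: sumr_ge0 => i _; exact: term2_ge0. Qed.

Let part3_ge0 s z : 0 <= part3 s z.
Proof.
by rewrite !mulr_ge0 ?exprn_ge0 ?ler0n ?(ltW (orbit_size_gt0 _ _)).
Qed.

Let part4_ge0 s z : 0 <= part4 s z.
Proof. by rewrite mulr_ge0 // quotient_bound_ge0. Qed.

Let gaugeE s z :
  gauge s z = 1 + part1 s z + part2 s z + part3 s z + part4 s z.
Proof. by []. Qed.

Let gauge_parts s z : [/\ 1 <= gauge s z, part1 s z <= gauge s z,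
  part2 s z <= gauge s z, part3 s z <= gauge s z & part4 s z <= gauge s z].
Proof.
rewrite gaugeE; have h1 := part1_ge0 s z; have h2 := part2_ge0 s z.
have h3 := part3_ge0 s z; have h4 := part4_ge0 s z.
move: (part1 s z) (part2 s z) (part3 s z) (part4 s z) h1 h2 h3 h4.
by move=> a b c d *; split; lra.
Qed.

Lemma gauge_ge1 s z : 1 <= gauge s z.
Proof. by case: (gauge_parts s z). Qed.

Lemma gauge_gt0 s z : 0 < gauge s z.
Proof. exact: lt_le_trans (gauge_ge1 s z). Qed.

Lemma gauge_decay_orbit s z :
  2 * decay s z * (1 + l1 (P s)) * orbit_size s z <= gauge s z.
Proof. by case: (gauge_parts s z). Qed.

Let gauge_term2 s z i : (i < stage_start s)%N ->
  (2 * decay_pred s z + 2 ^+ (s + i) * l1 (zpoly P i)) / q 0 (z i) <= gauge s z.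
Proof.
move=> h; have [_ _ le _ _] := gauge_parts s z; apply: le_trans le.
by rewrite /part2 (bigD1 (Ordinal h)) //= lerDl sumr_ge0 // => k _; apply: term2_ge0.
Qed.

Lemma gauge_decay_pred s z i : (i < stage_start s.+1)%N -> 0 < q 0 (z i) ->
  2 * decay s z <= gauge s.+1 z * q 0 (z i).
Proof.
move=> h zi; rewrite -ler_pdivrMr //; apply: le_trans (gauge_term2 z h).
rewrite ler_pM2r ?invr_gt0 // lerDl mulr_ge0 ?exprn_ge0 //.
exact: (l1_ge0 nuP).
Qed.

Lemma gauge_zeta s z i : (i < stage_start s)%N -> 0 < q 0 (z i) ->
  2 ^+ (s + i) * l1 (zpoly P i) <= gauge s z * q 0 (z i).
Proof.
move=> h zi; rewrite -ler_pdivrMr //; apply: le_trans (gauge_term2 z h).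
rewrite ler_pM2r ?invr_gt0 // lerDr mulr_ge0 //.
exact: decay_pred_ge0.
Qed.

Lemma gauge_pivot s z :
  2 * s.+1%:R ^+ 2 * (stage_start s)%:R * orbit_size s z <= gauge s z.
Proof. by case: (gauge_parts s z). Qed.

Lemma gauge_ge_nat s z : s.+1%:R <= gauge s z.
Proof.
apply: le_trans (gauge_pivot s z).
have -> : 2 * s.+1%:R ^+ 2 * (stage_start s)%:R * orbit_size s z =
  s.+1%:R * (2 * (s.+1%:R * ((stage_start s)%:R * orbit_size s z))) by ring.
apply: ler_peMr => //; apply: mulr_ege1; first by rewrite ler1n.
apply: mulr_ege1; first by rewrite ler1n.
by apply: mulr_ege1; rewrite ?ler1n ?stage_start_gt0 // orbit_size_ge1.
Qed.

Lemma gauge_quotient s z : s.+1%:R * quotient_bound s z <= gauge s z.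
Proof. by case: (gauge_parts s z). Qed.

End Gauge.

Section GaugeExt.
Variables (R : realType) (K : fieldType) (nu : K -> R).
Variables (X : lmodType K) (q : nat -> X -> R).
Variable (P : nat -> {poly K}).
Hypothesis sizeP : forall s, (size (P s) <= s.+1)%N.
Variables z z' : nat -> X.

Let agree s := forall i, (i < stage_start s)%N -> z i = z' i.

Let agreeS s : agree s.+1 -> agree s.
Proof. by move=> h i i_s; apply: h; exact: ltn_trans i_s (stage_start_ltS s). Qed.

Lemma orbit_size_ext s : agree s -> orbit_size q P s z = orbit_size q P s z'.
Proof.
move=> h; congr (_ + _); apply: eq_bigr => i _; congr (q s _).
by apply: orbit_ext => // k ki; apply: h; exact: leq_ltn_trans ki (ltn_ord i).
Qed.

Lemma quotient_bound_ext s : agree s ->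
  quotient_bound nu q P s z = quotient_bound nu q P s z'.
Proof.
case: s => [//|s] h; rewrite /quotient_bound /pivot_bound /error_bound.
rewrite (orbit_size_ext h) (orbit_size_ext (agreeS h)); congr division_bound.
by congr (_ * _); apply: eq_bigr => i _; rewrite h.
Qed.

Lemma decay_ext s : agree s -> decay nu q P s z = decay nu q P s z'.
Proof.
move=> h; congr (_ * _); apply: eq_bigr => r _; congr (_ + _).
apply: quotient_bound_ext => i ir; apply: h.
by rewrite (leq_trans ir) // stage_start_mono // -ltnS.
Qed.

Lemma gauge_ext s : agree s -> gauge nu q P s z = gauge nu q P s z'.
Proof.
move=> h; rewrite /gauge (decay_ext h) (orbit_size_ext h) (quotient_bound_ext h).
have -> : decay_pred nu q P s z = decay_pred nu q P s z'.
  by case: s h => [//|s] h; exact: decay_ext (agreeS h).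
by do 3!congr (_ + _); apply: eq_bigr => i _; rewrite h.
Qed.

Lemma stage_spec_ext s j w : agree s.+1 ->
  stage_spec q s j w z -> stage_spec q s j w z'.
Proof.
move=> h sp.
have hv l : (l < stage_start s)%N -> z' (pert s + l)%N = z (pert s + l)%N.
  by move=> ls; rewrite h // stage_startS ltn_add2l.
have hc : forall i, (i < pert s)%N -> z' i = z i.
  by move=> i ic; rewrite h // stage_startS ltn_addr.
have hu l : (l < s.+2 * width s)%N ->
    z' (stage_start s + l)%N = z (stage_start s + l)%N.
  by move=> lw; apply: hc; rewrite pertE addn1 ltnS ltnW // ltn_add2l.
have hg : z' (pert s).-1 = z (pert s).-1 by apply: hc; rewrite pertE addn1.
have lw l : (l < width s)%N -> (l < s.+2 * width s)%N.
  by move=> le; rewrite mulSn ltn_addr.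
case: sp => h1 h2 h3 h4 h5 h6 h7 h8 h9 h10; split.
- by move=> l hl; rewrite hv //; exact: h1.
- by move=> l hl; rewrite hv //; exact: h2.
- by move=> l l' k ll' l's ks; rewrite !hv // ?(ltn_trans ll') //; exact: h3.
- by rewrite hg.
- by move=> l hl; rewrite hv // hg; exact: h5.
- by move=> l hl; rewrite hu ?lw //; exact: h6.
- by move=> l i hl ci iS; rewrite hu ?lw // -h //; exact: h7.
- by move=> l h1' h2'; rewrite hu //; exact: h8.
- by move=> l i h1' h2' ci iS; rewrite hu // -h //; exact: h9.
- by move=> l l' k ll' l'l l's ks; rewrite !hu // ?(ltn_trans ll') //; exact: h10.
Qed.

End GaugeExt.

Section BasisSequence.
Variables (R : realType) (K : fieldType) (nu : K -> R).
Variables (X : lmodType K) (q : nat -> X -> R) (e : nat -> X).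
Hypothesis nuP : absolute_value nu.
Hypothesis nu_nat : forall n, nu n%:R = n%:R.
Hypothesis qP : seminorms nu q.
Hypothesis e_gt0 : forall n, 0 < q 0 (e n).
Hypothesis chains : has_chains q e.
Variables (P : nat -> {poly K}) (j : nat -> nat).
Hypothesis sizeP : forall s, (size (P s) <= s.+1)%N.

(** Iterates stage_extension; the vectors below stage_start s are not changed after
    step s, so the successive choices converge to one sequence. *)
Lemma basis_sequence : exists d : nat -> nat * K,
  [/\ forall s, valid (stage_start s) d,
      forall s, exists2 i, (i < stage_start s.+1)%N & (d i).1 = s &
      forall s, stage_spec q s (j s) (gauge nu q P s (vec e d)) (vec e d)].
Proof.
have step (sd : nat * (nat -> nat * K)) : exists d', valid (stage_start sd.1) sd.2 ->
    [/\ forall i, (i < stage_start sd.1)%N -> d' i = sd.2 i,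
    valid (stage_start sd.1.+1) d',
    exists2 i, (i < stage_start sd.1.+1)%N & (d' i).1 = sd.1 &
    stage_spec q sd.1 (j sd.1) (gauge nu q P sd.1 (vec e sd.2)) (vec e d')].
  case: sd => s d /=; have [vd|nvd] := pselect (valid (stage_start s) d).
    have [d' hd'] := stage_extension nuP nu_nat qP e_gt0 chains (j s)
      (gauge_ge1 P nuP qP s (vec e d)) vd.
    by exists d'.
  by exists d.
have [F hF] := choice step.
pose D := fix D s := if s is r.+1 then F (r, D r) else fun=> (0%N, 1 : K).
have vD s : valid (stage_start s) (D s).
  elim: s => [|s ih]; last by have [] := hF (s, D s) ih.
  by split=> [i _|[|i] [|i']] //=; rewrite oner_eq0.
have DS s i : (i < stage_start s)%N -> D s.+1 i = D s i.
  by have [+ _ _ _] := hF (s, D s) (vD s); apply.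
have DD s t i : (s <= t)%N -> (i < stage_start s)%N -> D t i = D s i.
  move=> st i_s; elim: t st => [|t ih]; first by rewrite leqn0 => /eqP->.
  rewrite leq_eqVlt => /predU1P[->//|]; rewrite ltnS => st.
  by rewrite DS ?ih // (leq_trans i_s) // stage_start_mono.
pose d i := D i i.
have dE s i : (i < stage_start s)%N -> d i = D s i.
  move=> i_s; rewrite /d; have [si|/ltnW si] := leqP s i; first exact: DD.
  by rewrite (DD i s) // stage_start_gt.
have vE s i : (i < stage_start s)%N -> vec e (D s) i = vec e d i.
  by move=> i_s; rewrite /vec (dE s).
exists d; split=> s.
- have [h1 h2] := vD s; split=> [i i_s|i i' ii' i's]; first by rewrite (dE s) ?h1.
  by rewrite !(dE s) // ?(ltn_trans ii') //; exact: h2.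
- have [_ _ [i i_s E] _] := hF (s, D s) (vD s).
  by exists i => //; rewrite (dE s.+1).
- have [_ _ _ /= sp] := hF (s, D s) (vD s).
  rewrite -(gauge_ext _ _ sizeP (vE s)); apply: stage_spec_ext sp.
  exact: (vE s.+1).
Qed.

End BasisSequence.

(** * Estimates along the orbit *)

Section Estimates.
Variables (R : realType) (K : fieldType) (nu : K -> R).
Variables (X : lmodType K) (q : nat -> X -> R).
Hypothesis nuP : absolute_value nu.
Hypothesis qP : seminorms nu q.
Variables (P : nat -> {poly K}) (j : nat -> nat) (z : nat -> X).
Hypothesis sizeP : forall s, (size (P s) <= s.+1)%N.
Hypothesis z_gt0 : forall i, 0 < q 0 (z i).
Local Notation w s := (gauge nu q P s z).
Hypothesis zP : forall s, stage_spec q s (j s) (w s) z.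
Local Notation l1 := (l1norm nu).
Local Notation f := (orbit P z).
Local Notation Phi := (orbit_sum P z).
Local Notation zeta := (zpoly P).
Local Notation G s := (orbit_size q P s z).
Local Notation B s := (poly_bound nu q P s z).
Local Notation Lam s := (decay nu q P s z).

Let w_gt0 s : 0 < w s := gauge_gt0 P nuP qP s z.
Let w_ge1 s : 1 <= w s := gauge_ge1 P nuP qP s z.
Let G_ge1 s : 1 <= G s := orbit_size_ge1 P qP s z.
Let G_gt0 s : 0 < G s := orbit_size_gt0 P qP s z.
Let B_ge1 s : 1 <= B s := poly_bound_ge1 P nuP qP s z.
Let decay_gt0 s : 0 < Lam s := decay_gt0 P nuP qP s z.

Lemma q_Phi_le k (p : {poly K}) g : (forall i, p`_i != 0 -> q k (f i) <= g) ->
  q k (Phi p) <= l1 p * g.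
Proof.
move=> h; apply: le_trans (q_sum nuP qP k _ _ _) _.
rewrite [leRHS]mulr_suml; apply: ler_sum => i _; rewrite (qZ qP).
have [->|pi0] := eqVneq p`_i 0; first by rewrite (nu0 nuP) !mul0r.
by rewrite ler_wpM2l ?(nu_ge0 nuP) // h.
Qed.

Lemma orbit_before s i k : (i < stage_start s)%N -> (k <= s)%N ->
  q k (f i) <= G s.
Proof.
move=> i_s ks; apply: (le_trans (q_mono qP _ ks)).
rewrite /orbit_size (bigD1 (Ordinal i_s)) //= addrCA lerDl.
by rewrite addr_ge0 // sumr_ge0 // => r _; exact: (q_ge0 qP).
Qed.

Lemma orbit_u s l : (l <= s.+2 * width s)%N ->
  f (stage_start s + l)%N = z (stage_start s + l)%N.
Proof.
move=> h; apply: (@orbit_layoff_stage _ _ P _ s); first exact: leq_addr.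
by rewrite pertE addn1 ltnS leq_add2l.
Qed.

Lemma width_le_block s l : (l < width s)%N -> (l < s.+2 * width s)%N.
Proof. by move=> h; rewrite mulSn ltn_addr. Qed.

Lemma orbit_tiny s l k : (l < width s)%N -> (k <= s)%N ->
  w s * q k (f (stage_start s + l)%N) <= 1.
Proof.
move=> h ks; rewrite orbit_u ?(ltnW (width_le_block h)) //.
apply: le_trans (u_small (zP s) h).
by rewrite ler_pM2l //; exact: (q_mono qP).
Qed.

Lemma orbit_near s i k : (i < stage_start s + width s)%N -> (k <= s)%N ->
  q k (f i) <= G s.
Proof.
move=> h ks; have [|si] := ltnP i (stage_start s); first by move=> ?; exact: orbit_before.
rewrite -(subnKC si); apply: (le_trans (y := 1)) => //.
have hl : (i - stage_start s < width s)%N by rewrite ltn_subLR.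
apply: le_trans (orbit_tiny hl ks).
by rewrite ler_peMl ?(q_ge0 qP).
Qed.

Lemma decay_le_gauge s : 2 * Lam s <= w s.
Proof.
apply: le_trans (gauge_decay_orbit P nuP qP s z).
rewrite -mulrA; apply: ler_peMr; first by rewrite mulr_ge0 // ltW.
by rewrite mulr_ege1 // lerDl (l1_ge0 nuP).
Qed.

Lemma decay_orbit_le s : 2 * Lam s * l1 (P s) * G s <= w s.
Proof.
apply: le_trans (gauge_decay_orbit P nuP qP s z).
apply: ler_wpM2r; first exact: ltW.
by apply: ler_wpM2l; [rewrite mulr_ge0 // ltW|rewrite lerDr].
Qed.

Lemma decay_poly_le s : 2 * Lam s * l1 (P s) <= w s.
Proof.
apply: le_trans (decay_orbit_le s); apply: ler_peMr => //.
by rewrite mulr_ge0 ?(l1_ge0 nuP) // mulr_ge0 // ltW.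
Qed.

Lemma next_tiny s i l k : (i < stage_start s.+1)%N -> (l < width s.+1)%N ->
  (k <= s)%N -> 2 * Lam s * q k (f (stage_start s.+1 + l)%N) <= q 0 (z i).
Proof.
move=> iS lw ks; have h := orbit_tiny lw (leqW ks).
have h' := gauge_decay_pred P nuP qP iS (z_gt0 i).
rewrite -(ler_pM2l (w_gt0 s.+1)); apply: le_trans h'.
by rewrite mulrCA ler_piMr // mulr_ge0 // ltW.
Qed.

(** For shifts from the end of u or from g into the rest of the stage and the start of
    the next one: z i is large compared with v, with the known part of the orbit,
    and with the tiny start of the next u. *)
Lemma crossing s i k m : (i < stage_start s.+1)%N -> w s <= q 0 (z i) ->
  (forall l, (l < stage_start s)%N -> w s * q s (z (pert s + l)%N) <= q 0 (z i)) ->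
  (k <= s)%N -> (pert s <= m)%N -> (m < stage_start s.+1 + width s.+1)%N ->
  Lam s * q k (f m) <= q 0 (z i).
Proof.
move=> iS wi gi ks cm mS.
have d0 := decay_gt0 s.
have [mlt|mge] := ltnP m (stage_start s.+1); last first.
  have hl : (m - stage_start s.+1 < width s.+1)%N by rewrite ltn_subLR.
  have := next_tiny iS hl ks; rewrite subnKC //.
  apply: le_trans; rewrite ler_wpM2r ?(q_ge0 qP) // ler_peMl ?(ltW d0) //.
  by rewrite ler1n.
have hl : (m - pert s < stage_start s)%N by rewrite ltn_subLR // -stage_startS.
rewrite -(subnKC cm) orbit_pert_stage //; set l := (m - pert s)%N.
have h1 : 2 * Lam s * q k (z (pert s + l)%N) <= q 0 (z i).
  apply: le_trans (gi l hl); apply: ler_pM.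
  - by rewrite mulr_ge0 // ltW.
  - exact: (q_ge0 qP).
  - exact: decay_le_gauge.
  - exact: (q_mono qP).
have h2 : 2 * Lam s * q k (Phi (P s * 'X^l)) <= q 0 (z i).
  apply: le_trans wi; apply: le_trans (decay_orbit_le s).
  rewrite -[leRHS]mulrA; apply: ler_wpM2l; first by rewrite mulr_ge0 // ltW.
  rewrite -(l1MXn nuP (P s) l); apply: q_Phi_le => i' hi'.
  apply: orbit_near => //; move: hi'; rewrite coefMXn; case: ltnP => [|li'].
    by rewrite eqxx.
  have [|ge] := ltnP (i' - l) (size (P s)); last by rewrite nth_default ?eqxx.
  move=> lt _; have := sizeP s; have := stage_start_gt s.
  have := start_lt_width s; move: lt hl; rewrite -/l; clear; lia.
have h3 := qD qP k (z (pert s + l)%N) (Phi (P s * 'X^l)).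
have h4 := ler_wpM2l (ltW d0) h3.
rewrite mulrDr in h4.
move: h1 h2 h4; rewrite -!mulrA; lra.
Qed.

(** Small positive powers of T cost one seminorm and gain the factor decay s. Inside
    u and inside v this is the chain condition; beyond the end of u and from g it is
    crossing; beyond the end of v the image is a difference of two combinations of
    initial vectors of u, this one and the next. *)
Lemma shift_small s i r k : (stage_start s <= i)%N -> (i < stage_start s.+1)%N ->
  (0 < r)%N -> (r <= stage_start s * stage_start s + stage_start s)%N ->
  (k <= s)%N -> Lam s * q k (Phi ('X^r * zeta i)) <= q k.+1 (z i).
Proof.
move=> si iS r0 rD ks.
have d0 := decay_gt0 s.
have dw : Lam s <= w s.
  by apply: le_trans (decay_le_gauge s); rewrite ler_peMl ?(ltW d0) // ler1n.
have rw : (r < width s)%N by move: rD; rewrite widthE; clear; lia.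
have rwS : (r < width s.+1)%N.
  apply: (ltn_trans rw); have := width_le_pert s; have := start_lt_width s.+1.
  rewrite stage_startS; clear; lia.
suff : [\/ Lam s * q k (Phi ('X^r * zeta i)) <= q 0 (z i) |
    Lam s * q k (Phi ('X^r * zeta i)) <= q k.+1 (z i)].
  by case=> // h; apply: (le_trans h); exact: (q_mono qP).
have [[l lL E]|E|[l ln E]] := pert_block si iS.
- have ic : (i < pert s)%N by rewrite E pertE addn1 ltnS ltnW // ltn_add2l.
  rewrite (zeta_layoff _ si ic) -exprD Phi_Xn.
  have [lr|lr] := ltnP (l + r) (s.+2 * width s).
    right; rewrite E addnCA (addnC r) orbit_u ?(ltnW lr) //.
    apply: le_trans (u_chain (zP s) _ _ lr ks).
    + by rewrite ler_wpM2r ?(q_ge0 qP).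
    + by rewrite -[ltnLHS]addn0 ltn_add2l.
    + by rewrite leq_add2l ltnW.
  left; have lrow : (s.+1 * width s <= l)%N.
    by move: lr rw; rewrite mulSn; move: (s.+1 * width s)%N; clear; lia.
  have hgv m : (pert s <= m.+1)%N -> (m < stage_start s.+1)%N ->
      w s * q s (z m) <= q 0 (z i).
    by move=> h1 h2; rewrite E; exact: (u_large_gv (zP s)).
  have [E'|ne] := eqVneq (r + i)%N (pert s).-1.
    have cS : ((pert s).-1 < stage_start s.+1)%N.
      by rewrite stage_startS pertE addn1 ltn_addr.
    rewrite E' (@orbit_layoff_stage _ _ P _ s); last 1 first.
    + by rewrite pertE addn1.
    + apply: le_trans (hgv (pert s).-1 _ cS); last by rewrite pertE addn1.
      by apply: ler_pM; rewrite ?(q_ge0 qP) ?(ltW d0) //; exact: (q_mono qP).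
    + by rewrite pertE addn1 leq_addr.
  apply: crossing => //.
  + by rewrite E; exact: (u_large (zP s)).
  + move=> l' hl'; apply: hgv; last by rewrite stage_startS ltn_add2l.
    by rewrite -addnS leq_addr.
  + by move: ne lr; rewrite E pertE addn1; move: (s.+2 * width s)%N; clear; lia.
  + by move: iS rwS; clear; lia.
- have ic : (i < pert s)%N by rewrite E pertE addn1.
  rewrite (zeta_layoff _ si ic) -exprD Phi_Xn; left; apply: crossing => //.
  + by rewrite E; exact: (g_large (zP s)).
  + by move=> l hl; rewrite E; exact: (g_large_v (zP s)).
  + by rewrite E; move: r0; rewrite pertE; clear; lia.
  + by move: iS rwS; clear; lia.
rewrite E zeta_pert // mulrBr -exprD mulrCA -exprD.
have [lr|lr] := ltnP (l + r) (stage_start s).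
  right; rewrite addnCA (addnC r) -zeta_pert // Phi_zeta //.
  apply: le_trans (v_chain (zP s) _ lr ks).
    by rewrite ler_wpM2r ?(q_ge0 qP).
  by rewrite -[ltnLHS]addn0 ltn_add2l.
left; rewrite linearB /= Phi_Xn.
have cS : (pert s + l < stage_start s.+1)%N by rewrite stage_startS ltn_add2l.
have h1 : 2 * Lam s * q k (f (r + (pert s + l))%N) <= q 0 (z (pert s + l)%N).
  have -> : (r + (pert s + l) = stage_start s.+1 + (l + r - stage_start s))%N.
    by move: lr; rewrite stage_startS; clear; lia.
  by apply: next_tiny => //; move: rwS ln; clear; lia.
have h2 : 2 * Lam s * q k (Phi (P s * 'X^(r + l))) <= q 0 (z (pert s + l)%N).
  have hb : q k (Phi (P s * 'X^(r + l))) <=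
      l1 (P s) * (q 0 (z (pert s + l)%N) / w s).
    rewrite -(l1MXn nuP (P s) (r + l)); apply: q_Phi_le => i'.
    rewrite coefMXn; case: ltnP => [|li']; first by rewrite eqxx.
    have [lt _|ge] := ltnP (i' - (r + l)) (size (P s)); last first.
      by rewrite nth_default ?eqxx.
    have hi : (stage_start s <= i')%N by move: lr li'; clear; lia.
    have hl : (i' - stage_start s < width s)%N.
      have := sizeP s; have := stage_start_gt s; rewrite widthE.
      by move: lt rD ln lr; clear; lia.
    rewrite ler_pdivlMr // mulrC -(subnKC hi) orbit_u ?(ltnW (width_le_block hl)) //.
    apply: le_trans (u_small_gv (zP s) hl _ cS); last by rewrite -addnS leq_addr.
    by rewrite ler_pM2l //; exact: (q_mono qP).
  have h := ler_wpM2l (mulr_ge0 (ler0n _ 2) (ltW d0)) hb.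
  apply: (le_trans h); move: (decay_poly_le s); move: (Lam s) => D hD.
  by rewrite !mulrA ler_pdivrMr // mulrC ler_pM2l.
have h3 := ler_wpM2l (ltW d0) (qB nuP qP k (f (r + (pert s + l))%N) (Phi (P s * 'X^(r + l)))).
rewrite mulrDr in h3.
move: h1 h2 h3; rewrite -!mulrA; lra.
Qed.

Lemma poly_shift_small s i k (p : {poly K}) :
  (stage_start s <= i)%N -> (i < stage_start s.+1)%N -> (k <= s)%N -> p`_0 = 0 ->
  (size p <= (stage_start s * stage_start s + stage_start s).+1)%N -> l1 p <= B s ->
  2 ^+ stage_start s.+1 * q k (Phi (p * zeta i)) <= q k.+1 (z i).
Proof.
move=> si iS ks p0 sp lp; have d0 := decay_gt0 s.
have B0 : 0 < B s by exact: lt_le_trans (B_ge1 s).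
have : q k (Phi (p * zeta i)) <= l1 p * (q k.+1 (z i) / Lam s).
  rewrite -{1}[p]coefK poly_def mulr_suml linear_sum /=.
  apply: (le_trans (q_sum nuP qP k _ _ _)); rewrite [leRHS]mulr_suml.
  apply: ler_sum => r _; rewrite -scalerAl linearZ /= (qZ qP).
  have [->|/eqP r0] := eqVneq (r : nat) 0%N; first by rewrite p0 (nu0 nuP) !mul0r.
  rewrite ler_wpM2l ?(nu_ge0 nuP) // ler_pdivlMr // mulrC.
  apply: shift_small => //; first by move: r0; clear; lia.
  by rewrite -ltnS (leq_trans (ltn_ord r)).
move=> /(ler_wpM2l (exprn_ge0 (stage_start s.+1) (ler0n R 2)))/le_trans; apply.
rewrite !mulrA ler_pdivrMr // mulrC ler_wpM2l ?(q_ge0 qP) //.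
by rewrite ler_pM2l ?exprn_gt0.
Qed.

(** For a polynomial A in the earlier positions, T^(pert s) - P s produces a
    combination of the vectors of v, which are small for q (j s). *)
Lemma pert_approx_poly s (A : {poly K}) : (size A <= stage_start s)%N ->
  w s * q (j s) (Phi (('X^(pert s) - P s) * A)) <= l1 A.
Proof.
move=> sA; rewrite [(_ - _) * A]mulrC -{1}[A]coefK poly_def mulr_suml.
rewrite linear_sum /= mulrC -ler_pdivlMr //; apply: (le_trans (q_sum nuP qP _ _ _ _)).
rewrite [leRHS]mulr_suml; apply: ler_sum => l _.
have ls : (l < stage_start s)%N by exact: leq_trans (ltn_ord l) sA.
rewrite -scalerAl linearZ /= (qZ qP) ler_wpM2l ?(nu_ge0 nuP) //.
rewrite mulrC mulrBl -exprD -zeta_pert // Phi_zeta //.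
by rewrite -[leRHS]mul1r ler_pdivlMr // mulrC; exact: (v_small (zP s)).
Qed.

Lemma pert_approx s i : (i < stage_start s)%N ->
  2 ^+ (s + i) * q (j s) (Phi (('X^(pert s) - P s) * zeta i)) <= q 0 (z i).
Proof.
move=> i_s; have h := pert_approx_poly (leq_trans (size_zeta sizeP i) i_s).
have h' := gauge_zeta P nuP qP i_s (z_gt0 i).
rewrite -(ler_pM2l (w_gt0 s)) mulrCA; apply: le_trans h'.
by rewrite ler_pM2l ?exprn_gt0.
Qed.

Lemma pow_le_decay s : 2 ^+ stage_start s.+1 <= Lam s.
Proof. by rewrite ler_peMr // exprn_ge0. Qed.

(** On u and g, T^(pert s) leads into the first row of the next u. A vector v_l is
    T^(pert s) f_l - P_s(T) f_l; applying T^(pert s) once more gives a tiny vector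
    minus P_s(T) v_l minus P_s(T)^2 f_l, and the last term is known before v_l is
    chosen large for q (j s).+1. *)
Lemma pert_shift_small s i : (stage_start s <= i)%N -> (i < stage_start s.+1)%N ->
  (j s <= s)%N -> (P s)`_0 = 0 ->
  2 ^+ stage_start s.+1 * q (j s) (Phi ('X^(pert s) * zeta i)) <=
    3 * q (j s).+1 (z i).
Proof.
move=> si iS js P0; have d0 := decay_gt0 s; set E2 := 2 ^+ _.
have E20 : 0 <= E2 by rewrite exprn_ge0.
have cwS : (stage_start s.+1 < width s.+1)%N := start_lt_width s.+1.
have q01 : q 0 (z i) <= q (j s).+1 (z i) by exact: (q_mono qP).
have tiny l : (l < width s.+1)%N ->
    E2 * q (j s) (f (stage_start s.+1 + l)%N) <= q (j s).+1 (z i).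
  move=> lw; apply: le_trans (le_trans (next_tiny iS lw js) q01).
  rewrite ler_wpM2r ?(q_ge0 qP) //; apply: (le_trans (pow_le_decay s)).
  by rewrite ler_peMl ?(ltW d0) // ler1n.
have qi0 := q_ge0 qP (j s).+1 (z i).
have [ic|ci] := ltnP i (pert s).
  rewrite (zeta_layoff _ si ic) -exprD Phi_Xn.
  have -> : (pert s + i = stage_start s.+1 + (i - stage_start s))%N.
    by move: si; rewrite stage_startS; clear; lia.
  apply: (le_trans (tiny _ _)); last by move: qi0; lra.
  by move: iS cwS; clear; lia.
have ln : (i - pert s < stage_start s)%N by rewrite ltn_subLR // -stage_startS.
rewrite -(subnKC ci); set l := (i - pert s)%N; have iE : (pert s + l = i)%N by rewrite subnKC.
have -> : 'X^(pert s) * zeta (pert s + l) =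
    'X^(stage_start s.+1 + (pert s + l - stage_start s))
    - (P s * zeta i + P s * P s * 'X^l) :> {poly K}.
  have -> : (stage_start s.+1 + (pert s + l - stage_start s) = pert s + (pert s + l))%N.
    by have := width_le_pert s; rewrite stage_startS; clear; lia.
  rewrite -iE zeta_pert // !exprD; ring.
rewrite linearB linearD /= Phi_Xn iE.
have h1 : E2 * q (j s) (f (stage_start s.+1 + (pert s + l - stage_start s))%N)
    <= q (j s).+1 (z i).
  by apply: tiny; move: cwS ln; rewrite -/l stage_startS; clear; lia.
have h2 : E2 * q (j s) (Phi (P s * zeta i)) <= q (j s).+1 (z i).
  apply: poly_shift_small => //.
    apply: leq_trans (sizeP s) _; have := stage_start_gt s; clear; lia.
  by apply: le_trans (poly_bound_l1 P nuP qP s z); rewrite lerDr.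
have h3 : E2 * q (j s) (Phi (P s * P s * 'X^l)) <= q (j s).+1 (z i).
  rewrite -iE; apply: le_trans (v_large (zP s) ln).
  apply: le_trans (decay_orbit_le s).
  have : q (j s) (Phi (P s * P s * 'X^l)) <= l1 (P s * P s) * G s.
    rewrite -(l1MXn nuP (P s * P s) l); apply: q_Phi_le => i'.
    rewrite coefMXn; case: ltnP => [|li']; first by rewrite eqxx.
    have [lt _|ge] := ltnP (i' - l) (size (P s * P s)); last first.
      by rewrite nth_default ?eqxx.
    apply: orbit_near => //; move: lt; rewrite ltnNge => /negP lt.
    rewrite ltnNge; apply/negP => ge; apply: lt.
    apply: leq_trans (size_polyMleq _ _) _; have := sizeP s.
    have := stage_start_gt s; move: ge ln; rewrite widthE -/l.
    by move: (size (P s)) => p; clear; lia.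
  move=> /(ler_wpM2l E20)/le_trans; apply.
  rewrite mulrA ler_wpM2r ?(ltW (G_gt0 _)) //.
  apply: (le_trans (ler_wpM2l E20 (l1M nuP _ _))).
  rewrite mulrA ler_wpM2r ?(l1_ge0 nuP) //.
  apply: (le_trans (y := Lam s)); last by rewrite ler_peMl ?(ltW d0) // ler1n.
  rewrite ler_pM2l ?exprn_gt0 //.
  by apply: le_trans (poly_bound_l1 P nuP qP s z); rewrite lerDr.
have h4 := ler_wpM2l E20 (qB nuP qP (j s)
  (f (stage_start s.+1 + (pert s + l - stage_start s))%N)
  (Phi (P s * zeta i) + Phi (P s * P s * 'X^l))).
have h5 := ler_wpM2l E20 (qD qP (j s) (Phi (P s * zeta i)) (Phi (P s * P s * 'X^l))).
rewrite iE mulrDr in h4; rewrite mulrDr in h5; rewrite iE in h1.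
move: h1 h2 h3 h4 h5; lra.
Qed.

(** According to the stage r of i: for r < s, T^(pert s) is close to P_s(T), which is
    admitted at stage r; for r = s this is pert_shift_small; for r > s the power
    pert s is small compared with stage r. *)
Lemma tail_small t s i : (t <= s)%N -> (stage_start t <= i)%N -> (j s <= t)%N ->
  (P s)`_0 = 0 -> l1 (P s) <= B t ->
  (size (P s) <= (stage_start t * stage_start t + stage_start t).+1)%N ->
  2 ^+ i * q (j s) (Phi ('X^(pert s) * zeta i)) <= 3 * q (j s).+1 (z i).
Proof.
move=> ts ti jt P0 lP sP; set r := stage_of i.
have i0 : (0 < i)%N by exact: leq_trans (stage_start_gt0 t) ti.
have /andP[ri iS] := stage_ofP i0; rewrite -/r in ri iS.
have tr : (t <= r)%N.
  rewrite leqNgt; apply/negP => rt; have := leq_trans iS (stage_start_mono rt).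
  by rewrite ltnNge ti.
have E2 : 2 ^+ i <= 2 ^+ stage_start r.+1 :> R by rewrite ler_weXn2l ?ler1n // ltnW.
have qi0 := q_ge0 qP (j s).+1 (z i).
have q01 : q 0 (z i) <= q (j s).+1 (z i) by exact: (q_mono qP).
have [rs|sr|E] := ltngtP r s.
- have i_s : (i < stage_start s)%N by rewrite (leq_trans iS) // stage_start_mono.
  have -> : 'X^(pert s) * zeta i = ('X^(pert s) - P s) * zeta i + P s * zeta i.
    by rewrite mulrBl subrK.
  rewrite linearD /=.
  have h1 : 2 ^+ i * q (j s) (Phi (('X^(pert s) - P s) * zeta i)) <= q (j s).+1 (z i).
    apply: le_trans (le_trans (pert_approx i_s) q01).
    by rewrite ler_wpM2r ?(q_ge0 qP) // ler_weXn2l ?ler1n // leq_addl.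
  have h2 : 2 ^+ i * q (j s) (Phi (P s * zeta i)) <= q (j s).+1 (z i).
    have := @poly_shift_small r i (j s) (P s) ri iS (leq_trans jt tr) P0.
    move=> h; apply: le_trans (h _ _).
    + by rewrite ler_wpM2r ?(q_ge0 qP).
    + have := stage_start_mono tr => m; apply: (leq_trans sP).
      by rewrite ltnS leq_add // leq_mul.
    + exact: le_trans lP (poly_bound_mono P nuP qP z tr).
  have h3 := ler_wpM2l (exprn_ge0 i (ler0n R 2))
    (qD qP (j s) (Phi (('X^(pert s) - P s) * zeta i)) (Phi (P s * zeta i))).
  rewrite mulrDr in h3; move: h1 h2 h3 qi0; lra.
- apply: (le_trans (y := q (j s).+1 (z i))); last by move: qi0; lra.
  have h := @shift_small r i (pert s) (j s) ri iS.
  apply: le_trans (h _ _ _).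
  + rewrite ler_wpM2r ?(q_ge0 qP) //; apply: (le_trans E2 (pow_le_decay r)).
  + by rewrite pertE addn1.
  + have := stage_start_mono sr; rewrite stage_startS.
    by move: (stage_start r) => m; clear; nia.
  + exact: leq_trans jt tr.
- have h := @pert_shift_small s i; rewrite -E in h *.
  apply: le_trans (h ri iS _ _).
  + by rewrite ler_wpM2r ?(q_ge0 qP).
  + by rewrite E (leq_trans jt).
  + by rewrite E.
Qed.

End Estimates.

(** * The operator determined by its orbit *)

Definition complete_seminorms (R : realType) (X : zmodType)
    (q : nat -> X -> R) : Prop :=
  forall u : nat -> X,
    (forall k eps, 0 < eps -> exists N, forall m n, (N <= m)%N -> (N <= n)%N ->
       q k (u m - u n) < eps) ->
    exists x, forall k eps, 0 < eps ->
      exists N, forall n, (N <= n)%N -> q k (u n - x) < eps.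

Lemma sum_half_pow (R : realType) (n m : nat) :
  \sum_(n <= i < n + m) 2^-1 ^+ i <= 2 * 2^-1 ^+ n :> R.
Proof.
suff -> : \sum_(n <= i < n + m) 2^-1 ^+ i = 2 * 2^-1 ^+ n - 2 * 2^-1 ^+ (n + m) :> R.
  by rewrite gerBl mulr_ge0 // exprn_ge0 // invr_ge0.
elim: m => [|m ih]; first by rewrite addn0 big_geq // subrr.
rewrite addnS big_nat_recr ?leq_addr //= ih exprS.
by move: (2^-1 ^+ n) (2^-1 ^+ (n + m)) => a b; lra.
Qed.

Lemma half_pow_small (R : realType) (n : nat) : (2^-1 ^+ n : R) <= n.+1%:R^-1.
Proof.
rewrite exprVn lef_pV2 ?posrE ?exprn_gt0 ?ltr0n //.
by rewrite -natrX ler_nat ltn_expl.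
Qed.

Section Series.
Variables (R : realType) (K : fieldType) (nu : K -> R).
Variables (X : lmodType K) (q : nat -> X -> R).
Hypothesis nuP : absolute_value nu.
Hypothesis qP : seminorms nu q.

Lemma geometric_tail k (x : nat -> X) (C : R) n N :
  (forall i, (n <= i)%N -> 2 ^+ i * q k (x i) <= C) -> (n <= N)%N ->
  q k (\sum_(i < N) x i - \sum_(i < n) x i) <= 2 * C * 2^-1 ^+ n.
Proof.
move=> h nN; rewrite -!(big_mkord xpredT x) (big_cat_nat (n := n)) //=.
rewrite addrAC subrr add0r; apply: (le_trans (q_sum nuP qP _ _ _ _)).
apply: (le_trans (y := \sum_(n <= i < N) C * 2^-1 ^+ i)).
  rewrite big_nat [leRHS]big_nat; apply: ler_sum => i /andP[ni _].
  by rewrite exprVn ler_pdivlMr ?exprn_gt0 // mulrC h.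
have C0 : 0 <= C.
  apply: le_trans (h n (leqnn n)); rewrite mulr_ge0 ?exprn_ge0 //.
  exact: (q_ge0 qP).
rewrite -mulr_sumr -mulrA mulrCA ler_wpM2l //.
by rewrite -(subnKC nN) sum_half_pow.
Qed.

Hypothesis q_complete : complete_seminorms q.

Lemma geometric_series (x : nat -> X) (C : nat -> R) :
  (forall k i, 2 ^+ i * q k (x i) <= C k) ->
  exists y, forall k n, q k (y - \sum_(i < n) x i) <= 2 * C k * 2^-1 ^+ n.
Proof.
move=> h; pose S n := \sum_(i < n) x i.
have tail k n N : (n <= N)%N -> q k (S N - S n) <= 2 * C k * 2^-1 ^+ n.
  by apply: geometric_tail => i _; exact: h.
have C0 k : 0 <= C k.
  apply: le_trans (h k 0%N); rewrite mulr_ge0 ?exprn_ge0 //.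
  exact: (q_ge0 qP).
have [k eps e0|y hy] := q_complete (u := S).
  have [N hN] : exists N : nat, 4 * C k / eps < N.+1%:R.
    by exists (Num.Def.truncn (4 * C k / eps)); exact: truncnS_gt.
  exists N => m n Nm Nn; apply: (le_lt_trans (q_dist_trans qP k (S m) (S N) (S n))).
  have h1 := tail k N m Nm.
  have h2 : q k (S N - S n) <= 2 * C k * 2^-1 ^+ N.
    by rewrite (q_distC nuP qP); exact: tail.
  have h3 : 4 * C k * 2^-1 ^+ N < eps.
    apply: (le_lt_trans (y := 4 * C k / N.+1%:R)).
      by rewrite ler_wpM2l ?half_pow_small // mulr_ge0.
    by rewrite ltr_pdivrMr ?ltr0n // -ltr_pdivrMl // mulrC.
  move: h1 h2 h3; rewrite -!mulrA; move: (C k * _) => a; lra.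
exists y => k n; apply/ler_addgt0Pr => eps e0.
have [N hN] := hy k eps e0.
apply: (le_trans (q_dist_trans qP k y (S (maxn n N)) (S n))).
rewrite addrC lerD ?tail ?leq_maxl //.
by rewrite (q_distC nuP qP) ltW // hN // leq_maxr.
Qed.

End Series.

Section Operator.
Variables (R : realType) (K : fieldType) (nu : K -> R).
Variables (X : lmodType K) (q : nat -> X -> R).
Hypothesis nuP : absolute_value nu.
Hypothesis qP : seminorms nu q.
Hypothesis q_complete : complete_seminorms q.
Hypothesis q_sep : forall x, (forall k, q k x = 0) -> x = 0.
Variables (P : nat -> {poly K}) (j : nat -> nat) (z : nat -> X).
Hypothesis sizeP : forall s, (size (P s) <= s.+1)%N.
Hypothesis z_gt0 : forall i, 0 < q 0 (z i).
Local Notation w s := (gauge nu q P s z).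
Hypothesis zP : forall s, stage_spec q s (j s) (w s) z.
Variable coord : nat -> X -> K.
Hypothesis coord_linear : forall i (c : K) x y,
  coord i (c *: x + y) = c * coord i x + coord i y.
Hypothesis coord_z : forall i i', coord i (z i') = (i == i')%:R.
Hypothesis coord_bound : forall k, exists k' C, 0 <= C /\
  forall i x, nu (coord i x) * q k (z i) <= C * q k' x.
Local Notation l1 := (l1norm nu).
Local Notation f := (orbit P z).
Local Notation Phi := (orbit_sum P z).
Local Notation zeta := (zpoly P).
Local Notation G s := (orbit_size q P s z).

(** The finitely many stages below k are absorbed into the constant; from stage k on
    shift_small with r = 1 applies. *)
Lemma term_bound k : exists k' C, 0 <= C /\ forall i x,
  2 ^+ i * q k (coord i x *: Phi ('X * zeta i)) <= C * q k' x.
Proof.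
pose t i := 2 ^+ i * q k (Phi ('X * zeta i)) / q 0 (z i).
have t0 i : 0 <= t i.
  by rewrite !mulr_ge0 ?invr_ge0 ?exprn_ge0 ?(q_ge0 qP).
pose M := 1 + \sum_(i < stage_start k) t i.
have M0 : 0 <= M by rewrite addr_ge0 ?sumr_ge0.
have hM i : 2 ^+ i * q k (Phi ('X * zeta i)) <= M * q k.+1 (z i).
  have [ik|ki] := ltnP i (stage_start k).
    apply: (le_trans (y := t i * q 0 (z i))).
      by rewrite /t divfK // gt_eqF.
    apply: ler_pM => //; [exact: (q_ge0 qP)| |exact: (q_mono qP)].
    rewrite /M (bigD1 (Ordinal ik)) //= addrCA lerDl.
    by rewrite addr_ge0 // sumr_ge0.
  have i0 : (0 < i)%N by exact: leq_trans (stage_start_gt0 k) ki.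
  have /andP[h1 h2] := stage_ofP i0; set s := stage_of i in h1 h2.
  have ks : (k <= s)%N.
    rewrite leqNgt; apply/negP => sk; have := leq_trans h2 (stage_start_mono sk).
    by rewrite ltnNge ki.
  have := shift_small nuP qP sizeP z_gt0 zP h1 h2 (ltn0Sn 0) _ ks.
  rewrite expr1 => h; apply: (le_trans (y := q k.+1 (z i))); last first.
    by rewrite ler_peMl ?(q_ge0 qP) // lerDl sumr_ge0.
  apply: le_trans (h _); last by have := stage_start_gt0 s; clear; lia.
  rewrite ler_wpM2r ?(q_ge0 qP) //.
  apply: (le_trans (ler_weXn2l _ (ltnW h2))); first by rewrite ler1n.
  exact: (pow_le_decay nuP qP).
have [k' [C [C0 hC]]] := coord_bound k.+1.
exists k', (M * C); split; first by rewrite mulr_ge0.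
move=> i x; rewrite (qZ qP) mulrCA.
apply: (le_trans (ler_wpM2l (nu_ge0 nuP _) (hM i))).
by rewrite mulrCA -mulrA ler_wpM2l.
Qed.

Definition bounded_operator (T : X -> X) : Prop :=
  forall k, exists k' C, 0 <= C /\ forall x, q k (T x) <= C * q k' x.

Lemma q_eq0_eq (x y : X) : (forall k eps, 0 < eps -> q k (x - y) <= eps) -> x = y.
Proof.
move=> h; apply/eqP; rewrite -subr_eq0; apply/eqP/q_sep => k.
apply/eqP; rewrite eq_le (q_ge0 qP) andbT.
by apply/ler_addgt0Pr => eps e0; rewrite add0r h.
Qed.

(** T x is the sum of the series of coord i x times the prescribed image of z i; it
    converges absolutely for every seminorm, whatever the Schauder expansion does. *)
Lemma operator_exists : exists T : X -> X,
  [/\ linear T, bounded_operator T &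
      forall k, exists k' C, 0 <= C /\ forall x n,
        q k (T x - \sum_(i < n) coord i x *: Phi ('X * zeta i))
          <= C * q k' x * 2^-1 ^+ n].
Proof.
have sum_ex x : exists y, forall k, forall k' C, 0 <= C ->
    (forall i x, 2 ^+ i * q k (coord i x *: Phi ('X * zeta i)) <= C * q k' x) ->
    forall n, q k (y - \sum_(i < n) coord i x *: Phi ('X * zeta i))
      <= 2 * (C * q k' x) * 2^-1 ^+ n.
  have [kk hkk] := choice term_bound; have [CC hC] := choice hkk.
  have [y hy] := geometric_series nuP qP q_complete
    (x := fun i => coord i x *: Phi ('X * zeta i))
    (fun k i => (hC k).2 i x).
  exists y => k k' C C0 h n; apply/ler_addgt0Pr => eps e0.
  set S := fun n => \sum_(i < n) coord i x *: Phi ('X * zeta i).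
  have [N hN] : exists N : nat, 2 * (CC k * q (kk k) x) / eps < N.+1%:R.
    by exists (Num.Def.truncn (2 * (CC k * q (kk k) x) / eps)); exact: truncnS_gt.
  apply: (le_trans (q_dist_trans qP k y (S (maxn n N)) (S n))).
  rewrite addrC lerD //.
    have gt := geometric_tail (x := fun i => coord i x *: Phi ('X * zeta i)) nuP qP.
    by apply: gt (leq_maxl _ _) => i _; exact: h.
  have CC0 : 0 <= CC k * q (kk k) x by rewrite mulr_ge0 ?(q_ge0 qP) // (hC k).1.
  apply: (le_trans (hy k (maxn n N))).
  apply: (le_trans (y := 2 * (CC k * q (kk k) x) * 2^-1 ^+ N)).
    apply: ler_wpM2l; first by rewrite mulr_ge0.
    by apply: ler_wiXn2l; rewrite ?leq_maxr ?invr_ge0 // invf_le1 // ler1n.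
  apply: (le_trans (y := 2 * (CC k * q (kk k) x) / N.+1%:R)).
    by rewrite ler_wpM2l ?half_pow_small // mulr_ge0.
  by rewrite ler_pdivrMr ?ltr0n // -ler_pdivrMl // mulrC ltW.
have [T hT] := choice sum_ex.
have hT' k : exists k' C, 0 <= C /\ forall x n,
    q k (T x - \sum_(i < n) coord i x *: Phi ('X * zeta i))
      <= C * q k' x * 2^-1 ^+ n.
  have [k' [C [C0 hC]]] := term_bound k.
  exists k', (2 * C); split; first by rewrite mulr_ge0.
  by move=> x n; rewrite -[2 * C * _]mulrA; exact: hT.
exists T; split=> //; last first.
  move=> k; have [k' [C [C0 hC]]] := hT' k; exists k', C; split=> // x.
  by have := hC x 0%N; rewrite big_ord0 subr0 expr0 mulr1.
move=> c x y; apply: q_eq0_eq => k eps e0.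
have [k' [C [C0 hC]]] := hT' k.
pose S x n := \sum_(i < n) coord i x *: Phi ('X * zeta i).
pose D := C * q k' (c *: x + y) + nu c * (C * q k' x) + C * q k' y.
have [N hN] : exists N : nat, D / eps < N.+1%:R.
  by exists (Num.Def.truncn (D / eps)); exact: truncnS_gt.
have SE : S (c *: x + y) N = c *: S x N + S y N.
  rewrite /S scaler_sumr -big_split; apply: eq_bigr => i _.
  by rewrite coord_linear scalerDl scalerA.
have -> : T (c *: x + y) - (c *: T x + T y) =
    (T (c *: x + y) - S (c *: x + y) N) - c *: (T x - S x N) - (T y - S y N).
  by rewrite SE scalerBr -[RHS]addrA -opprD addrACA -opprD opprB subrKA.
apply: (le_trans (y := D * 2^-1 ^+ N)).
  rewrite 2!mulrDl; apply: (le_trans (qB nuP qP _ _ _)); apply: (lerD _ (hC y N)).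
  apply: (le_trans (qB nuP qP _ _ _)); apply: (lerD (hC _ N)).
  by rewrite (qZ qP) -mulrA ler_wpM2l ?(nu_ge0 nuP) //; exact: hC.
have D0 : 0 <= D by rewrite !addr_ge0 ?mulr_ge0 ?(q_ge0 qP) ?(nu_ge0 nuP).
apply: (le_trans (y := D / N.+1%:R)).
  by rewrite ler_wpM2l ?half_pow_small.
by rewrite ler_pdivrMr ?ltr0n // -ler_pdivrMl // mulrC ltW.
Qed.

Variable T : {linear X -> X}.
Hypothesis T_bounded : bounded_operator T.
Hypothesis T_series : forall k, exists k' C, 0 <= C /\ forall x n,
  q k (T x - \sum_(i < n) coord i x *: Phi ('X * zeta i)) <= C * q k' x * 2^-1 ^+ n.

Lemma T_series_lim k x eps : 0 < eps -> exists N, forall n, (N <= n)%N ->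
  q k (T x - \sum_(i < n) coord i x *: Phi ('X * zeta i)) <= eps.
Proof.
move=> e0; have [k' [C [C0 hC]]] := T_series k.
pose D := C * q k' x; have D0 : 0 <= D by rewrite mulr_ge0 ?(q_ge0 qP).
have [N hN] : exists N : nat, D / eps < N.+1%:R.
  by exists (Num.Def.truncn (D / eps)); exact: truncnS_gt.
exists N => n Nn; apply: (le_trans (hC x n)).
apply: (le_trans (y := D / N.+1%:R)).
  rewrite ler_wpM2l // (le_trans (half_pow_small R n)) //.
  by rewrite lef_pV2 ?posrE ?ltr0n // ler_nat.
by rewrite ler_pdivrMr ?ltr0n // -ler_pdivrMl // mulrC ltW.
Qed.

Lemma T_z i : T (z i) = Phi ('X * zeta i).
Proof.
apply: q_eq0_eq => k eps e0; have [N hN] := T_series_lim k (z i) e0.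
have := hN (maxn N i.+1) (leq_maxl _ _).
have h : (i < maxn N i.+1)%N by exact: leq_maxr.
rewrite (bigD1 (Ordinal h)) //= coord_z eqxx scale1r big1 ?addr0 // => i' ne.
rewrite coord_z; case: eqP => [E|_]; last by rewrite scale0r.
by move/eqP: ne; case; exact: val_inj.
Qed.

(** Induction on i: at a perturbed position the entry is z i plus a combination of
    earlier entries, to which the induction hypothesis applies. *)
Lemma T_f i : T (f i) = f i.+1.
Proof.
elim/ltn_ind: i => i ih.
have hP (p : {poly K}) : (size p <= i)%N -> T (Phi p) = Phi ('X * p).
  move=> pi; rewrite /orbit_sum linear_sum /= -/(orbit_sum P z ('X * p)).
  rewrite [X in 'X * X]  (_ : p = \sum_(k < size p) p`_k *: 'X^k); last first.
    by rewrite -poly_def coefK.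
  rewrite mulr_sumr linear_sum /=; apply: eq_bigr => k _.
  rewrite linearZ /= ih ?(leq_trans (ltn_ord k)) //.
  by rewrite -scalerAr linearZ /= -exprS Phi_Xn.
have [ic|ci] := ltnP i (pert (stage_of i)).
  by rewrite orbit_layoff // T_z /zpoly leqNgt ic /= -exprS Phi_Xn.
rewrite (orbit_pert sizeP) // linearD /= T_z hP; last first.
  apply: (leq_trans (size_polyMleq _ _)); rewrite size_polyXn addnS /=.
  have := sizeP (stage_of i); have := width_le_pert (stage_of i).
  have := stage_start_gt (stage_of i) => h1 h2 h3.
  apply: (leq_trans (leq_add h3 (leqnn _))); move: h1 h2 ci; clear; lia.
by rewrite -linearD /= -mulrDr /zpoly ci subrK -exprS Phi_Xn.
Qed.

Lemma T_Phi (p : {poly K}) : T (Phi p) = Phi ('X * p).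
Proof.
rewrite /orbit_sum linear_sum /= -/(orbit_sum P z ('X * p)).
rewrite [X in 'X * X]  (_ : p = \sum_(k < size p) p`_k *: 'X^k); last first.
  by rewrite -poly_def coefK.
rewrite mulr_sumr linear_sum /=; apply: eq_bigr => k _.
by rewrite linearZ /= T_f -scalerAr linearZ /= -exprS Phi_Xn.
Qed.

Lemma iter_Phi m (p : {poly K}) : iter m T (Phi p) = Phi ('X^m * p).
Proof.
elim: m => [|m ih]; first by rewrite expr0 mul1r.
by rewrite iterS ih T_Phi mulrA -exprS.
Qed.

Lemma iter_linear m : linear (iter m T).
Proof. by elim: m => [|m ih] c x y //=; rewrite ih linearP. Qed.

Lemma iterB m x y : iter m T (x - y) = iter m T x - iter m T y.
Proof. by elim: m => [|m ih] //=; rewrite ih linearB. Qed.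

Lemma iter_bounded m : bounded_operator (iter m T).
Proof.
elim: m => [|m ih] k; first by exists k, 1; split=> // x; rewrite mul1r.
have [k1 [C1 [C10 h1]]] := T_bounded k; have [k2 [C2 [C20 h2]]] := ih k1.
exists k2, (C1 * C2); split; first by rewrite mulr_ge0.
by move=> x /=; apply: (le_trans (h1 _)); rewrite -mulrA ler_wpM2l.
Qed.

(** After one application of T the expansion of x converges absolutely, and the
    remaining m - 1 applications are continuous. *)
Lemma iter_head k m n (x : X) (C : R) : (0 < m)%N ->
  (forall i, (n <= i)%N -> 2 ^+ i * q k (coord i x *: Phi ('X^m * zeta i)) <= C) ->
  q k (iter m T x - Phi ('X^m * \sum_(i < n) coord i x *: zeta i))
    <= 2 * C * 2^-1 ^+ n.
Proof.
case: m => [//|m] _ h; apply/ler_addgt0Pr => eps e0.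
have [k' [D [D0 hD]]] := iter_bounded m k.
have D1 : 0 < D + 1 by rewrite ltr_wpDl.
have [N hN] := T_series_lim k' x (divr_gt0 e0 D1).
pose S n := \sum_(i < n) coord i x *: Phi ('X^(m.+1) * zeta i).
have SE n' : iter m T (\sum_(i < n') coord i x *: Phi ('X * zeta i)) = S n'.
  elim: n' => [|n' ih]; first by rewrite /S !big_ord0; have := iterB m 0 0; rewrite !subrr.
  rewrite /S !big_ord_recr /= addrC (iter_linear m) ih iter_Phi mulrA -exprSr.
  by rewrite addrC.
have -> : Phi ('X^(m.+1) * \sum_(i < n) coord i x *: zeta i) = S n.
  rewrite mulr_sumr linear_sum /=; apply: eq_bigr => i _.
  by rewrite -scalerAr linearZ.
apply: (le_trans (q_dist_trans qP k _ (S (maxn n N)) _)).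
rewrite addrC lerD //; first exact: (geometric_tail nuP qP h (leq_maxl _ _)).
rewrite -SE iterSr -iterB; apply: (le_trans (hD _)).
apply: (le_trans (ler_wpM2l D0 (hN _ (leq_maxr _ _)))).
by rewrite mulrA ler_pdivrMr // mulrC ler_pM2l // lerDl.
Qed.

End Operator.

(** * Every orbit is dense *)

Lemma archimedean_ratio (R : realType) (D eps : R) : 0 < eps ->
  exists N, forall n, (N <= n)%N -> D / n.+1%:R <= eps.
Proof.
move=> e0; exists (Num.Def.truncn (D / eps)) => n Nn.
rewrite ler_pdivrMr ?ltr0n // -ler_pdivrMl // mulrC ltW //.
apply: lt_le_trans (truncnS_gt _) _.
by rewrite ler_nat ltnS.
Qed.

Section Density.
Variables (R : realType) (K : fieldType) (nu : K -> R).
Variables (X : lmodType K) (q : nat -> X -> R).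
Hypothesis nuP : absolute_value nu.
Hypothesis qP : seminorms nu q.
Hypothesis q_sep : forall x, (forall k, q k x = 0) -> x = 0.
Variables (P : nat -> {poly K}) (j : nat -> nat) (z : nat -> X).
Hypothesis sizeP : forall s, (size (P s) <= s.+1)%N.
Hypothesis schedule : forall (r : {poly K}) (rho : R) (k s0 : nat), 0 < rho ->
  exists s, [/\ (s0 <= s)%N, j s = k, (size (P s) <= size r)%N,
    l1norm nu (P s - r) <= rho & r`_0 = 0 -> (P s)`_0 = 0].
Hypothesis schedule1 : forall (k s0 : nat),
  exists s, [/\ (s0 <= s)%N, j s = k & P s = 1].
Hypothesis z_gt0 : forall i, 0 < q 0 (z i).
Local Notation w s := (gauge nu q P s z).
Hypothesis zP : forall s, stage_spec q s (j s) (w s) z.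
Variable coord : nat -> X -> K.
Hypothesis coord_linear : forall i (c : K) x y,
  coord i (c *: x + y) = c * coord i x + coord i y.
Hypothesis coord_z : forall i i', coord i (z i') = (i == i')%:R.
Hypothesis coord_bound : forall k, exists k' C, 0 <= C /\
  forall i x, nu (coord i x) * q k (z i) <= C * q k' x.
Hypothesis coord_sep : forall x, (forall i, coord i x = 0) -> x = 0.
Local Notation l1 := (l1norm nu).
Local Notation f := (orbit P z).
Local Notation Phi := (orbit_sum P z).
Local Notation zeta := (zpoly P).
Local Notation G s := (orbit_size q P s z).
Hypothesis Phi_dense : forall x k eps, 0 < eps -> exists p, q k (x - Phi p) < eps.

Variable T : {linear X -> X}.
Hypothesis T_bounded : bounded_operator q T.
Hypothesis T_series : forall k, exists k' C, 0 <= C /\ forall x n,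
  q k (T x - \sum_(i < n) coord i x *: Phi ('X * zeta i)) <= C * q k' x * 2^-1 ^+ n.

Let iterPhi := iter_Phi qP q_sep sizeP coord_z T_series.

(** The polynomial A with A(T) (z 0) equal to the sum of the first n coordinates of x
    times their vectors. *)
Definition head_poly (n : nat) (x : X) : {poly K} := \sum_(i < n) coord i x *: zeta i.

Lemma size_head n x : (size (head_poly n x) <= n)%N.
Proof.
apply: (leq_trans (size_sum _ _ _)); apply/bigmax_leqP => i _.
apply: (leq_trans (size_scale_leq _ _)).
by apply: (leq_trans (size_zeta sizeP i)).
Qed.

Lemma Phi_head n x : Phi (head_poly n x) = \sum_(i < n) coord i x *: z i.
Proof.
rewrite linear_sum /=; apply: eq_bigr => i _.
by rewrite linearZ /= Phi_zeta.
Qed.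

Lemma coord_sum n i (c : nat -> K) (y : nat -> X) :
  coord i (\sum_(k < n) c k *: y k) = \sum_(k < n) c k * coord i (y k).
Proof.
elim: n => [|n ih]; last by rewrite !big_ord_recr /= addrC coord_linear ih addrC.
rewrite !big_ord0; have := coord_linear i 1 0 0.
by rewrite scaler0 addr0 mul1r => /eqP; rewrite -subr_eq subrr => /eqP.
Qed.

Lemma coord_Phi_head n x i : (i < n)%N -> coord i (Phi (head_poly n x)) = coord i x.
Proof.
move=> i_n; rewrite Phi_head (coord_sum n i (fun k => coord k x)).
rewrite (bigD1 (Ordinal i_n)) //= coord_z eqxx mulr1 big1 ?addr0 // => k ne.
rewrite coord_z; case: eqP => [E|_]; last by rewrite mulr0.
by move/eqP: ne; case; exact: val_inj.
Qed.

Lemma l1_head n x (D : R) :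
  (forall i, (i < n)%N -> nu (coord i x) * q 0 (z i) <= D) ->
  l1 (head_poly n x) <= D * \sum_(i < n) l1 (zeta i) / q 0 (z i).
Proof.
move=> h; apply: (le_trans (l1_sum nuP _ _)); rewrite mulr_sumr.
apply: ler_sum => i _; rewrite (l1Z nuP).
rewrite [leRHS]mulrCA mulrC ler_wpM2l ?(l1_ge0 nuP) //.
by rewrite ler_pdivlMr // h.
Qed.

(** When P s = 1, the polynomial of the position pert s + l is 'X^(pert s + l) - 'X^l,
    so the passage from stage s to s.+1 changes the low coefficients by single
    coordinates of x. *)
Lemma head_special s x i : P s = 1 -> (i < stage_start s)%N ->
  (head_poly (stage_start s.+1) x)`_i =
    (head_poly (stage_start s) x)`_i - coord (pert s + i)%N x.
Proof.
move=> P1 i_s.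
have sub : (stage_start s <= pert s)%N by have := width_le_pert s; clear; lia.
have split_sum : head_poly (stage_start s.+1) x = head_poly (stage_start s) x
    + \sum_(stage_start s <= k < pert s) coord k x *: 'X^k
    + \sum_(l < stage_start s) coord (pert s + l)%N x *: ('X^(pert s + l) - 'X^l).
  rewrite /head_poly -!(big_mkord xpredT (fun k => coord k x *: zeta k)).
  rewrite (big_cat_nat (n := stage_start s)) //=; last first.
    by rewrite ltnW // stage_start_ltS.
  rewrite -addrA; congr (_ + _).
  rewrite (big_cat_nat (n := pert s)) //=; last by rewrite stage_startS leq_addr.
  congr (_ + _).
    by apply: eq_big_nat => k /andP[h1 h2]; rewrite (zeta_layoff P h1 h2).
  rewrite -{1}[pert s]add0n big_addn stage_startS addKn big_mkord.
  by apply: eq_bigr => l _; rewrite addnC zeta_pert // P1 mul1r.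
have lt_pert l : (i < pert s + l)%N by rewrite ltn_addr // (leq_trans i_s).
rewrite split_sum !coefD; congr (_ + _).
  rewrite -[RHS]addr0; congr (_ + _); rewrite coef_sum big_nat big1 // => k.
  case/andP=> h1 h2; rewrite coefZ coefXn ltn_eqF ?mulr0 //.
  exact: leq_trans i_s h1.
rewrite coef_sum (bigD1 (Ordinal i_s)) //= coefZ coefB !coefXn eqxx.
rewrite ltn_eqF //.
rewrite sub0r mulrN1 big1 ?addr0 // => l ne.
rewrite coefZ coefB !coefXn ltn_eqF //.
rewrite sub0r; case: eqP => [E|_]; last by rewrite oppr0 mulr0.
by move/eqP: ne; case; exact: val_inj.
Qed.

(** If all low coefficients of the head at stage s.+1 were small, so would be those of
    the head at stage s, since the coordinates of x at v are tiny: v is large for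
    q (j s).+1. But the head at stage s has the non-zero coordinate of x at i0, which
    depends continuously on it. *)
Lemma head_pivot s x i0 k C D : P s = 1 -> (k <= s)%N -> (i0 < stage_start s)%N ->
  (forall y, nu (coord i0 y) * q 0 (z i0) <= C * q k y) -> 0 <= C ->
  (forall i, nu (coord i x) * q (j s).+1 (z i) <= D) -> D <= s.+1%:R ->
  C < nu (coord i0 x) * q 0 (z i0) * s.+1%:R ->
  exists2 i, (i < stage_start s)%N &
    pivot_bound q P s z <= nu (head_poly (stage_start s.+1) x)`_i.
Proof.
move=> P1 ks i0s hC C0 hD Ds big; apply: contrapT => no.
set pb := pivot_bound q P s z in no.
have pb0 : 0 < pb by exact: (pivot_bound_gt0 P qP).
have G0 : 0 < G s by exact: (orbit_size_gt0 P qP).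
set n := stage_start s in i0s no *.
have n0 : (0 : R) < n%:R by rewrite ltr0n stage_start_gt0.
have wpb : s.+1%:R <= pb * w s.
  rewrite /pb /pivot_bound mulrC ler_pdivlMr; last by rewrite !mulr_gt0.
  apply: le_trans (gauge_pivot P nuP qP s z); rewrite -/n.
  by rewrite le_eqVlt; apply/orP; left; apply/eqP; ring.
have tail i : (i < n)%N -> nu (coord (pert s + i)%N x) <= pb.
  move=> i_n; rewrite -(ler_pM2r (gauge_gt0 P nuP qP s z)).
  apply: le_trans wpb; apply: le_trans Ds; apply: le_trans (hD (pert s + i)%N).
  by rewrite ler_wpM2l ?(nu_ge0 nuP) //; exact: (v_large (zP s)).
have low i : (i < n)%N -> nu (head_poly n x)`_i <= 2 * pb.
  move=> i_n; have E := head_special x P1 i_n.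
  have -> : (head_poly n x)`_i = (head_poly (stage_start s.+1) x)`_i + coord (pert s + i)%N x.
    by rewrite E subrK.
  apply: (le_trans (nuD nuP _ _)); rewrite mulr_natl mulr2n lerD ?tail //.
  by rewrite leNgt; apply/negP => /ltW h; apply: no; exists i.
have lh : l1 (head_poly n x) <= n%:R * (2 * pb).
  rewrite (l1E nuP (size_head n x)).
  have -> : n%:R * (2 * pb) = \sum_(i < n) (2 * pb).
    by rewrite sumr_const card_ord mulr_natl.
  by apply: ler_sum => i _; exact: low.
have : nu (coord i0 x) * q 0 (z i0) <= C * (n%:R * (2 * pb) * G s).
  rewrite -(coord_Phi_head x i0s); apply: (le_trans (hC _)).
  rewrite ler_wpM2l //.
  apply: (le_trans (q_Phi_le nuP qP (p := head_poly n x) (g := G s) _)); last first.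
    by rewrite ler_wpM2r // ltW.
  move=> i; have [i_n _|ni] := ltnP i n; last first.
    by rewrite nth_default ?eqxx // (leq_trans (size_head _ _)).
  exact: (orbit_before qP).
have -> : C * (n%:R * (2 * pb) * G s) = C / s.+1%:R.
  rewrite /pb /pivot_bound -/n; field.
  by rewrite (gt_eqF G0) (gt_eqF n0) nat1r pnatr_eq0.
by rewrite ler_pdivlMr ?ltr0n // leNgt big.
Qed.

(** Take a late stage s with P s = 1 and the head polynomial A of x at t = s.+1. By
    head_pivot and approximate_division there is P0 with P0 * A close to 'X^(pert s)
    up to degrees where the orbit is tiny. A later stage s' with P s' close to P0
    gives T^(pert s') x close to P0(T) A(T) (z 0): on the tail by tail_small, on the
    head by pert_approx_poly. That vector is close to f (pert s), hence to f 0. *)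
Lemma orbit_approaches_start x k eps : x != 0 -> 0 < eps ->
  exists m, q k (iter m T x - f 0) <= eps.
Proof.
move=> x0 e0; have [i0 xi0] : exists i0, coord i0 x != 0.
  apply: contrapT => no; move/eqP: x0; apply; apply: coord_sep => i.
  by apply/eqP; apply: contrapT => /negP h; apply: no; exists i.
have [k0 [C0 [C00 hC0]]] := coord_bound 0%N.
have [k1 [C1 [C10 hC1]]] := coord_bound k.+1.
pose D0 := C0 * q k0 x; pose D1 := C1 * q k1 x.
have D00 : 0 <= D0 by rewrite mulr_ge0 ?(q_ge0 qP).
have D10 : 0 <= D1 by rewrite mulr_ge0 ?(q_ge0 qP).
pose g := nu (coord i0 x) * q 0 (z i0).
have g0 : 0 < g by rewrite mulr_gt0 // (nu_gt0 nuP).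
pose e6 := eps / 6; have e60 : 0 < e6 by rewrite divr_gt0.
(* s.+1 >= Big puts the coordinates of x within the bounds of stage s and makes
   the errors that involve D1 or the last v at most e6. *)
pose Big := 1 + D0 + D1 + (1 + C0) / g + (1 + 6 * D1) / e6.
have [N hN] := archimedean_ratio Big (ltr01 : (0 : R) < 1).
have [s [sN js P1]] := schedule1 k (maxn N (maxn k (maxn k0 i0))).
have {}hN : Big <= s.+1%:R.
  have := hN s (leq_trans (leq_maxl _ _) sN).
  by rewrite ler_pdivrMr ?ltr0n // mul1r.
have part0 : 0 <= (1 + C0) / g by rewrite divr_ge0 ?(ltW g0) // addr_ge0.
have part1 : 0 <= (1 + 6 * D1) / e6.
  by rewrite divr_ge0 ?(ltW e60) // addr_ge0 // mulr_ge0.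
have [B0 B1 Bg Be] : [/\ D0 <= s.+1%:R, D1 <= s.+1%:R, (1 + C0) / g <= s.+1%:R
    & (1 + 6 * D1) / e6 <= s.+1%:R].
  by move: hN part0 part1 D00 D10; rewrite /Big; split; lra.
have [ks k0s i0s] : [/\ (k <= s)%N, (k0 <= s)%N & (i0 <= s)%N].
  by move: sN; rewrite !geq_max => /andP[_ /andP[-> /andP[-> ->]]].
set t := s.+1; set n := stage_start t.
have kt : (k <= t)%N by exact: leqW.
have small1 : (1 + 6 * D1) / t.+1%:R <= e6.
  rewrite ler_pdivrMr ?ltr0n // -ler_pdivrMl // mulrC.
  by apply: (le_trans Be); rewrite ler_nat.
pose A := head_poly n x; have sA : (size A <= n)%N := size_head n x.
have lA : l1 A <= head_bound nu q P t z.
  apply: le_trans (l1_head (fun i _ => hC0 i x)) _; rewrite /head_bound.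
  rewrite ler_wpM2r //; last by apply: (le_trans B0); rewrite ler_nat.
  apply: sumr_ge0 => i _; rewrite mulr_ge0 ?(l1_ge0 nuP) // invr_ge0.
  exact: (q_ge0 qP).
have piv : exists2 i, (i < stage_start s)%N & pivot_bound q P s z <= nu A`_i.
  apply: (@head_pivot s x i0 k0 C0 D1) => //.
  - exact: leq_ltn_trans i0s (stage_start_gt s).
  - by move=> i; rewrite js; exact: hC1.
  - by move: Bg; rewrite ler_pdivrMr // mulrC; apply: lt_le_trans; rewrite ltrDr.
have [Q0 hQ] := quotient_boundP P nuP qP s z.
have [P0 [E1 [E2 [[PA P00 sP0 lP0] [lE1 lE2 E20 sE1 sE2]]]]] := hQ A sA lA piv.
rewrite -/t -/n in sP0 sE1 sE2 E20 lE1 lE2 lP0.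
have cn : (pert s < n)%N.
  by rewrite /n stage_startS -[ltnLHS]addn0 ltn_add2l stage_start_gt0.
set Q := quotient_bound nu q P t z in Q0 lP0 lE2.
set H := head_bound nu q P t z in lA.
have H0 : 0 <= H by exact: head_bound_ge0.
have G0 : 0 < G t by exact: (orbit_size_gt0 P qP).
have HG0 : 0 < 1 + H * G t by rewrite ltr_wpDr // mulr_ge0 // ltW.
(* The second bound limits the effect on the head to e6; the first one keeps
   P s' admitted at stage t. *)
pose rho := Num.min 1 (e6 / (1 + H * G t)).
have rho0 : 0 < rho by rewrite lt_min ltr01 divr_gt0.
have [N' hN'] := archimedean_ratio H e60.
have [s' [s'N js' sP' lP' P'0]] := schedule P0 k (maxn t N') rho0.
have ts' : (t <= s')%N := leq_trans (leq_maxl _ _) s'N.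
have N's' : (N' <= s')%N := leq_trans (leq_maxr _ _) s'N.
have rho1 : rho <= 1 by rewrite ge_min lexx.
have lPs' : l1 (P s') <= poly_bound nu q P t z.
  apply: le_trans (poly_bound_term P nuP qP t z).
  rewrite -[P s'](subrK P0); apply: (le_trans (l1D nuP _ _)).
  rewrite lerD //; apply: (le_trans lP'); apply: (le_trans rho1).
  by rewrite lerDl (l1_ge0 nuP).
have sizePs' : (size (P s') <= (n * n + n).+1)%N.
  by apply: (leq_trans sP'); apply: (leq_trans sP0); move: cn; clear; lia.
exists (pert s').
have near_q (p : {poly K}) : (size p <= n + width t)%N -> q k (Phi p) <= l1 p * G t.
  move=> sp; apply: (q_Phi_le nuP qP) => i; have [i_n _|ni] := ltnP i (n + width t).
    exact: (orbit_near nuP qP zP).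
  by rewrite nth_default ?eqxx // (leq_trans sp).
have polyE : 'X^(pert s') * A =
    ('X^(pert s') - P s') * A + (P s' - P0) * A + (E1 + E2) + 'X^(pert s).
  have -> : 'X^(pert s) = P0 * A - E1 - E2 by rewrite PA; ring.
  ring.
have PhiE : Phi ('X^(pert s') * A) - f 0 =
    Phi (('X^(pert s') - P s') * A) + Phi ((P s' - P0) * A) + (Phi E1 + Phi E2)
    + z (pert s).
  have -> : Phi ('X^(pert s') * A) =
      Phi (('X^(pert s') - P s') * A) + Phi ((P s' - P0) * A)
      + (Phi E1 + Phi E2) + Phi 'X^(pert s) by rewrite polyE !linearD.
  rewrite -addrA; congr (_ + _).
  rewrite Phi_Xn -[pert s]addn0 (orbit_pert_stage sizeP) ?stage_start_gt0 //.
  by rewrite P1 mul1r Phi_Xn addrK.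
apply: (le_trans (q_dist_trans qP k _ (Phi ('X^(pert s') * A)) _)).
have b1 : q k (iter (pert s') T x - Phi ('X^(pert s') * A)) <= e6.
  apply: le_trans small1.
  have tl i : (n <= i)%N ->
      2 ^+ i * q k (coord i x *: Phi ('X^(pert s') * zeta i)) <= 3 * D1.
    move=> ni; rewrite (qZ qP) mulrCA.
    have := tail_small nuP qP sizeP z_gt0 zP ts' ni; rewrite js'.
    move=> /(_ kt (P'0 P00) lPs' sizePs') h.
    apply: (le_trans (ler_wpM2l (nu_ge0 nuP _) h)).
    by rewrite mulrCA ler_wpM2l //; exact: hC1.
  have c0 : (0 < pert s')%N by rewrite pertE addn1.
  apply: (le_trans (iter_head nuP qP q_sep sizeP coord_z T_bounded T_series c0 tl)).
  apply: (le_trans (y := 6 * D1 / t.+1%:R)); last first.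
    by rewrite ler_pM2r ?invr_gt0 ?ltr0n // lerDr.
  have -> : 2 * (3 * D1) = 6 * D1 by rewrite mulrA -natrM.
  apply: ler_wpM2l; [by rewrite mulr_ge0|apply: (le_trans (half_pow_small R n))].
  by rewrite lef_pV2 ?posrE ?ltr0n // ler_nat ltnS ltnW // stage_start_gt.
have b2 : q k (Phi (('X^(pert s') - P s') * A)) <= e6.
  have := pert_approx_poly nuP qP sizeP zP (s := s') (A := A) (leq_trans sA (stage_start_mono ts')).
  rewrite js' => h; apply: le_trans (hN' s' N's').
  rewrite ler_pdivlMr ?ltr0n // mulrC; apply: le_trans (le_trans h lA).
  by rewrite ler_wpM2r ?(q_ge0 qP) //; exact: (gauge_ge_nat P nuP qP).
have b3 : q k (Phi ((P s' - P0) * A)) <= e6.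
  apply: (le_trans (near_q _ _)).
    apply: (leq_trans (size_polyMleq _ _)).
    have sB : (size (P s' - P0)%R <= pert s + n * n)%N.
      by rewrite (leq_trans (size_polyD _ _)) // size_polyN geq_max sP0 (leq_trans sP').
    rewrite widthE (leq_trans (leq_pred _)) // (leq_trans (leq_add sB sA)) //.
    by move: cn; rewrite -/n; clear; lia.
  apply: (le_trans (y := rho * H * G t)).
    rewrite ler_wpM2r ?(ltW G0) //; apply: (le_trans (l1M nuP _ _)).
    by rewrite ler_pM ?(l1_ge0 nuP).
  apply: (le_trans (y := e6 / (1 + H * G t) * (1 + H * G t))); last first.
    by rewrite divfK // gt_eqF.
  rewrite -mulrA; apply: ler_pM; first exact: ltW.
  - by rewrite mulr_ge0 // ltW.
  - by rewrite ge_min lexx orbT.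
  - by rewrite lerDr.
have one_small : 1 / t.+1%:R <= e6.
  apply: le_trans small1; rewrite ler_pM2r ?invr_gt0 ?ltr0n // lerDl.
  by rewrite mulr_ge0.
have b4 : q k (Phi E1) <= e6.
  apply: (le_trans (near_q _ _)).
    by apply: (leq_trans sE1); rewrite widthE; move: cn; rewrite -/n; clear; lia.
  apply: le_trans one_small; apply: (le_trans (ler_wpM2r (ltW G0) lE1)).
  rewrite /error_bound invfM -mulrA mulVf ?gt_eqF //.
  by rewrite mulr1 div1r.
have w0 := gauge_gt0 P nuP qP t z.
have b5 : q k (Phi E2) <= e6.
  apply: le_trans one_small.
  apply: (le_trans (y := l1 E2 * (w t)^-1)).
    apply: (q_Phi_le nuP qP) => i Ei.
    have ni : (n <= i)%N by rewrite leqNgt; apply: contra_neqN Ei => /E20.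
    have iE : (i < size E2)%N.
      by rewrite ltnNge; apply: contra_neqN Ei => h; rewrite nth_default.
    have il : (i - n < width t)%N.
      have := leq_trans iE sE2; rewrite widthE -/n; move: ni cn; clear; lia.
    rewrite -div1r ler_pdivlMr // mulrC -(subnKC ni).
    exact: (orbit_tiny nuP qP zP).
  rewrite ler_pdivrMr // mulrAC ler_pdivlMr ?ltr0n // mul1r mulrC.
  by apply: le_trans (gauge_quotient P nuP qP t z); rewrite ler_wpM2l.
have b6 : q k (z (pert s)) <= e6.
  have := v_small (zP s) (stage_start_gt0 s); rewrite addn0 js => h.
  apply: (le_trans (y := 1 / s.+1%:R)); last first.
    rewrite ler_pdivrMr ?ltr0n // -ler_pdivrMl // mulrC; apply: le_trans Be.
    by rewrite ler_pM2r ?invr_gt0 // lerDl mulr_ge0.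
  rewrite ler_pdivlMr ?ltr0n // mulrC; apply: le_trans h.
  by rewrite ler_wpM2r ?(q_ge0 qP) //; exact: (gauge_ge_nat P nuP qP).
rewrite PhiE.
have c1 := qD qP k (Phi (('X^(pert s') - P s') * A) + Phi ((P s' - P0) * A)
  + (Phi E1 + Phi E2)) (z (pert s)).
have c2 := qD qP k (Phi (('X^(pert s') - P s') * A) + Phi ((P s' - P0) * A))
  (Phi E1 + Phi E2).
have c3 := qD qP k (Phi (('X^(pert s') - P s') * A)) (Phi ((P s' - P0) * A)).
have c4 := qD qP k (Phi E1) (Phi E2).
have e6E : eps = 6 * e6 by rewrite /e6 mulrC divfK.
move: b1 b2 b3 b4 b5 b6 c1 c2 c3 c4; rewrite e6E.
move: (q k _) (q k _) (q k _) (q k _) (q k _) (q k _) (q k _) (q k _) (q k _) (q k _).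
by move=> *; lra.
Qed.

(** T^(pert s) (f 0) = z (pert s) + P_s(T) (f 0), with a small first term, and the
    polynomials P s approximate every r. *)
Lemma start_orbit_dense (r : {poly K}) k eps : 0 < eps ->
  exists m, q k (iter m T (f 0) - Phi r) <= eps.
Proof.
move=> e0; pose g := 1 + \sum_(i < size r) q k (f i).
have g1 : 1 <= g by rewrite lerDl sumr_ge0 // => i _; exact: (q_ge0 qP).
have g0 : 0 < g := lt_le_trans ltr01 g1.
have e20 : 0 < eps / 2 by rewrite divr_gt0.
have [N hN] := archimedean_ratio 1 e20.
have [s [Ns js sPs lPs _]] := schedule r k N (divr_gt0 e20 g0).
exists (pert s).
have -> : iter (pert s) T (f 0) = z (pert s) + Phi (P s).
  rewrite -Phi_Xn iterPhi expr0 mulr1 Phi_Xn -{1}[pert s]addn0.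
  rewrite (orbit_pert_stage sizeP) ?stage_start_gt0 // addn0.
  by rewrite expr0 mulr1.
rewrite -addrA -linearB /=; apply: (le_trans (qD qP _ _ _)).
rewrite [eps]splitr lerD //.
  have := v_small (zP s) (stage_start_gt0 s); rewrite addn0 js => h.
  apply: le_trans (hN s Ns); rewrite ler_pdivlMr ?ltr0n // mulrC.
  apply: le_trans h.
  by rewrite ler_wpM2r ?(q_ge0 qP) //; exact: (gauge_ge_nat P nuP qP).
apply: (le_trans (y := l1 (P s - r) * g)).
  apply: (q_Phi_le nuP qP) => i pi0.
  have [ir|ri] := ltnP i (size r).
    rewrite /g (bigD1 (Ordinal ir)) //= addrCA lerDl addr_ge0 //.
    by rewrite sumr_ge0 // => l _; exact: (q_ge0 qP).
  by move/eqP: pi0; case; rewrite coefB !nth_default ?subrr // (leq_trans sPs).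
by rewrite -ler_pdivlMr.
Qed.

(** M contains f 0 by orbit_approaches_start, hence the dense set of all r(T) (f 0). *)
Lemma closed_invariant_full (M : set X) :
  (forall x, (forall k eps, 0 < eps -> exists2 y, M y & q k (y - x) <= eps) -> M x) ->
  (forall x, M x -> M (T x)) -> (exists2 x, M x & x != 0) -> forall y, M y.
Proof.
move=> Mcl MT [x Mx x0].
have Miter u m : M u -> M (iter m T u).
  by move=> Mu; elim: m => //= m; exact: MT.
have Mf : M (f 0).
  apply: Mcl => k eps e0; have [m hm] := orbit_approaches_start k x0 e0.
  by exists (iter m T x) => //; exact: Miter.
have MPhi r : M (Phi r).
  apply: Mcl => k eps e0; have [m hm] := start_orbit_dense r k e0.
  by exists (iter m T (f 0)) => //; exact: Miter.
move=> y; apply: Mcl => k eps e0; have [r hr] := Phi_dense y k e0.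
by exists (Phi r) => //; rewrite (q_distC nuP qP) ltW.
Qed.

End Density.

(** * Equicontinuity of the partial sums of a Schauder expansion *)

Lemma dependent_choice (A : Type) (good : nat -> A -> Prop)
    (step : nat -> A -> A -> Prop) (a0 : A) : good 0%N a0 ->
  (forall n a, good n a -> exists2 b, good n.+1 b & step n a b) ->
  exists u : nat -> A, [/\ u 0%N = a0, forall n, good n (u n) &
    forall n, step n (u n) (u n.+1)].
Proof.
move=> g0 h.
have h' (na : nat * A) : exists b, good na.1 na.2 -> good na.1.+1 b /\ step na.1 na.2 b.
  have [g|ng] := pselect (good na.1 na.2); last by exists na.2.
  by have [b gb sb] := h _ _ g; exists b.
have [F hF] := choice h'.
pose u := fix u n := if n is m.+1 then F (m, u m) else a0.
have gu n : good n (u n).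
  by elim: n => [//|n ih]; have [] := hF (n, u n) ih.
by exists u; split=> // n; have [] := hF (n, u n) (gu n).
Qed.

Section Expansion.
Variables (R : realType) (K : fieldType) (nu : K -> R).
Variables (X : lmodType K) (q : nat -> X -> R) (e : nat -> X).
Hypothesis nuP : absolute_value nu.
Hypothesis nu_nat : forall n, nu n%:R = n%:R.
Hypothesis nu_complete : forall u : nat -> K,
  (forall eps, 0 < eps -> exists N, forall m n, (N <= m)%N -> (N <= n)%N ->
     nu (u m - u n) < eps) ->
  exists b, forall eps, 0 < eps -> exists N, forall n, (N <= n)%N -> nu (u n - b) < eps.
Hypothesis qP : seminorms nu q.
Hypothesis q_complete : complete_seminorms q.
Hypothesis q_sep : forall x, (forall k, q k x = 0) -> x = 0.
Hypothesis e_gt0 : forall n, 0 < q 0 (e n).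

Definition expands (a : nat -> K) (x : X) : Prop := forall k eps, 0 < eps ->
  exists N, forall n, (N <= n)%N -> q k (\sum_(i < n) a i *: e i - x) < eps.

Variable a : nat -> X -> K.
Hypothesis a_expands : forall x, expands (a^~ x) x.
Hypothesis a_unique : forall x b, expands b x -> forall i, b i = a i x.

Lemma expands_linear c x y b b' : expands b x -> expands b' y ->
  expands (fun i => c * b i + b' i) (c *: x + y).
Proof.
move=> hx hy k eps e0; have c1 : 0 < nu c + 1 by rewrite ltr_wpDl ?(nu_ge0 nuP).
have e1 : 0 < eps / 2 / (nu c + 1) by rewrite !divr_gt0.
have e2 : 0 < eps / 2 by rewrite divr_gt0.
have [N1 h1] := hx k _ e1; have [N2 h2] := hy k _ e2.
exists (maxn N1 N2) => n; rewrite geq_max => /andP[n1 n2].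
have -> : \sum_(i < n) (c * b i + b' i) *: e i - (c *: x + y) =
    c *: (\sum_(i < n) b i *: e i - x) + (\sum_(i < n) b' i *: e i - y).
  rewrite scalerBr addrACA -opprD; congr (_ - _).
  rewrite scaler_sumr -big_split; apply: eq_bigr => i _.
  by rewrite scalerDl scalerA.
apply: (le_lt_trans (qD qP _ _ _)); rewrite [eps]splitr ler_ltD ?h2 // (qZ qP).
apply: (le_trans (y := nu c * (eps / 2 / (nu c + 1)))).
  by rewrite ler_wpM2l ?(nu_ge0 nuP) // ltW // h1.
by rewrite mulrCA -[leRHS]mulr1 ler_wpM2l ?(ltW e2) // ler_pdivrMr // mul1r lerDl.
Qed.

Lemma a_linear i c x y : a i (c *: x + y) = c * a i x + a i y.
Proof.
by rewrite -(a_unique (expands_linear c (a_expands x) (a_expands y))).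
Qed.

Lemma a_basis i i' : a i (e i') = (i == i')%:R.
Proof.
rewrite -(a_unique (b := fun m => (m == i')%:R) (x := e i')) // => k eps e0.
exists i'.+1 => n i'n.
rewrite (bigD1 (Ordinal i'n)) //= eqxx scale1r big1 ?addr0 => [|m ne].
  by rewrite subrr (q_zero nuP qP).
case: eqP => [E|_]; last by rewrite scale0r.
by move/eqP: ne; case; exact: val_inj.
Qed.

Definition psum (N : nat) (x : X) : X := \sum_(i < N) a i x *: e i.

Lemma psum_linear N c x y : psum N (c *: x + y) = c *: psum N x + psum N y.
Proof.
rewrite /psum scaler_sumr -big_split; apply: eq_bigr => i _.
by rewrite a_linear scalerDl scalerA.
Qed.

Lemma psum0 N : psum N 0 = 0.
Proof. by have := psum_linear N (-1) 0 0; rewrite scaler0 addr0 scaleN1r addNr. Qed.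

Lemma psumD N x y : psum N (x + y) = psum N x + psum N y.
Proof. by have := psum_linear N 1 x y; rewrite !scale1r. Qed.

Lemma psumZ N c x : psum N (c *: x) = c *: psum N x.
Proof. by rewrite -[c *: x]addr0 psum_linear psum0 addr0. Qed.

Lemma psumB N x y : psum N (x - y) = psum N x - psum N y.
Proof. by rewrite -!scaleN1r addrC psum_linear addrC. Qed.

Lemma psum_sum N n (y : nat -> X) : psum N (\sum_(i < n) y i) = \sum_(i < n) psum N (y i).
Proof.
by elim: n => [|n ih]; rewrite ?big_ord0 ?psum0 // !big_ord_recr psumD ih.
Qed.

Definition psum_le (k : nat) (x : X) (C : R) : Prop := forall N, q k (psum N x) <= C.

Lemma psum_bounded k x : exists2 C, 0 <= C & psum_le k x C.
Proof.
have [N hN] := a_expands x k ltr01.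
pose C := q k x + 1 + \sum_(n < N) q k (psum n x).
have S0 : 0 <= \sum_(n < N) q k (psum n x) by apply: sumr_ge0 => i _; exact: (q_ge0 qP).
exists C; first by rewrite !addr_ge0 // (q_ge0 qP).
move=> n; have [nN|Nn] := ltnP n N.
  rewrite /C (bigD1 (Ordinal nN)) //= addrCA lerDl !addr_ge0 ?(q_ge0 qP) //.
  by rewrite sumr_ge0 // => i _; exact: (q_ge0 qP).
apply: (le_trans (y := q k x + 1)); last by rewrite lerDl.
rewrite -[psum n x](subrK x) addrC; apply: (le_trans (qD qP _ _ _)).
by rewrite lerD2l ltW // hN.
Qed.

Lemma psum_le_self k x C : psum_le k x C -> q k x <= C.
Proof.
move=> h; apply/ler_addgt0Pr => eps e0; have [N hN] := a_expands x k e0.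
have := hN N (leqnn N); rewrite (q_distC nuP qP) => h1.
rewrite -[x](subrK (psum N x)); apply: (le_trans (qD qP _ _ _)).
by rewrite addrC lerD // ltW.
Qed.

(** Completeness for the seminorms x |-> sup_N q k (psum N x), in the form needed for
    geometric series. The partial sums of the limit are the limits Y N of the partial
    sums: Y N.+1 - Y N is a multiple of e N because the coefficients form a Cauchy
    sequence, and the Y N converge to x by uniformity in N. *)
Lemma psum_series (y : nat -> X) (C : nat -> R) :
  (forall k i, psum_le k (y i) (C k * 2^-1 ^+ i)) ->
  exists x, (forall k n, q k (x - \sum_(i < n) y i) <= 2 * C k * 2^-1 ^+ n) /\
    forall k, psum_le k x (2 * C k).
Proof.
move=> h.
have scaled k i v : q k v <= C k * 2^-1 ^+ i -> 2 ^+ i * q k v <= C k.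
  by rewrite exprVn ler_pdivlMr ?exprn_gt0 // mulrC.
have [x hx] := geometric_series nuP qP q_complete
  (fun k i => scaled k i _ (psum_le_self (h k i))).
have hY N : exists Y, forall k n,
    q k (Y - psum N (\sum_(i < n) y i)) <= 2 * C k * 2^-1 ^+ n.
  have [Y hY] := geometric_series nuP qP q_complete
    (fun k i => scaled k i _ (h k i N)).
  by exists Y => k n; rewrite psum_sum.
have [Y hYP] := choice hY.
have C0 k : 0 <= C k by have := le_trans (q_ge0 qP _ _) (h k 0%N 0%N); rewrite mulr1.
have small k eps : 0 < eps -> exists N, forall n, (N <= n)%N -> C k * 2^-1 ^+ n <= eps.
  move=> e0; have [N hN] := archimedean_ratio (C k) e0; exists N => n Nn.
  by apply: le_trans (hN n Nn); rewrite ler_wpM2l ?half_pow_small.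
have step m : exists b, Y m.+1 - Y m = b *: e m.
  have dist k n : q k (Y m.+1 - Y m - a m (\sum_(i < n) y i) *: e m)
      <= 4 * (C k * 2^-1 ^+ n).
    have -> : Y m.+1 - Y m - a m (\sum_(i < n) y i) *: e m =
        (Y m.+1 - psum m.+1 (\sum_(i < n) y i)) - (Y m - psum m (\sum_(i < n) y i)).
      rewrite /psum big_ord_recr /= -[RHS]addrA -opprD.
      by rewrite [X in _ = _ - X]addrC subrKA opprD addrA.
    apply: (le_trans (qB nuP qP _ _ _)).
    have := hYP m.+1 k n; have := hYP m k n; rewrite -!mulrA.
    by move: (C k * _) => t; lra.
  have [eps e0|b hb] := nu_complete (u := fun n => a m (\sum_(i < n) y i)).
    have e1 : 0 < eps * q 0 (e m) / 16 by rewrite divr_gt0 // mulr_gt0.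
    have [N hN] := small 0%N _ e1; exists N => n n' Nn Nn'.
    rewrite -(ltr_pM2r (e_gt0 m)) -(qZ qP) scalerBl.
    apply: (le_lt_trans (q_dist_trans qP 0 _ (Y m.+1 - Y m) _)).
    have := dist 0%N n; have := dist 0%N n'; have := hN n Nn; have := hN n' Nn'.
    rewrite (q_distC nuP qP _ (a m (\sum_(i < n) y i) *: e m)).
    have e2 : 0 < eps * q 0 (e m) by rewrite mulr_gt0.
    by move: e2; move: (eps * _) (C 0%N * _) (C 0%N * _) => t u v; lra.
  exists b; apply: (q_eq0_eq qP q_sep) => k eps e0.
  have e1 : 0 < eps / 2 by rewrite divr_gt0.
  have e2 : 0 < eps / 8 by rewrite divr_gt0.
  have qe : 0 < q k (e m) by apply: lt_le_trans (e_gt0 m) (q_mono qP _ (leq0n k)).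
  have [N1 h1] := small k _ e2; have [N2 h2] := hb _ (divr_gt0 e1 qe).
  pose n := maxn N1 N2.
  apply: (le_trans (q_dist_trans qP k _ (a m (\sum_(i < n) y i) *: e m) _)).
  rewrite [eps]splitr lerD //.
    apply: (le_trans (dist k n)); have := h1 n (leq_maxl _ _).
    by move: (C k * _) => t; lra.
  rewrite -scalerBl (qZ qP) -ler_pdivlMr //.
  by rewrite ltW // h2 // leq_maxr.
have [b hb] := choice step.
have YE N : Y N = \sum_(i < N) b i *: e i.
  elim: N => [|N ih]; last by rewrite big_ord_recr /= -ih -hb addrC subrK.
  rewrite big_ord0; apply: (q_eq0_eq qP q_sep) => k eps e0.
  have [N hN] := small k _ (divr_gt0 e0 (ltr0n R 2 : 0 < 2)).
  have := hYP 0%N k N; rewrite /psum big_ord0 => h1.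
  apply: (le_trans h1); have := hN N (leqnn N); rewrite -mulrA.
  by move: (C k * _) => t; lra.
have bx : expands b x.
  move=> k eps e0; have e3 : 0 < eps / 8 by rewrite divr_gt0.
  have [n hn] := small k _ e3; have {}hn := hn n (leqnn n).
  have [N hN] := a_expands (\sum_(i < n) y i) k e3.
  exists N => m Nm; rewrite -YE.
  have h1 := hYP m k n; have h2 := hx k n; have h3 := hN m Nm.
  have h4 := q_dist_trans qP k (Y m) (psum m (\sum_(i < n) y i)) x.
  have h5 := q_dist_trans qP k (psum m (\sum_(i < n) y i)) (\sum_(i < n) y i) x.
  rewrite (q_distC nuP qP _ x) in h2.
  move: h1 h2 h3 h4 h5 hn e0; rewrite -!mulrA; move: (C k * _) => t.
  by rewrite /psum; lra.
exists x; split=> // k N.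
have -> : psum N x = Y N.
  by rewrite YE; apply: eq_bigr => i _; rewrite (a_unique bx).
have := hYP N k 0%N; rewrite big_ord0 psum0 subr0 expr0 mulr1; exact.
Qed.

Lemma psum_leB k x y C D : psum_le k x C -> psum_le k y D -> psum_le k (x - y) (C + D).
Proof.
move=> hx hy N; rewrite psumB; apply: (le_trans (qB nuP qP _ _ _)).
by rewrite lerD.
Qed.

(** x lies in the closure of the set of y with psum_le k y C. *)
Definition approximable (k : nat) (C : R) (x : X) : Prop :=
  forall l eps, 0 < eps -> exists2 y, psum_le k y C & q l (x - y) <= eps.

Lemma approximableB k C x y : approximable k C x -> approximable k C y ->
  approximable k (C + C) (x - y).
Proof.
move=> hx hy l eps e0; have e2 : 0 < eps / 2 by rewrite divr_gt0.
have [u u1 u2] := hx l _ e2; have [v v1 v2] := hy l _ e2.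
exists (u - v); first exact: psum_leB.
have -> : x - y - (u - v) = (x - u) - (y - v)
  by rewrite !opprD !opprK addrACA.
by apply: (le_trans (qB nuP qP _ _ _)); rewrite [eps]splitr lerD.
Qed.

(** Baire's theorem for the sets of y with psum_le k y n, which cover X. A ball in the
    closure of the set for n gives, by differences, a ball around 0 in the closure of
    the set for 2n. So if there were none of the latter, nested balls could be chosen
    that avoid all the sets one after another and shrink to a point outside all. *)
Lemma baire_ball k : exists l delta C, [/\ 0 < delta, 0 <= C &
  forall x, q l x <= delta -> approximable k C x].
Proof.
apply: contrapT => no.
have escape l delta n x0 : 0 < delta -> exists x, q l (x - x0) <= delta /\
    exists l' eps, 0 < eps /\ forall y, psum_le k y n%:R -> eps < q l' (x - y).
  move=> d0; apply: contrapT => no'; apply: no.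
  exists l, delta, (n%:R + n%:R); split=> //.
  have app x : q l (x - x0) <= delta -> approximable k n%:R x.
    move=> hx l' eps e0; apply: contrapT => no''; apply: no'.
    exists x; split=> //; exists l', eps; split=> // y hy.
    by rewrite ltNge; apply/negP => h; apply: no''; exists y.
  move=> h qh; rewrite -[h](addrK x0); apply: approximableB; apply: app.
    by rewrite addrK.
  by rewrite subrr (q_zero nuP qP) ltW.
(* Closed balls: a centre, the index of a seminorm and a radius. *)
pose A := (X * nat * R)%type.
pose good (n : nat) (s : A) := (n <= s.1.2)%N /\ 0 < s.2 <= n.+1%:R^-1.
pose step (n : nat) (s t : A) := [/\ (s.1.2 <= t.1.2)%N, t.2 <= s.2 / 2,
  q s.1.2 (t.1.1 - s.1.1) <= s.2 / 2 &
  forall y, psum_le k y n%:R -> t.2 < q t.1.2 (t.1.1 - y)].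
have [||u [_ gu su]] := @dependent_choice A good step ((0 : X), 0%N, 1 : R).
- by split=> //=; rewrite ltr01 invr1 lexx.
- move=> n [[x l] r] [/= nl /andP[r0 rn]].
  have [x' [h1 [l' [eps [e0 h2]]]]] := escape l (r / 2) n x (divr_gt0 r0 (ltr0n _ 2)).
  pose r' := Num.min (r / 2) (Num.min eps n.+2%:R^-1).
  exists (x', maxn (maxn l l') n.+1, r').
    split=> /=; first by rewrite leq_maxr.
    by rewrite !lt_min divr_gt0 // e0 invr_gt0 ltr0n !ge_min lexx !orbT.
  split=> //=.
  + by rewrite -maxnA leq_maxl.
  + by rewrite ge_min lexx.
  + move=> y hy; apply: (le_lt_trans (y := eps)); first by rewrite !ge_min lexx orbT.
    apply: (lt_le_trans (h2 y hy)); apply: (q_mono qP).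
    by rewrite -maxnA maxnCA leq_maxl.
pose x n := (u n).1.1; pose l n := (u n).1.2; pose r n := (u n).2.
have ball n m y : (n <= m)%N -> q (l m) (y - x m) <= r m -> q (l n) (y - x n) <= r n.
  move=> nm; elim: m nm => [|m ih]; first by rewrite leqn0 => /eqP->.
  rewrite leq_eqVlt => /predU1P[->//|]; rewrite ltnS => nm hy; apply: ih => //.
  have [s1 s2 s3 _] := su m.
  apply: (le_trans (q_dist_trans qP _ y (x m.+1) (x m))).
  have := q_mono qP (y - x m.+1) s1.
  by move: hy s2 s3; rewrite -/(l m) -/(r m) -/(x m) -/(r m.+1) -/(l m.+1) -/(x m.+1); lra.
have r0 n : 0 < r n by have [_ /andP[]] := gu n.
have xb n m : (n <= m)%N -> q (l n) (x m - x n) <= r n.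
  by move=> nm; apply: (ball n m) => //; rewrite subrr (q_zero nuP qP) ltW.
have rsmall eps : 0 < eps -> exists N, forall n, (N <= n)%N -> r n <= eps.
  move=> e0; have [N hN] := archimedean_ratio 1 e0; exists N => n Nn.
  by apply: le_trans (hN n Nn); rewrite div1r; have [_ /andP[]] := gu n.
have [kk eps e0|xx hx] := q_complete (u := x).
  have [N hN] := rsmall _ (divr_gt0 e0 (ltr0n R 4 : 0 < 4)).
  pose n := maxn N kk; have h := hN n (leq_maxl _ _).
  have kl : (kk <= l n)%N by apply: leq_trans (leq_maxr N kk) _; have [] := gu n.
  exists n => m m' nm nm'.
  have h1 := xb n m nm; have h2 := xb n m' nm'.
  have h3 := q_mono qP (x m - x m') kl.
  have h4 := q_dist_trans qP (l n) (x m) (x n) (x m').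
  rewrite (q_distC nuP qP _ (x n)) in h4.
  by move: h h1 h2 h3 h4 e0; lra.
have inball n : q (l n) (xx - x n) <= r n.
  apply/ler_addgt0Pr => eps e0; have [N hN] := hx (l n) eps e0.
  apply: (le_trans (q_dist_trans qP _ xx (x (maxn n N)) (x n))).
  rewrite addrC lerD ?xb ?leq_maxl //.
  by rewrite (q_distC nuP qP) ltW // hN // leq_maxr.
have [C C0 hC] := psum_bounded k xx.
have [n hn] : exists n : nat, C <= n%:R.
  by exists (Num.Def.truncn C).+1; exact: ltW (truncnS_gt _).
have [_ _ _ sn] := su n.
have := sn xx (fun N => le_trans (hC N) hn).
by rewrite (q_distC nuP qP) ltNge; move: (inball n.+1); rewrite /x /l /r => ->.
Qed.

Lemma approximable_scale k C x n : (0 < n)%N -> 0 <= C ->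
  approximable k C (n%:R *: x) -> approximable k (C / n%:R) x.
Proof.
move=> n0 C0 h l eps e0; have nR : (0 : R) < n%:R by rewrite ltr0n.
have nK : n%:R != 0 :> K by rewrite -(nu_gt0 nuP) nu_nat.
have [y hy qy] := h l _ (mulr_gt0 e0 nR).
exists (n%:R^-1 *: y).
  move=> N; rewrite psumZ (qZ qP) (nuV nuP) nu_nat mulrC.
  by rewrite ler_wpM2r // invr_ge0 ltW.
rewrite -(ler_pM2r nR) mulrC -nu_nat -(qZ qP) scalerBr scalerA divff //.
by rewrite scale1r nu_nat.
Qed.

Lemma approximable_ball k : exists l delta, 0 < delta /\ forall i x,
  q l x <= delta * 2^-1 ^+ i -> approximable k (2^-1 ^+ i) x.
Proof.
have [l [delta [C [d0 C0 h]]]] := baire_ball k.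
have [m Cm] : exists m : nat, C <= m.+1%:R.
  by exists (Num.Def.truncn C); exact: ltW (truncnS_gt _).
exists l, (delta / m.+1%:R); split=> [|i x hx]; first by rewrite divr_gt0 ?ltr0n.
pose n := (m.+1 * 2 ^ i)%N.
have n0 : (0 < n)%N by rewrite muln_gt0 expn_gt0.
have nE : n%:R = m.+1%:R * 2 ^+ i :> R by rewrite natrM natrX.
have := approximable_scale n0 C0 (x := x) (h _ _).
rewrite (qZ qP) nu_nat nE => h'.
have {h'} : approximable k (C / n%:R) x.
  rewrite nE; apply: h'.
  rewrite mulrC -ler_pdivlMr ?mulr_gt0 ?exprn_gt0 ?ltr0n //.
  by rewrite invfM mulrA -exprVn.
move=> h' l' eps e0; have [y hy qy] := h' l' eps e0; exists y => // N.
apply: (le_trans (hy N)); rewrite nE invfM mulrA exprVn ler_piMl //.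
by rewrite ler_pdivrMr ?ltr0n // mul1r.
Qed.

Lemma psum_le_mono k l x C : (k <= l)%N -> psum_le l x C -> psum_le k x C.
Proof. by move=> kl h N; apply: le_trans (h N); exact: (q_mono qP). Qed.

(** The successive approximations of the open mapping theorem. The i-th correction is
    taken for the seminorm of index k + i, so that the series of corrections is
    geometric for all seminorms at once and psum_series applies. *)
Lemma psum_ball k : exists l delta, 0 < delta /\ forall x,
  q l x <= delta -> psum_le k x 2.
Proof.
have [L hL] := choice approximable_ball.
have [D hD] := choice hL.
have D0 i : 0 < D i by have [] := hD i.
pose lev i := maxn (L (k + i)%N) i.
(* The second bound makes the remainders u i tend to 0 for every seminorm. *)
pose rad i := Num.min (D (k + i)%N * 2^-1 ^+ i) (2^-1 ^+ i).
have h2 i : 0 < 2^-1 ^+ i :> R by rewrite exprn_gt0 // invr_gt0.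
have rad0 i : 0 < rad i by rewrite lt_min mulr_gt0 /=.
exists (lev 0%N), (rad 0%N); split=> // x hx.
pose good (i : nat) (v : X) := q (lev i) v <= rad i.
pose step (i : nat) (v w : X) := psum_le (k + i) (v - w) (2^-1 ^+ i).
have [//|i v gv|u [u0 gu su]] := @dependent_choice X good step x.
  have hv : q (L (k + i)%N) v <= D (k + i)%N * 2^-1 ^+ i.
    apply: (le_trans (q_mono qP v (leq_maxl _ i))); apply: (le_trans gv).
    by rewrite ge_min lexx.
  have [y hy qy] := (hD (k + i)%N).2 i v hv (lev i.+1) _ (rad0 i.+1).
  by exists (v - y) => //; rewrite /step subKr.
pose y i := u i - u i.+1.
have sumE n : \sum_(i < n) y i = x - u n.
  elim: n => [|n ih]; first by rewrite big_ord0 u0 subrr.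
  by rewrite big_ord_recr /= ih /y subrKA.
have bnd kk : exists C, (kk = k -> C = 1) /\ forall i, psum_le kk (y i) (C * 2^-1 ^+ i).
  have [->|ne] := eqVneq kk k.
    exists 1; split=> // i; rewrite mul1r.
    exact: psum_le_mono (leq_addr i k) (su i).
  have [c hc] := choice (fun i => let: ex_intro2 C C0 h := psum_bounded kk (y i) in
    ex_intro (fun C => 0 <= C /\ psum_le kk (y i) C) C (conj C0 h)).
  pose C := 1 + \sum_(i < kk) c i * 2 ^+ i.
  have c0 i : 0 <= c i * 2 ^+ i by rewrite mulr_ge0 ?exprn_ge0 //; case: (hc i).
  exists C; split=> [E|i]; first by rewrite E eqxx in ne.
  have [ik|ki] := ltnP i kk.
    move=> N; apply: (le_trans ((hc i).2 N)).
    rewrite exprVn ler_pdivlMr ?exprn_gt0 // /C (bigD1 (Ordinal ik)) //= addrCA lerDl.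
    by rewrite addr_ge0 // sumr_ge0.
  move=> N; apply: (le_trans (psum_le_mono (leq_trans ki (leq_addl k i)) (su i) N)).
  by rewrite ler_peMl ?(ltW (h2 i)) // lerDl sumr_ge0.
have [C hC] := choice bnd.
have [x' [hx' px']] := psum_series (fun kk i => (hC kk).2 i).
have -> : x = x'.
  apply: (q_eq0_eq qP q_sep) => kk eps e0.
  have C0 : 0 <= C kk.
    by have := le_trans (q_ge0 qP _ _) ((hC kk).2 0%N 0%N); rewrite mulr1.
  have [N hN] := archimedean_ratio (1 + 2 * C kk) e0.
  pose n := maxn N kk; have {}hN := hN n (leq_maxl _ _).
  rewrite -[x](subrK (u n)) -sumE.
  have -> : \sum_(i < n) y i + u n - x' = u n - (x' - \sum_(i < n) y i).
    by rewrite opprB addrCA addrA.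
  apply: (le_trans (qB nuP qP _ _ _)); apply: le_trans hN.
  rewrite mulrDl mul1r lerD //.
    apply: (le_trans (q_mono qP _ (leq_maxr N kk : (kk <= n)%N))).
    apply: (le_trans (q_mono qP _ (leq_maxr (L (k + n)%N) n))).
    apply: (le_trans (gu n)); apply: le_trans (half_pow_small R n).
    by rewrite ge_min lexx orbT.
  apply: (le_trans (hx' kk n)).
  by rewrite ler_wpM2l ?mulr_ge0 // half_pow_small.
by have := px' k; rewrite (hC k).1 // mulr1.
Qed.

(** Homogeneity, by means of rational scalars only, turns the ball of psum_ball into an
    inequality between seminorms. *)
Lemma psum_equicontinuous k : exists k' C, 0 <= C /\
  forall x N, q k (psum N x) <= C * q k' x.
Proof.
have [l [delta [d0 h]]] := psum_ball k.
exists l, (4 / delta); split=> [|x N]; first by rewrite divr_ge0 // ltW.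
suff main b : q l x < b -> q k (psum N x) <= 4 / delta * b.
  have c0 : 0 < 4 / delta by rewrite divr_gt0.
  apply/ler_addgt0Pr => eps e0.
  have := main (q l x + eps / (4 / delta)); rewrite ltrDl divr_gt0 // => /(_ isT).
  by rewrite mulrDr mulrCA divff ?mulr1 // gt_eqF.
move=> xb; have b0 : 0 < b by exact: le_lt_trans (q_ge0 qP l x) xb.
have [m hm] : exists m : nat, b / delta < m.+1%:R.
  by exists (Num.Def.truncn (b / delta)); exact: truncnS_gt.
have m0 : (0 : R) < m.+1%:R by rewrite ltr0n.
(* The scalar n / m.+1, with n the integer part of t, sends x into the ball, and
   n is at least t / 2 because t >= 1. *)
pose t := delta * m.+1%:R / b.
have t1 : 1 <= t.
  by rewrite ler_pdivlMr // mul1r mulrC -ler_pdivrMr // ltW.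
pose n := Num.Def.truncn t.
have /andP[n1 n2] : n%:R <= t < n.+1%:R by apply: truncn_itv; rewrite (le_trans ler01).
have n0 : (0 < n)%N.
  by rewrite -(ltr_nat R) -[ltRHS](addrK 1) natr1 subr_gt0 (le_lt_trans t1).
have nR : (0 : R) < n%:R by rewrite ltr0n.
have mK : m.+1%:R != 0 :> K by rewrite -(nu_gt0 nuP) nu_nat.
have := h ((n%:R / m.+1%:R) *: x) _ N.
rewrite psumZ !(qZ qP) (nuM nuP) (nuV nuP) !nu_nat => h1.
have {}h1 : n%:R / m.+1%:R * q k (psum N x) <= 2.
  apply: h1; apply: (le_trans (y := t / m.+1%:R * b)).
    by rewrite ler_pM ?divr_ge0 ?(q_ge0 qP) ?ler0n ?(ltW xb) // ler_pM2r ?invr_gt0.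
  by rewrite /t; rewrite le_eqVlt; apply/orP; left; apply/eqP; field; rewrite (gt_eqF b0) nat1r pnatr_eq0.
rewrite mulrAC ler_pdivrMr // in h1.
rewrite mulrAC ler_pdivlMr // -(ler_pM2l nR) mulrA.
apply: (le_trans (ler_wpM2r (ltW d0) h1)).
have h2 : delta * m.+1%:R < b * n.+1%:R
  by rewrite [b * _]mulrC -ltr_pdivrMr.
have h3 : (n.+1%:R : R) <= 2 * n%:R by rewrite -natrM ler_nat; move: n0; clear; lia.
have h4 := ler_wpM2l (ltW b0) h3.
apply: (le_trans (y := 2 * (b * n.+1%:R))); first by rewrite -mulrA ler_pM2l // mulrC ltW.
apply: (le_trans (y := 2 * (b * (2 * n%:R)))); first by rewrite ler_pM2l.
by rewrite le_eqVlt; apply/orP; left; apply/eqP; ring.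
Qed.

End Expansion.

(** * Real and complex scalars *)

Definition complete_absval (R : realType) (K : fieldType) (nu : K -> R) : Prop :=
  forall u : nat -> K,
  (forall eps, 0 < eps -> exists N, forall m n, (N <= m)%N -> (N <= n)%N ->
     nu (u m - u n) < eps) ->
  exists b, forall eps, 0 < eps -> exists N, forall n, (N <= n)%N -> nu (u n - b) < eps.

Definition dense_sequence (R : realType) (K : fieldType) (nu : K -> R) (d : nat -> K) : Prop :=
  [/\ d 0%N = 0, d 1%N = 1 & forall a eps, 0 < eps -> exists n, nu (a - d n) < eps].

Section RealScalars.
Variable R : realType.

Lemma norm_complete : complete_absval (fun a : R => `|a|).
Proof.
move=> u hu.
have : cvg (u @ \oo).
  apply/cauchy_cvgP; apply: cauchy_exP => eps e0.
  have [N hN] := hu eps e0; exists (u N).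
  exists N => // n /= Nn; rewrite /ball /=; exact: hN.
move=> /cvg_ex[b hb]; exists b => eps e0.
have [N _ hN] := (cvgrPdist_lt _ _).1 hb eps e0.
by exists N => n Nn; rewrite distrC; exact: hN.
Qed.

Lemma rat_dense (a eps : R) : 0 < eps -> exists r : rat, `|a - ratr r| < eps.
Proof.
move=> e0; have [r] : exists r : rat, ratr r \in `]a - eps, a + eps[.
  by apply: rat_in_itvoo; rewrite ltrD2l gtrN.
rewrite in_itv /= => /andP[h1 h2]; exists r.
by rewrite ltr_norml; apply/andP; split; lra.
Qed.

Lemma real_dense_sequence : exists d, dense_sequence (fun a : R => `|a|) d.
Proof.
exists (fun n => if n is m.+2 then ratr (odflt 0 (unpickle m : option rat)) else n%:R).
split=> // a eps e0; have [r hr] := rat_dense a e0.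
by exists (pickle r).+2; rewrite pickleK.
Qed.

Lemma norm_absolute_value : absolute_value (fun a : R => `|a|).
Proof.
split=> [a|a|a b|a b]; [exact: normr_ge0| |exact: normrM|exact: ler_normD].
by split=> [/eqP|->]; [rewrite normr_eq0 => /eqP|rewrite normr0].
Qed.

End RealScalars.

Section ComplexScalars.
Variable R : realType.
Import ComplexField.Normc.
Local Notation C := (R[i])%C.

Lemma normc_le (z : C) : normc z <= `|complex.Re z| + `|complex.Im z|.
Proof.
case: z => a b /=; rewrite -(@ler_pXn2r _ 2) ?nnegrE ?sqrtr_ge0 ?addr_ge0 //.
rewrite sqr_sqrtr ?addr_ge0 ?sqr_ge0 // sqrrD !real_normK ?num_real //.
by rewrite addrAC lerDl mulrn_wge0 // mulr_ge0.
Qed.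

Lemma normRe_le (z : C) : `|complex.Re z| <= normc z.
Proof.
by case: z => a b /=; rewrite -sqrtr_sqr ler_wsqrtr // lerDl sqr_ge0.
Qed.

Lemma normIm_le (z : C) : `|complex.Im z| <= normc z.
Proof.
by case: z => a b /=; rewrite -sqrtr_sqr ler_wsqrtr // lerDr sqr_ge0.
Qed.

Lemma normc_absolute_value : absolute_value (@normc R : C -> R).
Proof.
split=> [[a b]|a|a b|a b].
- exact: sqrtr_ge0.
- by split=> [/eq0_normc|->] //; rewrite normc0.
- exact: normcM.
- exact: le_normcD.
Qed.

Lemma normc_complete : complete_absval (@normc R : C -> R).
Proof.
move=> u hu.
have [|a ha] := @norm_complete R (fun n => complex.Re (u n)).
  move=> eps e0; have [N hN] := hu eps e0; exists N => m n Nm Nn.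
  by apply: le_lt_trans (hN m n Nm Nn); rewrite -raddfB normRe_le.
have [|b hb] := @norm_complete R (fun n => complex.Im (u n)).
  move=> eps e0; have [N hN] := hu eps e0; exists N => m n Nm Nn.
  by apply: le_lt_trans (hN m n Nm Nn); rewrite -raddfB normIm_le.
exists (a +i* b)%C => eps e0; have e2 : 0 < eps / 2 by rewrite divr_gt0.
have [N hN] := ha _ e2; have [M hM] := hb _ e2.
exists (maxn N M) => n; rewrite geq_max => /andP[Nn Mn].
apply: (le_lt_trans (normc_le _)); rewrite [eps]splitr !raddfB ltrD //=.
  exact: hN.
exact: hM.
Qed.

Lemma complex_dense_sequence : exists d, dense_sequence (@normc R : C -> R) d.
Proof.
exists (fun n => if n is m.+2 then
   (let r := odflt (0, 0) (unpickle m : option (rat * rat)) in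
    (ratr r.1 +i* ratr r.2)%C) else n%:R).
split=> // z eps e0; have e2 : 0 < eps / 2 by rewrite divr_gt0.
have [r hr] := rat_dense (complex.Re z) e2.
have [t ht] := rat_dense (complex.Im z) e2.
exists (pickle (r, t)).+2; rewrite pickleK /=.
apply: (le_lt_trans (normc_le _)); rewrite [eps]splitr !raddfB ltrD //=.
Qed.

End ComplexScalars.

Lemma modulus_absolute_value (R : realType) (s : scalar_kind) :
  absolute_value (@modulus R s : scalars R s -> R).
Proof. by case: s; [exact: norm_absolute_value|exact: normc_absolute_value]. Qed.

Lemma modulus_complete (R : realType) (s : scalar_kind) :
  complete_absval (@modulus R s : scalars R s -> R).
Proof. by case: s; [exact: norm_complete|exact: normc_complete]. Qed.

Lemma modulus_dense (R : realType) (s : scalar_kind) :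
  exists d, dense_sequence (@modulus R s : scalars R s -> R) d.
Proof. by case: s; [exact: real_dense_sequence|exact: complex_dense_sequence]. Qed.

Lemma modulus_nat (R : realType) (s : scalar_kind) n :
  modulus (n%:R : scalars R s) = n%:R.
Proof.
case: s => /=; first by rewrite normr_nat.
by rewrite normcMn ComplexField.Normc.normc1.
Qed.

(** * Enumerating approximate polynomials *)

Section Schedule.
Variables (R : realType) (K : fieldType) (nu : K -> R) (d : nat -> K).
Hypothesis nuP : absolute_value nu.
Hypothesis dP : dense_sequence nu d.

(** The free first component of the code makes every task occur infinitely often. *)
Definition task (s : nat) : nat * (nat * seq nat) :=
  odflt (0%N, (0%N, [::])) (unpickle s).

Definition scheduled_poly (s : nat) : {poly K} :=
  let p := Poly (map d (task s).2.2) in if (size p <= s.+1)%N then p else 0.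

Definition scheduled_index (s : nat) : nat := (task s).2.1.

Lemma size_scheduled s : (size (scheduled_poly s) <= s.+1)%N.
Proof. by rewrite /scheduled_poly; case: ifP => //; rewrite size_poly0. Qed.

Lemma scheduled_often (l : seq nat) k s0 : exists s, [/\ (s0 <= s)%N,
  scheduled_index s = k & scheduled_poly s = Poly (map d l)].
Proof.
pose code m := pickle ((m, (k, l)) : nat * (nat * seq nat)).
have code_inj : injective code.
  by move=> m m' /(pcan_inj pickleK) [].
pose b := maxn s0 (size (Poly (map d l))).
have [m hm] : exists m, (b <= code m)%N.
  apply: contrapT => no.
  have lt m : (code m < b)%N by rewrite ltnNge; apply/negP => h; apply: no; exists m.
  pose g (i : 'I_b.+1) : 'I_b := Ordinal (lt i).
  have g_inj : injective g by move=> i i' /(congr1 val) /= /code_inj /val_inj.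
  by have := leq_card g g_inj; rewrite !card_ord ltnn.
exists (code m); rewrite /scheduled_index /scheduled_poly /task pickleK /=.
move: hm; rewrite /b geq_max => /andP[h1 h2]; split=> //.
by rewrite (leq_trans h2).
Qed.

Lemma schedule_one k s0 : exists s, [/\ (s0 <= s)%N,
  scheduled_index s = k & scheduled_poly s = 1].
Proof.
have [s [h1 h2 h3]] := scheduled_often [:: 1%N] k s0; exists s; split=> //.
by rewrite h3 /=; have [_ -> _] := dP; rewrite cons_poly_def mul0r add0r.
Qed.

(** The entries of r are replaced by nearby terms of the dense sequence d, with 0
    replaced by itself so that a vanishing constant term is kept. *)
Lemma schedule_dense (r : {poly K}) (rho : R) k s0 : 0 < rho ->
  exists s, [/\ (s0 <= s)%N, scheduled_index s = k,
    (size (scheduled_poly s) <= size r)%N,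
    l1norm nu (scheduled_poly s - r) <= rho & r`_0 = 0 -> (scheduled_poly s)`_0 = 0].
Proof.
move=> rho0; have [d0 _ dd] := dP.
pose eta := rho / (size r).+1%:R.
have eta0 : 0 < eta by rewrite divr_gt0 ?ltr0n.
have ex (a : K) : exists n, nu (a - d n) <= eta /\ (a = 0 -> d n = 0).
  have [->|a0] := eqVneq a 0.
    by exists 0%N; rewrite d0 subrr (nu0 nuP) ltW.
  have [n hn] := dd a eta eta0; exists n; split; first exact: ltW.
  by move=> E; rewrite E eqxx in a0.
have [c hc] := choice ex.
pose l := map c (polyseq r).
have [s [h1 h2 h3]] := scheduled_often l k s0; exists s.
have coefE i : (scheduled_poly s)`_i = if (i < size r)%N then d (c r`_i) else 0.
  rewrite h3 coef_Poly; case: ltnP => ir.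
    by rewrite (nth_map 0%N) ?size_map // (nth_map 0).
  by rewrite nth_default // !size_map.
split=> //.
- apply/leq_sizeP => i ri; rewrite coefE ltnNge ri //.
- have sl : (size (scheduled_poly s - r)%R <= size r)%N.
    by apply/leq_sizeP => i ri; rewrite coefB coefE ltnNge ri /= nth_default // subrr.
  rewrite (l1E nuP sl); apply: (le_trans (y := \sum_(i < size r) eta)).
    apply: ler_sum => i _; rewrite coefB coefE ltn_ord -(nuN nuP) opprB.
    by have [] := hc r`_i.
  rewrite sumr_const card_ord -mulr_natl /eta mulrCA ler_piMr ?(ltW rho0) //.
  by rewrite ler_pdivrMr ?ltr0n // mul1r ler_nat.
- move=> r0; rewrite coefE; case: ifP => // _.
  by rewrite r0; have [_ ->] := hc 0.
Qed.

End Schedule.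

(** * From the Schauder basis to the operator *)

Section Assembly.
Variables (R : realType) (K : fieldType) (nu : K -> R) (d : nat -> K).
Variables (X : lmodType K) (q : nat -> X -> R) (e : nat -> X).
Hypothesis nuP : absolute_value nu.
Hypothesis nu_nat : forall n, nu n%:R = n%:R.
Hypothesis nu_complete : complete_absval nu.
Hypothesis dP : dense_sequence nu d.
Hypothesis qP : seminorms nu q.
Hypothesis q_complete : complete_seminorms q.
Hypothesis q_sep : forall x, (forall k, q k x = 0) -> x = 0.
Hypothesis e_gt0 : forall n, 0 < q 0 (e n).
Variable a : nat -> X -> K.
Hypothesis a_expands : forall x, expands q e (a^~ x) x.
Hypothesis a_unique : forall x b, expands q e b x -> forall i, b i = a i x.
Hypothesis chains : has_chains q e.

Lemma coordinate_bound k : exists k' C, 0 <= C /\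
  forall i x, nu (a i x) * q k (e i) <= C * q k' x.
Proof.
have [k' [C [C0 hC]]] := psum_equicontinuous nuP nu_nat nu_complete qP
  q_complete q_sep e_gt0 a_expands a_unique k.
exists k', (C + C); split=> [|i x]; first by rewrite addr_ge0.
have -> : nu (a i x) * q k (e i) = q k (psum e a i.+1 x - psum e a i x).
  by rewrite /psum big_ord_recr /= addrAC subrr add0r (qZ qP).
by apply: (le_trans (qB nuP qP _ _ _)); rewrite mulrDl lerD.
Qed.

(** Since basis_sequence uses every basis vector, the coordinates with respect to z
    separate points and the polynomials in T applied to z 0 are dense. *)
Lemma dense_orbits_operator : exists T : {linear X -> X}, bounded_operator q T /\
  forall M : set X,
    (forall x, (forall k eps, 0 < eps -> exists2 y, M y & q k (y - x) <= eps) -> M x) ->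
    (forall x, M x -> M (T x)) -> (exists2 x, M x & x != 0) -> forall y, M y.
Proof.
pose P := scheduled_poly d; pose j := scheduled_index.
have sizeP : forall s, (size (P s) <= s.+1)%N := size_scheduled d.
have [dd [d_valid d_onto d_spec]] :=
  basis_sequence nuP nu_nat qP e_gt0 chains j sizeP.
have d0 i : (dd i).2 != 0 by apply: (d_valid i).1; exact: stage_start_gt.
have d_inj i i' : (dd i).1 = (dd i').1 -> i = i'.
  have h m m' : (m < m')%N -> (dd m).1 <> (dd m').1.
    by move=> mm; apply: (d_valid m').2 => //; exact: stage_start_gt.
  by move=> E; case: (ltngtP i i') => // /h; rewrite E.
pose z := vec e dd.
have z_gt0 i : 0 < q 0 (z i).
  by apply: (vec_gt0 nuP qP e_gt0 (d_valid i)); exact: stage_start_gt.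
pose coord i x := (dd i).2^-1 * a (dd i).1 x.
have aL := a_linear nuP qP a_expands a_unique.
have coord_linear i (c : K) x y : coord i (c *: x + y) = c * coord i x + coord i y.
  by rewrite /coord aL mulrDr mulrCA.
have a0 i : a i 0 = 0.
  by have := aL i (-1) 0 0; rewrite scaler0 addr0 mulN1r addNr.
have aZ i c x : a i (c *: x) = c * a i x.
  by rewrite -[c *: x]addr0 aL a0 addr0.
have coord_z i i' : coord i (z i') = (i == i')%:R.
  rewrite /coord /z /vec aZ (a_basis nuP qP a_unique).
  have [->|ne] := eqVneq i i'; first by rewrite eqxx mulr1 mulVf.
  by case: eqP => [/d_inj E|_]; rewrite ?mulr0 //; rewrite E eqxx in ne.
have coord_bound k : exists k' C, 0 <= C /\
    forall i x, nu (coord i x) * q k (z i) <= C * q k' x.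
  have [k' [C [C0 hC]]] := coordinate_bound k; exists k', C; split=> // i x.
  have nd : nu (dd i).2 != 0 by rewrite (nu_eq0 nuP).
  rewrite /coord /z /vec (qZ qP) (nuM nuP) (nuV nuP) mulrACA mulVf //.
  by rewrite mul1r hC.
have coord_sep x : (forall i, coord i x = 0) -> x = 0.
  move=> h; apply: (q_eq0_eq qP q_sep) => k eps e0.
  have [N hN] := a_expands x k e0; have := hN N (leqnn N).
  rewrite big1 ?sub0r ?(qN nuP qP) => [/ltW|n _]; first by rewrite subr0.
  have [i _ <-] := d_onto n; have /eqP := h i.
  by rewrite mulf_eq0 invr_eq0 (negbTE (d0 i)) => /eqP->; rewrite scale0r.
have Phi_dense x k eps : 0 < eps -> exists p, q k (x - orbit_sum P z p) < eps.
  move=> e0; have [N hN] := a_expands x k e0.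
  have ex n : exists p, orbit_sum P z p = e n.
    have [i _ E] := d_onto n; exists ((dd i).2^-1 *: zpoly P i).
    by rewrite linearZ /= (Phi_zeta sizeP) /z /vec E scalerA mulVf // scale1r.
  have [g hg] := choice ex; exists (\sum_(n < N) a n x *: g n).
  rewrite (q_distC nuP qP) linear_sum /=.
  under eq_bigr do rewrite linearZ /= hg.
  exact: hN.
have [T0 [T0_lin T0_bd T0_series]] := operator_exists nuP qP q_complete q_sep
  sizeP z_gt0 d_spec coord_linear coord_bound.
pose T : {linear X -> X} := HB.pack T0 (GRing.isLinear.Build K X X *:%R T0 T0_lin).
exists T; split=> // M; apply: (@closed_invariant_full _ _ _ _ _ nuP qP q_sep P j z sizeP
  (fun r rho k s0 => schedule_dense nuP dP r k s0)
  (schedule_one dP) z_gt0 d_spec coord coord_linear coord_z coord_bound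
  coord_sep Phi_dense T) => //.
Qed.

End Assembly.

(** * Chains indexed by pairs *)

Section Lexicographic.
Variables J M : nat.
Hypothesis M_gt0 : (0 < M)%N.

(** The pair of lexicographic rank i, both components counted from 1. *)
Definition cell (i : nat) : nat * nat := ((i %/ M).+1, (i %% M).+1).

Lemma cell_index i : (i < J * M)%N -> index_set J M (cell i).
Proof.
move=> h; split=> /=; last by rewrite ltn_pmod.
by rewrite ltn_divLR.
Qed.

Lemma cell_onto (c : nat * nat) : index_set J M c -> exists2 i, (i < J * M)%N & c = cell i.
Proof.
case: c => [[|b] [|m]] [/= h1 h2] //; exists (b * M + m)%N.
  by apply: (@leq_trans (b.+1 * M)); rewrite ?leq_mul2r ?h1 ?orbT // mulSn addnC ltn_add2r.
by rewrite /cell divnMDl // modnMDl divn_small // modn_small // addn0.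
Qed.

Lemma cell_lt i k : ((cell i : nat *l nat) < (cell k : nat *l nat))%O = (i < k)%N.
Proof.
have -> : ((cell i : nat *l nat) < (cell k : nat *l nat))%O =
  (i %/ M <= k %/ M)%N && ((k %/ M <= i %/ M)%N ==> (i %% M < k %% M)%N) by [].
have Ei := divn_eq i M; have Ek := divn_eq k M.
have ri : (i %% M < M)%N by rewrite ltn_pmod.
have rk : (k %% M < M)%N by rewrite ltn_pmod.
move: (i %/ M)%N (k %/ M)%N (i %% M)%N (k %% M)%N Ei Ek ri rk => a b r t -> -> ra tb.
case: (ltngtP a b) => [ab|ba|->] /=.
- by symmetry; apply: (@leq_trans (a.+1 * M)); [rewrite mulSn addnC ltn_add2r|
    rewrite (@leq_trans (b * M)) ?leq_addr // leq_mul2r ab orbT].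
- symmetry; apply/negbTE; rewrite -leqNgt ltnW //.
  by apply: (@leq_trans (b.+1 * M)); [rewrite mulSn addnC ltn_add2r|
    rewrite (@leq_trans (a * M)) ?leq_addr // leq_mul2r ba orbT].
- by rewrite ltn_add2l.
Qed.

Lemma cell_le i k : ((cell i : nat *l nat) <= (cell k : nat *l nat))%O = (i <= k)%N.
Proof. by rewrite leNgt cell_lt -leqNgt. Qed.

Lemma cell_next i : (i.+1 < J * M)%N -> is_next J M (cell i) (cell i.+1).
Proof.
move=> h; split; [exact: cell_index|by rewrite cell_lt|].
by move=> c /cell_onto[k _ ->]; rewrite cell_lt cell_le.
Qed.

Lemma cell_next_iter l i : (i + l < J * M)%N -> is_next_iter J M l (cell i) (cell (i + l)).
Proof.
elim: l i => [|l ih] i h /=; first by rewrite addn0.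
exists (cell i.+1); first by apply: cell_next; rewrite (leq_ltn_trans _ h) // addnS ltnS leq_addr.
by rewrite -addSnnS; apply: ih; rewrite addSnnS.
Qed.

Lemma cell_inj : injective cell.
Proof. by move=> i k [h1 h2]; rewrite (divn_eq i M) (divn_eq k M) h1 h2. Qed.

End Lexicographic.

(** * The topology of a Frechet space in terms of its seminorms *)

Section FrechetSpace.
Variables (R : realType) (s : scalar_kind) (X : topologicalLmodType (scalars R s)).
Variable p : nat -> X -> R.
Hypothesis pF : frechet_space p.

Definition seminorm_seq (k : nat) (x : X) : R := p k.+1 x.
Local Notation q := seminorm_seq.

Lemma frechet_seminorms : seminorms (@modulus R s) q.
Proof.
have [hs hm _ _ _] := pF.
split=> k; [have [h _ _] := hs k.+1 isT|have [_ h _] := hs k.+1 isT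
  |have [_ _ h] := hs k.+1 isT|by move=> x; exact: hm]; exact: h.
Qed.

Let qP := frechet_seminorms.
Let nuP := @modulus_absolute_value R s.

Lemma frechet_separating x : (forall k, q k x = 0) -> x = 0.
Proof. by have [_ _ hsep _ _] := pF => h; apply: hsep => -[//|j] _; exact: h. Qed.

Lemma nbhs_seminorm x (A : set X) : nbhs x A <->
  exists k eps, 0 < eps /\ forall y, q k (y - x) < eps -> A y.
Proof.
have [_ _ _ ht _] := pF; split=> [/ht[J [r [r0 hJ]]]|[k [eps [e0 hk]]]].
  exists J, r; split=> // y hy; apply: hJ => -[//|j] /andP[_ jJ].
  by apply: le_lt_trans hy; exact: (q_mono qP _ (ltnW jJ)).
by apply/ht; exists k.+1, eps; split=> // y hy; apply: hk; apply: hy; rewrite /= ltnSn.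
Qed.

Lemma cvg_seminorm (u : nat -> X) x : (u @ \oo --> x) <->
  forall k eps, 0 < eps -> exists N, forall n, (N <= n)%N -> q k (u n - x) < eps.
Proof.
split=> [ux k eps e0|h A /nbhs_seminorm[k [eps [e0 hA]]]].
  have /ux[N _ hN] : nbhs x [set y | q k (y - x) < eps].
    by apply/nbhs_seminorm; exists k, eps.
  by exists N => n Nn; exact: hN.
by have [N hN] := h k eps e0; exists N => // n /= Nn; apply: hA; exact: hN.
Qed.

Lemma closed_seminorm (A : set X) : closed A -> forall x,
  (forall k eps, 0 < eps -> exists2 y, A y & q k (y - x) <= eps) -> A x.
Proof.
move=> Acl x h; apply: Acl => B /nbhs_seminorm[k [eps [e0 hB]]].
have e2 : 0 < eps / 2 by rewrite divr_gt0.
have [y Ay qy] := h k _ e2; exists y; split=> //; apply: hB.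
by apply: le_lt_trans qy _; rewrite ltr_pdivrMr // mulr_natr mulr2n ltrDl.
Qed.

Lemma continuous_seminorm (T : {linear X -> X}) : bounded_operator q T -> continuous T.
Proof.
move=> Tb x A /nbhs_seminorm[k [eps [e0 hA]]]; apply/nbhs_seminorm.
have [k' [C [C0 hC]]] := Tb k; have C1 : 0 < C + 1 by rewrite ltr_wpDl.
exists k', (eps / (C + 1)); split=> [|y hy]; first by rewrite divr_gt0.
apply: hA; rewrite -linearB; apply: (le_lt_trans (hC _)).
rewrite ltr_pdivlMr // mulrC in hy; apply: le_lt_trans hy.
by rewrite ler_wpM2r ?(q_ge0 qP) // lerDl.
Qed.

Let dsum x (n : nat) : R := \sum_(1 <= j < n) 2 ^- j * Num.min 1 (p j x).

Let dterm_ge0 x j : (1 <= j)%N -> 0 <= 2 ^- j * Num.min 1 (p j x).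
Proof.
case: j => // j _; rewrite mulr_ge0 ?invr_ge0 ?exprn_ge0 //.
by rewrite le_min ler01 (q_ge0 qP j x).
Qed.

Let dsum_mono x : nondecreasing_seq (dsum x).
Proof.
apply/nondecreasing_seqP => -[|n]; first by rewrite /dsum !big_geq.
by rewrite /dsum [leRHS]big_nat_recr //= lerDl dterm_ge0.
Qed.

Let dsum_le x k n : dsum x n <= q k x + 2 ^- k.+1.
Proof.
pose N := maxn n k.+2.
apply: (le_trans (dsum_mono x (leq_maxl n k.+2))); rewrite -/N /dsum.
rewrite (big_cat_nat (n := k.+2)) ?leq_maxr //=; apply: lerD.
  apply: (le_trans (y := \sum_(1 <= j < k.+2) 2^-1 ^+ j * q k x)).
    rewrite big_nat [leRHS]big_nat; apply: ler_sum => -[//|j] /andP[_ jk].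
    rewrite exprVn ler_wpM2l ?invr_ge0 ?exprn_ge0 // ge_min; apply/orP; right.
    exact: (q_mono qP x (_ : j <= k)%N).
  rewrite -mulr_suml ler_piMl ?(q_ge0 qP) //.
  by have := @sum_half_pow R 1 k.+1; rewrite add1n expr1 divff.
apply: (le_trans (y := \sum_(k.+2 <= j < N) 2^-1 ^+ j)).
  rewrite big_nat [leRHS]big_nat; apply: ler_sum => j _.
  by rewrite exprVn ler_piMr ?invr_ge0 ?exprn_ge0 // ge_min lexx.
have -> : N = (k.+2 + (N - k.+2))%N by rewrite subnKC // leq_maxr.
apply: (le_trans (sum_half_pow _ _ _)).
by rewrite exprS mulrA divff // mul1r exprVn.
Qed.

Let dsum_cvg x : cvgn (dsum x).
Proof.
apply: nondecreasing_is_cvgn; first exact: dsum_mono.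
by exists (q 0 x + 2 ^- 1) => _ [n _ <-]; exact: dsum_le.
Qed.

Lemma dist_le k x y : frechet_dist p x y <= q k (x - y) + 2 ^- k.+1.
Proof.
apply: limr_le; first exact: dsum_cvg.
by apply: nearW => n; exact: dsum_le.
Qed.

Lemma min_le_dist k x y : Num.min 1 (q k (x - y)) <= 2 ^+ k.+1 * frechet_dist p x y.
Proof.
rewrite -ler_pdivrMl ?exprn_gt0 //.
apply: (@le_trans _ _ (dsum (x - y) k.+2)); last first.
  exact: (nondecreasing_cvgn_le (@dsum_mono (x - y)) (@dsum_cvg (x - y)) k.+2).
rewrite /dsum big_nat_recr //= lerDr big_nat sumr_ge0 // => j /andP[j1 _].
exact: dterm_ge0.
Qed.

Lemma frechet_complete : complete_seminorms q.
Proof.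
have [_ _ _ _ hc] := pF => u hu.
have [eps e0|x hx] := hc u.
  have e2 : 0 < eps / 2 by rewrite divr_gt0.
  have [k hk] := archimedean_ratio 1 e2; have {}hk := hk k (leqnn k).
  have [N hN] := hu k _ e2; exists N => m n Nm Nn.
  apply: (le_lt_trans (dist_le k _ _)); rewrite [eps]splitr ltr_leD ?hN //.
  apply: le_trans hk; rewrite -exprVn exprS div1r.
  apply: le_trans (half_pow_small R k).
  by rewrite ler_piMl ?exprn_ge0 ?invr_ge0 // invf_le1 // ler1n.
exists x => k eps e0.
pose m := Num.min 1 eps; have m0 : 0 < m by rewrite lt_min ltr01.
have d0 : 0 < m / 2 ^+ k.+1 by rewrite divr_gt0 ?exprn_gt0.
have [N _ hN] := (cvgrPdist_lt _ _).1 hx _ d0; exists N => n Nn.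
have := hN n Nn; rewrite sub0r normrN => /(le_lt_trans (ler_norm _)).
rewrite ltr_pdivlMr ?exprn_gt0 // mulrC => /(le_lt_trans (min_le_dist k _ _)).
by rewrite gt_min /m !lt_min ltxx /= => /andP[].
Qed.

End FrechetSpace.

Theorem theorem3p3 (R : realType) (s : scalar_kind)
    (X : topologicalLmodType (scalars R s)) (p : nat -> X -> R) (e : nat -> X)
    (X_frechet : frechet_space p)
    (e_basis : schauder_basis e)
    (p1e_gt0 : forall n : nat, 0 < p 1%N (e n))
    (e_seq : forall (eps C : R) (M N J K : nat),
       0 < eps -> 1 <= C -> (1 <= M)%N -> (1 <= N)%N ->
       (2 <= J)%N -> (J <= K)%N ->
       exists (n : nat * nat -> nat) (alpha : nat * nat -> scalars R s),
         [/\ forall i, index_set J M i -> (N < n i)%N,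
             forall i i', index_set J M i -> index_set J M i' ->
               i <> i' -> n i <> n i',
             forall i, index_set J M i -> alpha i <> 0 &
             forall j m : nat, (1 <= j <= J)%N -> (1 <= m <= M)%N ->
               [/\ p (J - 1)%N (alpha (1%N, m) *: e (n (1%N, m))) <= eps,
                   eps^-1 <= p 1%N (alpha (J, m) *: e (n (J, m))) &
                   forall (l : nat) (i' : nat * nat), (1 <= l <= M)%N ->
                     is_next_iter J M l (j, m) i' ->
                     forall k : nat, (1 <= k < K)%N ->
                       C * p k (alpha i' *: e (n i'))
                         <= p k.+1 (alpha (j, m) *: e (n (j, m)))]]) :
  ~ invariant_subset_property X.
Proof.
pose q := seminorm_seq p.
have nuP := @modulus_absolute_value R s.
have qP : seminorms (@modulus R s) q := frechet_seminorms X_frechet.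
have [d dP] := modulus_dense R s.
have chains : has_chains q e.
  move=> eps C M N j kk e0 C1 M0.
  have J2 : (2 <= j.+2)%N by [].
  (* K exceeds both the number of rows and kk. *)
  have [n [al [h1 h2 h3 h4]]] := e_seq eps C M N.+1 j.+2 (j.+2 + kk.+1)%N e0 C1 M0
    (ltn0Sn N) J2 (leq_addr _ _).
  have idx := @cell_index j.+2 M M0.
  have jm i : (i < j.+2 * M)%N -> (1 <= (cell M i).1 <= j.+2)%N /\ (1 <= (cell M i).2 <= M)%N.
    exact: idx.
  exists (n \o cell M), (al \o cell M); split=> /=.
  - move=> i /idx hi; split; first by apply: ltn_trans (h1 _ hi).
    by apply/eqP; exact: h3.
  - move=> i i' ii' hi'; apply: h2; [exact: idx (ltn_trans ii' hi')|exact: idx|].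
    by move=> /(@cell_inj M) E; rewrite E ltnn in ii'.
  - move=> i iM; have ij : (i < j.+2 * M)%N by rewrite mulSn ltn_addr.
    have [hi1 hi2] := jm i ij; have [+ _ _] := h4 _ _ hi1 hi2.
    by rewrite subn1 /cell /= divn_small.
  - move=> i jM ij; have [hi1 hi2] := jm i ij; have [_ + _] := h4 _ _ hi1 hi2.
    suff -> : cell M i = (j.+2, (i %% M).+1) by [].
    rewrite /cell; congr (_.+1, _); apply/eqP; rewrite eqn_leq.
    by rewrite leq_divRL // jM andbT -ltnS ltn_divLR.
  - move=> i i' k ii' i'iM i'j kkk; have ij := ltn_trans ii' i'j.
    have [hi1 hi2] := jm i ij; have [_ _ h5] := h4 _ _ hi1 hi2.
    have := h5 (i' - i)%N (cell M i'); rewrite subn_gt0 ii' leq_subLR i'iM.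
    have := @cell_next_iter j.+2 M M0 (i' - i)%N i; rewrite subnKC ?(ltnW ii') // => /(_ i'j) h6.
    move=> /(_ isT h6 k.+1); apply.
    by move: kkk; clear; lia.
have [a ha] : exists a : nat -> X -> scalars R s, forall x,
    expands q e (a^~ x) x /\ forall b, expands q e b x -> forall i, b i = a i x.
  have ex x : exists a : nat -> scalars R s, expands q e a x /\
      forall b, expands q e b x -> forall i, b i = a i.
    have expE b : expands q e b x <->
        ((fun n => \sum_(0 <= k < n) b k *: e k) @ \oo --> x).
      split=> h.
        by apply/(cvg_seminorm X_frechet) => k eps e0; have [N hN] := h k eps e0;
           exists N => n Nn; rewrite big_mkord; exact: hN.
      move=> k eps e0; have [N hN] := (cvg_seminorm X_frechet _ _).1 h k eps e0.
      by exists N => n Nn; rewrite -(big_mkord xpredT (fun i => b i *: e i)); exact: hN.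
    have [a [a1 a2]] := e_basis x; exists a; split; first exact/expE.
    by move=> b /expE /a2 ->.
  by have [a ha] := choice ex; exists (fun i x => a x i).
have [T [T_bd T_dense]] := @dense_orbits_operator R _ (@modulus R s) d X q e nuP
  (@modulus_nat R s) (@modulus_complete R s) dP qP (frechet_complete X_frechet)
  (frechet_separating X_frechet) p1e_gt0 a (fun x => (ha x).1) (fun x => (ha x).2) chains.
move=> /(_ T (continuous_seminorm X_frechet T_bd)) [A [[x0 Ax0] Acl A0 AT TA]].
apply: AT; apply/seteqP; split=> // y _.
apply: (T_dense A (closed_seminorm X_frechet Acl)).
  by move=> x Ax; apply: TA; exists x.
apply: contrapT => no; apply: A0; apply/seteqP; split=> [x Ax|_ ->].
  by apply: contrapT => /eqP xn0; apply: no; exists x.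
have [->//|ne] := eqVneq 0 x0; by case: no; exists x0 => //; rewrite eq_sym.
Qed.
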